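(* Let $n\ge 2$, $p,q\in\mathbf{R}^n$, let $v,w\in\mathbf{R}^n$ be unit vectors, and let $\Lambda>0$. Let $\gamma:I=[0,L]\to\mathbf{R}^n$ be a shortest curve in $\mathcal{C}(p,q;v,w;\Lambda)$, parametrized by arclength. (a) If $\gamma$ does not have constant curvature $\Lambda$, i.e. $\kappa\gamma(s_0)<\Lambda$ for some $s_0\in[0,L]$, then there exist $a_0$ and $b_0$ such that $s_0\in[a_0,b_0]\subset[0,L]$ and $\gamma|_{[a_0,b_0]}$ is a $CLC(\Lambda)$ curve in which each circular part has length at least $\frac{\pi}{\Lambda}$ unless it contains the initial or terminal point of $\gamma$. (b) If $R_O(\gamma(I),\mathbf{R}^n)\ge\frac1\Lambda$ and $\gamma$ does not have constant curvature $\Lambda$, then $\gamma$ is a $CLC(\Lambda)$ curve.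
   Context: A $C^{1,1}$ curve is a $C^1$ curve whose derivative is Lipschitz; derivatives at endpoints of intervals are one-sided, and $L>0$. (Generalized) curvature: for a $C^1$ curve $\gamma$ with $\gamma'\ne0$, $\kappa\gamma(s)=\limsup_{t\neq u,\; t,u\to s}\frac{\measuredangle(\gamma'(t),\gamma'(u))}{\ell_{tu}(\gamma)}$, where $\measuredangle$ is the angle in $[0,\pi]$ and $\ell_{tu}(\gamma)$ is the length of $\gamma$ between the parameters $t$ and $u$. $\mathcal{C}(p,q;v,w;\Lambda)$ is the set of all $C^{1,1}$ curves $\gamma:[0,L]\to\mathbf{R}^n$ with $\gamma(0)=p$, $\gamma'(0)=v$, $\gamma(L)=q$, $\gamma'(L)=w$, $\|\gamma'\|\equiv1$ and $\kappa\gamma\le\Lambda$ on $[0,L]$, where $L=\ell(\gamma)$ is not fixed. A shortest curve in this set is an element of minimal length $L$. A $C^{1,1}$ curve $\gamma:[a,b]\to\mathbf{R}^n$ is a $CLC(\Lambda)$ (circle-line-circle) curve if there are $a\le c\le d\le b$ such that (i) $\gamma([c,d])$ is a line segment of possibly zero length, and (ii) each of $\gamma([a,c])$ and $\gamma([d,b])$ (the circular parts) is a planar circular arc of radius $\frac1\Lambda$ and of length in $[0,\frac{2\pi}{\Lambda})$; $\gamma$ itself need not be planar. For $x\in\mathbf{R}^n$, a unit vector $u$ and $r>0$, let $O_x(u,r)=\{y\in\mathbf{R}^n:\exists z\in\mathbf{R}^n,\ u\cdot z=0,\ \|z\|=1,\ \|y-x-rz\|<r\}$, the union of the open balls of radius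 $r$ tangent to the direction $u$ at $x$. For a $C^1$ curve with unit speed parametrization $\gamma$ and image $K$, let $O(r;K)=\bigcup_s O_{\gamma(s)}(\gamma'(s),r)$ and define the ball radius $R_O(K,\mathbf{R}^n)=\inf\{r>0:O(r;K)\cap K\neq\emptyset\}$ (with $\inf\emptyset=\infty$). *)

(* Defs.v *)
From HB Require Import structures.
From mathcomp Require Import all_boot all_order all_algebra.
From mathcomp Require Import all_classical all_reals all_analysis.

Set Implicit Arguments.
Unset Strict Implicit.
Unset Printing Implicit Defensive.

Import Order.TTheory GRing.Theory Num.Theory.
Import numFieldNormedType.Exports.

Local Open Scope classical_set_scope.
Local Open Scope ring_scope.

(* The norm that the library puts on 'rV[R]_n is the sup norm, so Euclidean
   geometry goes through [dotv] and [enorm].  The library's topology and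
   Lipschitz notion are unaffected by this choice of (equivalent) norm. *)
Definition dotv (R : realType) (n : nat) (u v : 'rV[R]_n) : R :=
  \sum_(i < n) u 0 i * v 0 i.

Definition enorm (R : realType) (n : nat) (u : 'rV[R]_n) : R :=
  Num.sqrt (dotv u u).

Definition angle (R : realType) (n : nat) (u v : 'rV[R]_n) : R :=
  acos (dotv u v / (enorm u * enorm v)).

(* Curves are total functions R -> 'rV[R]_n of which only the values on [a, b]
   matter.  The limits below are taken within [a, b], hence they are one-sided
   at the endpoints. *)
Definition diff_quotient (R : realType) (n : nat) (g : R -> 'rV[R]_n)
    (s t : R) : 'rV[R]_n :=
  (t - s)^-1 *: (g t - g s).

Definition curve_derivable (R : realType) (n : nat) (a b : R)
    (g : R -> 'rV[R]_n) (s : R) : Prop :=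
  cvg (diff_quotient g s t @[t --> within `[a, b] s^']).

Definition velocity (R : realType) (n : nat) (a b : R)
    (g : R -> 'rV[R]_n) (s : R) : 'rV[R]_n :=
  lim (diff_quotient g s t @[t --> within `[a, b] s^']).

Definition C1_curve (R : realType) (n : nat) (a b : R)
    (g : R -> 'rV[R]_n) : Prop :=
  [/\ a < b,
      forall s, s \in `[a, b] -> curve_derivable a b g s
    & {within `[a, b], continuous (velocity a b g)}].

Definition C11_curve (R : realType) (n : nat) (a b : R)
    (g : R -> 'rV[R]_n) : Prop :=
  C1_curve a b g /\ [lipschitz velocity a b g s | s in `[a, b]].

(* Length between the parameters t and u of [a, b], in either order. *)
Definition curve_length (R : realType) (n : nat) (a b : R)
    (g : R -> 'rV[R]_n) (t u : R) : R :=
  \int[lebesgue_measure]_(x in `[Num.min t u, Num.max t u])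
     enorm (velocity a b g x).

Definition curvature (R : realType) (n : nat) (a b : R)
    (g : R -> 'rV[R]_n) (s : R) : \bar R :=
  limf_esup
    (fun z : R * R =>
       (angle (velocity a b g z.1) (velocity a b g z.2)
          / curve_length a b g z.1 z.2)%:E)
    (within [set z | [/\ z.1 \in `[a, b], z.2 \in `[a, b] & z.1 != z.2]]
       (nbhs (s, s))).

(* The set C(p, q; v, w; Lam), as a set of pairs (L, g) with g defined on
   [0, L].  Since g has unit speed, L is its length. *)
Definition in_C (R : realType) (n : nat) (p q v w : 'rV[R]_n) (Lam L : R)
    (g : R -> 'rV[R]_n) : Prop :=
  [/\ C11_curve 0 L g,
      g 0 = p /\ velocity 0 L g 0 = v,
      g L = q /\ velocity 0 L g L = w,
      forall s, s \in `[0, L] -> enorm (velocity 0 L g s) = 1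
    & forall s, s \in `[0, L] -> (curvature 0 L g s <= Lam%:E)%E].

Definition shortest_in_C (R : realType) (n : nat) (p q v w : 'rV[R]_n)
    (Lam L : R) (g : R -> 'rV[R]_n) : Prop :=
  in_C p q v w Lam L g /\
  forall (L' : R) (g' : R -> 'rV[R]_n), in_C p q v w Lam L' g' -> L <= L'.

Definition line_segment (R : realType) (n : nat) (S : set 'rV[R]_n) : Prop :=
  exists x y : 'rV[R]_n, S = [set x + t *: (y - x) | t in `[0, 1]].

(* S is an arc of radius r and length l in the circle with centre z in the
   affine plane z + span(e1, e2). *)
Definition circular_arc (R : realType) (n : nat) (r l : R)
    (S : set 'rV[R]_n) : Prop :=
  exists z e1 e2 : 'rV[R]_n,
    [/\ enorm e1 = 1, enorm e2 = 1, dotv e1 e2 = 0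
      & S = [set z + (r * cos (t / r)) *: e1 + (r * sin (t / r)) *: e2
            | t in `[0, l]]].

(* [CLC_decomposition Lam g a c d b l1 l2]: g restricted to [a, b] is a
   CLC(Lam) curve with line segment g([c, d]) and with circular parts
   g([a, c]) and g([d, b]) of respective lengths l1 and l2. *)
Definition CLC_decomposition (R : realType) (n : nat) (Lam : R)
    (g : R -> 'rV[R]_n) (a c d b l1 l2 : R) : Prop :=
  [/\ C11_curve a b g,
      [/\ a <= c, c <= d & d <= b],
      line_segment (g @` `[c, d]),
      0 <= l1 < 2 * pi / Lam /\ circular_arc Lam^-1 l1 (g @` `[a, c])
    & 0 <= l2 < 2 * pi / Lam /\ circular_arc Lam^-1 l2 (g @` `[d, b])].

Definition CLC_curve (R : realType) (n : nat) (Lam a b : R)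
    (g : R -> 'rV[R]_n) : Prop :=
  exists c d l1 l2 : R, CLC_decomposition Lam g a c d b l1 l2.

Definition tangent_balls (R : realType) (n : nat) (x u : 'rV[R]_n)
    (r : R) : set 'rV[R]_n :=
  [set y | exists z : 'rV[R]_n,
     [/\ dotv u z = 0, enorm z = 1 & enorm (y - x - r *: z) < r]].

Definition tangent_balls_along (R : realType) (n : nat) (a b : R)
    (g : R -> 'rV[R]_n) (r : R) : set 'rV[R]_n :=
  \bigcup_(s in `[a, b]) tangent_balls (g s) (velocity a b g s) r.

(* [g] is meant to be parametrized by arclength; K = g([a, b]). *)
Definition ball_radius (R : realType) (n : nat) (a b : R)
    (g : R -> 'rV[R]_n) : \bar R :=
  ereal_inf [set r%:E | r in
    [set r | 0 < r /\ tangent_balls_along a b g r `&` g @` `[a, b] !=set0]].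

(* Main.v *)
Require Import Defs.
From HB Require Import structures.
From mathcomp Require Import all_boot all_order all_algebra.
From mathcomp Require Import all_classical all_reals all_analysis.
From mathcomp Require Import ring lra.
Import Order.TTheory GRing.Theory Num.Theory.
Import numFieldNormedType.Exports.
Local Open Scope classical_set_scope.
Local Open Scope ring_scope.

(** Why the theorem is true.

    Rescaled to [Lam = 1], the unit tangents of an admissible curve form a map
    [U] from [[0, T]] to the unit sphere that is Lipschitz with constant one, and the end points
    of the curve differ by the integral of [U]. The problem becomes to
    minimise [T] among such maps with given values at [0] and [T] and a given
    integral ([shortest_field]). The curve consists of an arc, a segment and an
    arc exactly if [U] runs along a great circle, rests at some [u], and runs
    along a great circle again. We show this for the whole curve as soon as
    the curvature bound is not attained at some point; both parts follow.

    Near a point where the curvature is less than one, the curve is straight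
    ([straight_of_slack]). Otherwise some velocity of any finite curvature has
    the same ends and the same integral and is shorter. Length is convex in the
    velocity, so a small step towards it shortens the curve, and the slack in
    the curvature bound keeps it admissible.

    Let [U = u] on a segment [[c, d]] that cannot be prolonged beyond [d], and
    replace the rest of the curve by a competitor. This displaces the end point,
    and the segment repairs the displacement [D]: its length compensates the
    component along [u] exactly, and an S shaped detour compensates the
    orthogonal component at a cost of order [|D|^2] ([shortest_after_line]). So
    up to second order the rest of the curve minimises the integral of
    [1 - u . U], for which resting at [u] is free and the fastest way out is a
    great circle. The competitors are great circles through [u], run through
    as late as possible. Each comparison gains an amount that dominates the
    square of the displacement, so nothing can be gained and [U] agrees with its
    competitor. This is done in three situations: over a short time after [d]
    ([initial_arc]), for the continuation of an arc on which [u] and the last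
    point are not antipodal ([arc_extends]), and for the passage through the
    antipode [- u] ([arc_crosses_antipode]). Hence [U] follows one
    great circle until the end or for a full turn ([tail_is_arc]), and a full
    turn is impossible since it could be cut out. Reversing the curve
    gives the same on the other side of the segment ([shortest_arc_line_arc]). *)

Set Implicit Arguments.
Unset Strict Implicit.
Unset Printing Implicit Defensive.

(** * Euclidean geometry of row vectors *)

Section Euclid.
Variables (R : realType) (n : nat).
Implicit Types (u v w : 'rV[R]_n) (a b c x y : R).

Lemma dotC u v : dotv u v = dotv v u.
Proof. by apply: eq_bigr => i _; rewrite mulrC. Qed.

Lemma dotDl u v w : dotv (u + v) w = dotv u w + dotv v w.
Proof. by rewrite -big_split; apply: eq_bigr => i _; rewrite mxE mulrDl. Qed.

Lemma dotZl a u v : dotv (a *: u) v = a * dotv u v.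
Proof. by rewrite /dotv mulr_sumr; apply: eq_bigr => i _; rewrite mxE mulrA. Qed.

Lemma dotNl u v : dotv (- u) v = - dotv u v.
Proof. by rewrite -scaleN1r dotZl mulN1r. Qed.

Lemma dotDr u v w : dotv w (u + v) = dotv w u + dotv w v.
Proof. by rewrite dotC dotDl !(dotC w). Qed.

Lemma dotZr a u v : dotv u (a *: v) = a * dotv u v.
Proof. by rewrite dotC dotZl dotC. Qed.

Lemma dotNr u v : dotv u (- v) = - dotv u v.
Proof. by rewrite dotC dotNl dotC. Qed.

Lemma dot0l u : dotv 0 u = 0.
Proof. by rewrite -(scale0r 0) dotZl mul0r. Qed.

Lemma dot0r u : dotv u 0 = 0.
Proof. by rewrite dotC dot0l. Qed.

Definition dotE := (dotDl, dotDr, dotZl, dotZr, dotNl, dotNr, dot0l, dot0r).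

Lemma dot_ge0 u : 0 <= dotv u u.
Proof. by apply: sumr_ge0 => i _; rewrite -expr2 sqr_ge0. Qed.

Lemma dot_eq0 u : dotv u u = 0 -> u = 0.
Proof.
move=> /eqP; rewrite psumr_eq0 => [|i _]; last by rewrite -expr2 sqr_ge0.
move=> /allP u0; apply/rowP => i; rewrite mxE.
have /implyP/(_ isT) := u0 i (mem_index_enum i).
by rewrite mulf_eq0 orbb => /eqP.
Qed.

Lemma dot_extl u v : (forall h, dotv h u = dotv h v) -> u = v.
Proof.
move=> uv; apply/eqP; rewrite -subr_eq0; apply/eqP/dot_eq0.
by rewrite dotDr dotNr uv subrr.
Qed.

Lemma enorm_ge0 u : 0 <= enorm u.
Proof. exact: sqrtr_ge0. Qed.

Lemma enorm_sqr u : enorm u ^+ 2 = dotv u u.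
Proof. by rewrite sqr_sqrtr // dot_ge0. Qed.

Lemma enorm0 : enorm (0 : 'rV[R]_n) = 0.
Proof. by rewrite /enorm dot0l sqrtr0. Qed.

Lemma enorm_eq0 u : enorm u = 0 -> u = 0.
Proof. by move=> u0; apply: dot_eq0; rewrite -enorm_sqr u0 expr0n. Qed.

Lemma enormZ a u : enorm (a *: u) = `|a| * enorm u.
Proof.
by rewrite /enorm dotZl dotZr mulrA -expr2 sqrtrM ?sqr_ge0// sqrtr_sqr.
Qed.

Lemma enormN u : enorm (- u) = enorm u.
Proof. by rewrite /enorm dotNl dotNr opprK. Qed.

Lemma enorm_subC u v : enorm (u - v) = enorm (v - u).
Proof. by rewrite -enormN opprB. Qed.

Lemma enorm1P u : enorm u = 1 <-> dotv u u = 1.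
Proof.
split=> [u1|u1]; first by rewrite -enorm_sqr u1 expr1n.
by rewrite /enorm u1 sqrtr1.
Qed.

Lemma enorm_le_sqr u c : 0 <= c -> (enorm u <= c) = (dotv u u <= c ^+ 2).
Proof. by move=> c0; rewrite -enorm_sqr ler_pXn2r // nnegrE ?enorm_ge0. Qed.

Lemma dot_sub_sqr u v :
  dotv (u - v) (u - v) = dotv u u + dotv v v - 2 * dotv u v.
Proof. by rewrite !dotE (dotC v u); ring. Qed.

Lemma dot_sub_unit u v : dotv u u = 1 -> dotv v v = 1 ->
  dotv (u - v) (u - v) = 2 * (1 - dotv u v).
Proof. by move=> u1 v1; rewrite dot_sub_sqr u1 v1; ring. Qed.

Lemma cauchy_schwarz_sqr u v : dotv u v ^+ 2 <= dotv u u * dotv v v.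
Proof.
have [v0|v0] := eqVneq (dotv v v) 0.
  by rewrite (dot_eq0 v0) !dotE mulr0 expr0n.
have vp : 0 < dotv v v by rewrite lt_neqAle eq_sym v0 dot_ge0.
have h := dot_ge0 (dotv v v *: u - dotv u v *: v).
rewrite -subr_ge0 -(pmulr_rge0 _ vp).
by move: h; rewrite !dotE (dotC v u); congr (_ <= _); ring.
Qed.

Lemma cauchy_schwarz u v : `|dotv u v| <= enorm u * enorm v.
Proof.
rewrite -(@ler_pXn2r _ 2) ?nnegrE ?mulr_ge0 ?enorm_ge0 //.
by rewrite real_normK ?num_real // exprMn !enorm_sqr cauchy_schwarz_sqr.
Qed.

Lemma dot_le u v : dotv u v <= enorm u * enorm v.
Proof. exact: le_trans (ler_norm _) (cauchy_schwarz u v). Qed.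

Lemma enorm_triangle u v : enorm (u + v) <= enorm u + enorm v.
Proof.
rewrite enorm_le_sqr ?addr_ge0 ?enorm_ge0 // !dotE (dotC v u) -!enorm_sqr.
have := dot_le u v; set x := enorm u; set y := enorm v; set z := dotv u v.
by move=> h; nra.
Qed.

Lemma enorm_triangle_sub w u v : enorm (u - v) <= enorm (u - w) + enorm (w - v).
Proof. by have := enorm_triangle (u - w) (w - v); rewrite addrA subrK. Qed.

Lemma enorm_sub_ge u v : enorm u - enorm v <= enorm (u - v).
Proof. by rewrite lerBlDr; have := enorm_triangle (u - v) v; rewrite subrK. Qed.

Lemma unit_dot_le1 u v : dotv u u = 1 -> dotv v v = 1 -> dotv u v <= 1.
Proof.
move=> /enorm1P u1 /enorm1P v1; have := dot_le u v.
by rewrite u1 v1 mul1r.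
Qed.

Lemma unit_dot_geN1 u v : dotv u u = 1 -> dotv v v = 1 -> -1 <= dotv u v.
Proof.
move=> u1 v1; have : dotv (- u) v <= 1.
  by apply: unit_dot_le1; rewrite ?dotNl ?dotNr ?opprK.
by rewrite dotNl; lra.
Qed.

Lemma unit_dot_eq1 u v : dotv u u = 1 -> dotv v v = 1 -> dotv u v = 1 -> u = v.
Proof.
move=> u1 v1 uv; apply/eqP; rewrite -subr_eq0; apply/eqP/dot_eq0.
by rewrite dot_sub_unit // uv; ring.
Qed.

Lemma entry_le_enorm u i : `|u 0 i| <= enorm u.
Proof.
rewrite -(@ler_pXn2r _ 2) ?nnegrE ?enorm_ge0 // enorm_sqr real_normK ?num_real //.
rewrite /dotv (bigD1 i) //= -expr2 lerDl.
by apply: sumr_ge0 => j _; rewrite -expr2 sqr_ge0.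
Qed.

Lemma enorm_le_sum u : enorm u <= \sum_(i < n) `|u 0 i|.
Proof.
rewrite enorm_le_sqr ?sumr_ge0 //.
suff H (I : seq 'I_n) : \sum_(i <- I) u 0 i * u 0 i <= (\sum_(i <- I) `|u 0 i|) ^+ 2.
  exact: H.
elim: I => [|i I ih]; first by rewrite !big_nil expr0n.
rewrite !big_cons; set s := \sum_(j <- I) `|u 0 j| in ih *.
have s0 : 0 <= s by apply: sumr_ge0.
have -> : u 0 i * u 0 i = `|u 0 i| ^+ 2 by rewrite real_normK ?num_real.
have := normr_ge0 (u 0 i); move: ih; set t := \sum_(j <- I) _.
move: `|u 0 i| => z; nra.
Qed.

(** In dimension at least two every unit vector [a] has unit normals, so that
    each unit vector has polar coordinates around [a], even [a] and [- a]. *)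
Lemma exists_unit_orthogonal : (2 <= n)%N ->
  forall a : 'rV[R]_n, dotv a a = 1 ->
  exists e : 'rV[R]_n, dotv e e = 1 /\ dotv a e = 0.
Proof.
move=> n2 a a1.
have normalize (b : 'rV[R]_n) : dotv a b = 0 -> b != 0 ->
    exists e : 'rV[R]_n, dotv e e = 1 /\ dotv a e = 0.
  move=> ab b0; exists ((enorm b)^-1 *: b); split; last by rewrite dotZr ab mulr0.
  have b0' : enorm b != 0 by apply: contra_neq b0 => /enorm_eq0.
  by rewrite !dotE -enorm_sqr; field.
pose i0 : 'I_n := Ordinal (ltn_trans (ltnSn 0) n2).
pose i1 : 'I_n := Ordinal n2.
pose d (i : 'I_n) : 'rV[R]_n := delta_mx 0 i.
have dotd v i : dotv v (d i) = v 0 i.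
  rewrite /dotv (bigD1 i) //= mxE !eqxx mulr1 big1 ?addr0 // => j ji.
  by rewrite mxE (negbTE ji) mulr0.
have [z0|nz0] := eqVneq (a 0 i0) 0.
  apply: (normalize (d i0)); first by rewrite dotd.
  apply/eqP => /rowP /(_ i0); rewrite !mxE !eqxx /=.
  by move/eqP; rewrite oner_eq0.
apply: (normalize (a 0 i1 *: d i0 - a 0 i0 *: d i1)).
  by rewrite !dotE !dotd; ring.
apply/eqP => /rowP /(_ i1); rewrite !mxE !eqxx /= mulr0 mulr1 add0r.
by move/eqP; rewrite oppr_eq0 (negbTE nz0).
Qed.

End Euclid.

(** * Calculus on the real line *)

Section Calculus.
Variable R : realType.
Implicit Types (f g F G : R -> R) (a b c x y : R).

Lemma is_derive_lam_cst c x : is_derive x 1 (fun=> c) 0.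
Proof. exact: is_derive_cst. Qed.

Lemma is_derive_lam_id x : is_derive x 1 (fun y : R => y) 1.
Proof. exact: is_derive_id. Qed.

Lemma is_derive_lamD f g x a b : is_derive x 1 f a -> is_derive x 1 g b ->
  is_derive x 1 (fun y => f y + g y) (a + b).
Proof. by move=> hf hg; exact: is_deriveD. Qed.

Lemma is_derive_lamN f x a : is_derive x 1 f a ->
  is_derive x 1 (fun y => - f y) (- a).
Proof. by move=> hf; exact: is_deriveN. Qed.

Lemma is_derive_lamM f g x a b : is_derive x 1 f a -> is_derive x 1 g b ->
  is_derive x 1 (fun y => f y * g y) (f x * b + g x * a).
Proof. by move=> hf hg; exact: is_deriveM. Qed.

Lemma is_derive_lam_comp f g x a b :
  is_derive x 1 g b -> is_derive (g x) 1 f a ->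
  is_derive x 1 (fun y => f (g y)) (b * a).
Proof. by move=> hf hg; rewrite mulrC; exact: (is_derive1_comp hg hf). Qed.

Lemma is_derive_eql f x a b : is_derive x 1 f a -> a = b -> is_derive x 1 f b.
Proof. by move=> h <-. Qed.

Lemma is_derive_continuous f f' : (forall x, is_derive x 1 f (f' x)) -> continuous f.
Proof.
move=> df x; apply: differentiable_continuous; apply/derivable1_diffP.
by have [] := df x.
Qed.

Lemma le_of_derive f g f' g' a b : a <= b ->
  (forall x, is_derive x 1 f (f' x)) -> (forall x, is_derive x 1 g (g' x)) ->
  (forall x, a <= x <= b -> f' x <= g' x) -> f b - f a <= g b - g a.
Proof.
move=> ab df dg fg.
have dh x : is_derive x 1 (fun y => g y + - f y) (g' x + - f' x).
  by apply: is_derive_lamD => //; exact: is_derive_lamN.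
have ch : {within `[a, b], continuous (fun y => g y + - f y)}.
  by apply: continuous_subspaceT; exact: is_derive_continuous dh.
have [c] := MVT_segment ab (fun x _ => dh x) ch.
rewrite in_itv /= => cab e.
have := fg c cab; nra.
Qed.

Lemma eq_of_derive f g f' a b :
  (forall x, is_derive x 1 f (f' x)) -> (forall x, is_derive x 1 g (f' x)) ->
  f b - f a = g b - g a.
Proof.
wlog ab : a b / a <= b => [h|] df dg.
  have [/h|/ltW /h] := leP a b; first by apply.
  by move=> /(_ df dg) /eqP; rewrite -(eqr_opp (f a - _)) !opprB => /eqP.
by apply/eqP; rewrite eq_le; apply/andP; split; apply: le_of_derive ab _ _ _.
Qed.

End Calculus.

Ltac der1 := first
  [ eassumption | exact: is_derive_lam_cst | exact: is_derive_lam_id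
  | exact: is_derive_sin | exact: is_derive_cos
  | match goal with
    | |- is_derive _ _ (fun y => _ + _) _ =>
        notypeclasses refine (is_derive_lamD _ _)
    | |- is_derive _ _ -%R _ =>
        notypeclasses refine (@is_derive_lamN _ (fun y => y) _ _ _)
    | |- is_derive _ _ ( *%R ?k) _ =>
        notypeclasses refine (@is_derive_lamM _ (fun=> k) (fun y => y) _ _ _ _ _)
    | |- is_derive _ _ (+%R ?k) _ =>
        notypeclasses refine (@is_derive_lamD _ (fun=> k) (fun y => y) _ _ _ _ _)
    | |- is_derive _ _ (fun y => - _) _ =>
        notypeclasses refine (is_derive_lamN _)
    | |- is_derive _ _ (fun y => _ * _) _ =>
        notypeclasses refine (is_derive_lamM _ _)
    | |- is_derive _ _ (fun y => sin (@?g y)) _ =>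
        notypeclasses refine (@is_derive_lam_comp _ sin g _ _ _ _ _)
    | |- is_derive _ _ (fun y => cos (@?g y)) _ =>
        notypeclasses refine (@is_derive_lam_comp _ cos g _ _ _ _ _)
    end ].
(** Differentiates an expression built from constants, [+], [-], [*], [sin]
    and [cos]; the remaining goal equates the computed derivative to the
    announced one. *)
Ltac der := notypeclasses refine (is_derive_eql _ _); [solve [repeat der1]|cbv beta].

Section Trigonometry.
Variable R : realType.
Implicit Types (a b c x y : R).

Lemma sin_le_id x : 0 <= x -> sin x <= x.
Proof.
move=> x0; have d1 y : is_derive y 1 sin (cos y) by exact: is_derive_sin.
have d2 y : is_derive y 1 (fun z : R => z) 1 by der.
have := le_of_derive x0 d1 d2 (fun y _ => cos_le1 y).
by rewrite sin0 !subr0.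
Qed.

Lemma cos_ge_quad x : 1 - x ^+ 2 / 2 <= cos x.
Proof.
wlog x0 : x / 0 <= x => [h|].
  have [/h//|/ltW xn] := leP 0 x.
  by rewrite -cosN -sqrrN; apply: h; rewrite oppr_ge0.
have d1 y : is_derive y 1 (fun y : R => - (2^-1 * (y * y))) (- y) by der; field.
have d2 y : is_derive y 1 cos (- sin y) by exact: is_derive_cos.
have := le_of_derive x0 d1 d2; rewrite cos0 expr2 => h.
suff : - (2^-1 * (x * x)) - - (2^-1 * (0 * 0)) <= cos x - 1 by lra.
by apply: h => y /andP[y0 _]; rewrite lerN2 sin_le_id.
Qed.

Lemma sin_ge_cubic x : 0 <= x -> x - x ^+ 3 / 6 <= sin x.
Proof.
move=> x0; have d1 y : is_derive y 1 (fun y : R => y + - (6^-1 * (y * (y * y))))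
  (1 - y ^+ 2 / 2) by der; field.
have d2 y : is_derive y 1 sin (cos y) by exact: is_derive_sin.
have := le_of_derive x0 d1 d2 (fun y _ => cos_ge_quad y).
by rewrite sin0 !exprS expr0; lra.
Qed.

Lemma cos_le_quart x : 0 <= x -> cos x <= 1 - x ^+ 2 / 2 + x ^+ 4 / 24.
Proof.
move=> x0; have d1 y : is_derive y 1 cos (- sin y) by exact: is_derive_cos.
have d2 y : is_derive y 1
  (fun y : R => - (2^-1 * (y * y)) + 24^-1 * ((y * y) * (y * y)))
  (- (y - y ^+ 3 / 6)) by der; field.
have := le_of_derive x0 d1 d2; rewrite cos0 => h.
suff : cos x - 1 <= - (2^-1 * (x * x)) + 24^-1 * ((x * x) * (x * x)) -
   (- (2^-1 * (0 * 0)) + 24^-1 * ((0 * 0) * (0 * 0))).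
  by rewrite !exprS expr0; lra.
by apply: h => y /andP[y0 _]; rewrite lerN2 sin_ge_cubic.
Qed.

Lemma sin_diff_le_cos a b c : a <= b ->
  (forall x, a <= x <= b -> cos x <= c) -> sin b - sin a <= c * (b - a).
Proof.
move=> ab h; have d1 y : is_derive y 1 sin (cos y) by exact: is_derive_sin.
have d2 y : is_derive y 1 (fun y : R => c * y) c by der; ring.
by have := le_of_derive ab d1 d2 h; rewrite mulrBr.
Qed.

Lemma cos_diff_le_sin a b c : a <= b ->
  (forall x, a <= x <= b -> sin x <= c) -> cos a - cos b <= c * (b - a).
Proof.
move=> ab h; have d1 y : is_derive y 1 (fun y : R => - cos y) (sin y) by der; ring.
have d2 y : is_derive y 1 (fun y : R => c * y) c by der; ring.
by have := le_of_derive ab d1 d2 h; rewrite mulrBr opprK addrC.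
Qed.

Lemma sin_lip a b : `|sin a - sin b| <= `|a - b|.
Proof.
wlog ab : a b / b <= a => [h|].
  have [/h//|/ltW /h] := leP b a.
  by rewrite distrC (distrC b).
rewrite (ger0_norm (x := a - b)) ?subr_ge0 // ler_norml; apply/andP; split.
  have d1 y : is_derive y 1 sin (cos y) by exact: is_derive_sin.
  have d2 y : is_derive y 1 (fun y : R => - y) (- 1) by der.
  have := le_of_derive ab d2 d1 (fun y _ => cos_geN1 y).
  by congr (_ <= _); ring.
have := @sin_diff_le_cos b a 1 ab; rewrite mul1r; apply=> x _.
exact: cos_le1.
Qed.

Lemma cos_lip a b : `|cos a - cos b| <= `|a - b|.
Proof.
have := sin_lip (a + pi / 2) (b + pi / 2); rewrite !sinDpihalf.
by have -> : a + pi / 2 - (b + pi / 2) = a - b by ring.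
Qed.

Lemma cos_mono a b : 0 <= a -> a <= b -> b <= pi -> cos b <= cos a.
Proof.
move=> a0 ab bpi; move: ab; rewrite le_eqVlt => /orP[/eqP -> //|ab].
by apply: ltW; rewrite ltr_cos ?in_itv /= ?a0 ?bpi ?(le_trans a0 (ltW ab))
  ?(le_trans (ltW ab) bpi).
Qed.

Lemma le_of_cos_le a b : 0 <= a <= pi -> 0 <= b <= pi -> cos b <= cos a -> a <= b.
Proof.
move=> /andP[a0 api] /andP[b0 bpi] h; rewrite leNgt; apply/negP => ba.
have : cos a < cos b by rewrite ltr_cos ?in_itv /= ?a0 ?b0.
by rewrite ltNge h.
Qed.

(** An angle exceeds its chord, but at small scales only by a factor as close
    to one as desired: unit vectors at distance [h] have scalar product
    [1 - h ^+ 2 / 2]. *)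
Lemma cos_speedup_le_quad (lam : R) : 1 < lam ->
  exists2 h0, 0 < h0 & forall h, 0 <= h <= h0 -> cos (lam * h) <= 1 - h ^+ 2 / 2.
Proof.
move=> lam1; have l4 : 0 < lam ^+ 4 by apply: exprn_gt0; lra.
pose h0 := Num.min 1 ((lam - 1) / lam ^+ 4).
have h00 : 0 < h0 by rewrite /h0 lt_min ltr01 /= divr_gt0 // subr_gt0.
exists h0 => // h /andP[hp hh].
have h1 : h <= 1 by apply: le_trans hh _; rewrite ge_min lexx.
have h2 : lam ^+ 4 * h <= lam - 1.
  by rewrite mulrC -ler_pdivlMr //; apply: le_trans hh _; rewrite ge_min lexx orbT.
apply: le_trans (cos_le_quart _) _; first by apply: mulr_ge0 => //; lra.
rewrite !exprMn.
have h3 : lam ^+ 4 * h ^+ 4 <= (lam - 1) * h ^+ 2.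
  have -> : lam ^+ 4 * h ^+ 4 = (lam ^+ 4 * h) * (h * h ^+ 2) by ring.
  have hh2 : 0 <= h ^+ 2 by exact: sqr_ge0.
  have : h * h ^+ 2 <= h ^+ 2 by nra.
  have : 0 <= h * h ^+ 2 by nra.
  by move: (h * h ^+ 2) (lam ^+ 4 * h) h2 hh2 => p q; nra.
have : lam ^+ 2 >= lam by rewrite expr2; nra.
have : 0 <= h ^+ 2 by exact: sqr_ge0.
move: h3; rewrite !expr2; move: (lam ^+ 4 * h ^+ 4) (h * h) (lam * lam) => p q r; nra.
Qed.

End Trigonometry.

(** * Integration of continuous functions *)

Section Primitive.
Variable R : realType.
Implicit Types (f g F G : R -> R) (a b c x y : R).
Let mu := @lebesgue_measure R.

Lemma exists_primitive f : continuous f -> exists F, forall x, is_derive x 1 F (f x).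
Proof.
move=> cf.
have intf a b : mu.-integrable `[a, b] (EFin \o f).
  apply: continuous_compact_integrable; first exact: segment_compact.
  exact: continuous_subspaceT.
(* on any half line x >= N, the function F differs by a constant from the
   integral over [N, x], whose derivative is known *)
pose F x := if 0 <= x then \int[mu]_(t in `]0, x]) f t
            else - \int[mu]_(t in `]x, 0]) f t.
exists F => x0; pose N := - (`|x0| + 2).
pose G x := \int[mu]_(t in `[N, x]) f t - \int[mu]_(t in `[N, 0]) f t.
have Nx0 : N < x0 - 1 by rewrite /N; have := ler_norm (- x0); rewrite normrN; lra.
have N0 : N < 0 by rewrite /N; have := normr_ge0 x0; lra.
have FG x : N <= x -> F x = G x.
  move=> Nx; rewrite /F /G; case: ifP => [x_ge|/negbT].
    by rewrite -(@Rintegral_itvB _ _ (BLeft N) (BRight x)) ?bnd_simp //; exact: ltW.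
  rewrite -ltNge => x_lt.
  by rewrite -(@Rintegral_itvB _ _ (BLeft N) (BRight 0)) ?bnd_simp ?opprB //; exact: ltW.
apply: (@near_eq_is_derive _ _ _ G F).
  near=> x; apply/esym/FG; apply/ltW.
  by near: x; apply: lt_nbhsr; lra.
have [dG eG] : derivable (fun y => \int[mu]_(t in `[N, y]) f t) x0 1 /\
    derive1 (fun y => \int[mu]_(t in `[N, y]) f t) x0 = f x0.
  by apply: (@continuous_FTC1_closed _ f N x0 (x0 + 1)) => //; [lra|lra|exact: cf].
have dint : is_derive x0 1 (fun y => \int[mu]_(t in `[N, y]) f t) (f x0).
  by apply: (DeriveDef dG); rewrite -derive1E; exact: eG.
by rewrite /G; der; ring.
Unshelve. all: by end_near. Qed.

Definition primitive f : R -> R := xget (fun=> 0) [set F | forall x, is_derive x 1 F (f x)].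

Lemma primitiveP f : continuous f -> forall x, is_derive x 1 (primitive f) (f x).
Proof. by move=> /exists_primitive ex; exact: (xgetPex (fun=> 0) ex). Qed.

(** With a primitive on the whole line, the rules of integration reduce to
    those of differentiation, and intervals may have either orientation. *)
Definition rint a b f : R := primitive f b - primitive f a.

Lemma rint_primitive a b f F : (forall x, is_derive x 1 F (f x)) ->
  rint a b f = F b - F a.
Proof.
move=> dF; apply: (@eq_of_derive _ _ _ f) => // x.
exact: (xgetPex (P := [set G | forall x, is_derive x 1 G (f x)]) (fun=> 0) (ex_intro _ F dF)).
Qed.

Lemma rint_chasles b a c f : rint a c f = rint a b f + rint b c f.
Proof. by rewrite /rint; ring. Qed.

Lemma rint_id a f : rint a a f = 0.
Proof. exact: subrr. Qed.

Lemma rintD a b f g : continuous f -> continuous g ->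
  rint a b (fun x => f x + g x) = rint a b f + rint a b g.
Proof.
move=> cf cg.
have d x : is_derive x 1 (fun x => primitive f x + primitive g x) (f x + g x).
  by apply: is_derive_lamD; exact: primitiveP.
by rewrite (rint_primitive _ _ d) /rint; ring.
Qed.

Lemma rintZ a b c f : continuous f -> rint a b (fun x => c * f x) = c * rint a b f.
Proof.
move=> cf.
have d x : is_derive x 1 (fun x => c * primitive f x) (c * f x).
  by have := primitiveP cf x => df; der; ring.
by rewrite (rint_primitive _ _ d) /rint; ring.
Qed.

Lemma rint_cst a b c : rint a b (fun=> c) = c * (b - a).
Proof.
have d x : is_derive x 1 (fun x => c * x) c by der; ring.
by rewrite (rint_primitive _ _ d) mulrBr.
Qed.

Lemma le_rint a b f g : a <= b -> continuous f -> continuous g ->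
  (forall x, a <= x <= b -> f x <= g x) -> rint a b f <= rint a b g.
Proof. by move=> ab /primitiveP cf /primitiveP cg fg; exact: (le_of_derive ab cf cg fg). Qed.

Lemma eq_rint a b f g : a <= b -> continuous f -> continuous g ->
  (forall x, a <= x <= b -> f x = g x) -> rint a b f = rint a b g.
Proof.
move=> ab cf cg fg; apply/eqP; rewrite eq_le; apply/andP.
by split; apply: le_rint => // x /fg ->.
Qed.

Lemma rint_shift a b c f : continuous f ->
  rint a b (fun x => f (c + x)) = rint (c + a) (c + b) f.
Proof.
move=> cf.
have d x : is_derive x 1 (fun x => primitive f (c + x)) (f (c + x)).
  have dc : is_derive x 1 (fun x => c + x) 1 by der; ring.
  by rewrite -[f _]mul1r; exact: (is_derive_lam_comp dc (primitiveP cf _)).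
by rewrite (rint_primitive _ _ d).
Qed.

Lemma rint_reverse a b c f : continuous f ->
  rint a b (fun x => f (c - x)) = rint (c - b) (c - a) f.
Proof.
move=> cf.
have d x : is_derive x 1 (fun x => - primitive f (c - x)) (f (c - x)).
  have dc : is_derive x 1 (fun x => c - x) (- 1) by der; ring.
  rewrite -[f _]opprK -[- f _]mulN1r; apply: is_derive_lamN.
  exact: (is_derive_lam_comp dc (primitiveP cf _)).
by rewrite (rint_primitive _ _ d) /rint; ring.
Qed.

Lemma rint_ge0 a b f : a <= b -> continuous f ->
  (forall x, a <= x <= b -> 0 <= f x) -> 0 <= rint a b f.
Proof.
move=> ab cf f0; rewrite -[leLHS](mul0r (b - a)) -rint_cst.
by apply: le_rint => // x; exact: cvg_cst.
Qed.

(** A nonnegative continuous function of nonpositive integral vanishes: its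
    primitive is nondecreasing, hence constant, hence has zero derivative. *)
Lemma rint_le0_eq0 a b f : a < b -> continuous f ->
  (forall x, a <= x <= b -> 0 <= f x) -> rint a b f <= 0 ->
  forall x, a <= x <= b -> f x = 0.
Proof.
move=> ab cf f0 i0.
have inner x : a < x < b -> f x = 0.
  move=> /andP[ax xb].
  have cst y : a <= y <= b -> primitive f y = primitive f a.
    move=> /andP[ay yb]; apply/eqP; rewrite eq_le -subr_le0 -(subr_ge0 _ (primitive f y)).
    have h1 : 0 <= rint a y f.
      by apply: rint_ge0 => // z /andP[az zy]; apply: f0; rewrite az (le_trans zy).
    have h2 : 0 <= rint y b f.
      by apply: rint_ge0 => // z /andP[yz zb]; apply: f0; rewrite zb (le_trans ay).
    by move: i0; rewrite (rint_chasles y) => i0; apply/andP; split; move: h1 h2 i0; rewrite /rint; lra.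
  have d0 : is_derive x 1 (primitive f) 0.
    have dc := is_derive_lam_cst (primitive f a) x.
    apply: (near_eq_is_derive _ dc).
    near=> y; apply/esym/cst; apply/andP; split; apply/ltW; near: y.
      exact: lt_nbhsr.
    exact: lt_nbhsl.
  have [_ <-] := primitiveP cf x; by have [_ ->] := d0.
have cont_eq y : (forall d, 0 < d -> exists2 x, `|y - x| < d & f x = 0) -> f y = 0.
  move=> h; apply: contrapT => /eqP; rewrite -normr_gt0 => fy0.
  have /cvgrPdist_lt /(_ _ fy0) /nbhs_ballP [d /= d0 hd] := cf y.
  have [x xd fx] := h d d0.
  by have := hd x xd; rewrite /= fx subr0 ltxx.
move=> x /andP[ax xb].
have mid d : 0 < d -> [/\ 0 < Num.min d (b - a) / 2, Num.min d (b - a) / 2 < d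
    & Num.min d (b - a) / 2 < b - a].
  move=> d0; have ba : 0 < b - a by rewrite subr_gt0.
  have [h1 h2] : Num.min d (b - a) <= d /\ Num.min d (b - a) <= b - a.
    by split; rewrite ge_min lexx ?orbT.
  have h3 : 0 < Num.min d (b - a) by rewrite lt_min d0.
  by split; lra.
have [xa|xa] := eqVneq x a; last have [xb'|xb'] := eqVneq x b.
- apply: cont_eq => d /mid [h1 h2 h3]; exists (x + Num.min d (b - a) / 2).
    by rewrite opprD addNKr normrN ger0_norm // ltW.
  by apply: inner; apply/andP; split; lra.
- apply: cont_eq => d /mid [h1 h2 h3]; exists (x - Num.min d (b - a) / 2).
    by rewrite opprB addrCA subrr addr0 ger0_norm // ltW.
  by apply: inner; apply/andP; split; lra.
- by apply: inner; rewrite !lt_neqAle ax xb eq_sym xa xb'.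
Unshelve. all: by end_near. Qed.

End Primitive.

(** * Integration of vector-valued functions *)

Section VectorIntegral.
Variables (R : realType) (n : nat).
Implicit Types (U W : R -> 'rV[R]_n) (h : 'rV[R]_n) (a b c s t : R).

Lemma continuous_lamD (f g : R -> R) : continuous f -> continuous g ->
  continuous (fun x => f x + g x).
Proof. by move=> cf cg x; apply: cvgD; [exact: cf|exact: cg]. Qed.

Lemma continuous_lamN (f : R -> R) : continuous f -> continuous (fun x => - f x).
Proof. by move=> cf x; apply: cvgN; exact: cf. Qed.

Lemma continuous_lamM (f g : R -> R) : continuous f -> continuous g ->
  continuous (fun x => f x * g x).
Proof. by move=> cf cg x; apply: cvgM; [exact: cf|exact: cg]. Qed.

Lemma continuous_lam_cst c : continuous (fun _ : R => c).
Proof. by move=> x; exact: cvg_cst. Qed.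

Lemma continuous_lam_id : continuous (fun x : R => x).
Proof. by move=> x; exact: cvg_id. Qed.

Lemma continuous_lam_comp (f g : R -> R) : continuous f -> continuous g ->
  continuous (fun x => f (g x)).
Proof. by move=> cf cg x; apply: continuous_comp; [exact: cg|exact: cf]. Qed.

Lemma continuous_of_lip (f : R -> R) c :
  (forall s t, `|f s - f t| <= c * `|s - t|) -> continuous f.
Proof.
move=> lf s.
have c0 : 0 <= c.
  by have := lf 0 1; have := normr_ge0 (f 0 - f 1); rewrite sub0r normrN1 mulr1; lra.
have c1 : 0 < c + 1 by lra.
apply/cvgrPdist_lt => e e0; apply/nbhs_ballP.
exists (e / (c + 1)) => [|t]; first by rewrite /= divr_gt0.
rewrite /ball /= ltr_pdivlMr // => h; apply: le_lt_trans (lf s t) _.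
by have := normr_ge0 (s - t); move: `|s - t| h => z; nra.
Qed.

Lemma continuous_lam_sum (I : Type) (r : seq I) (f : I -> R -> R) :
  (forall i, continuous (f i)) -> continuous (fun x => \sum_(i <- r) f i x).
Proof.
move=> cf; elim: r => [|i r ih].
  by under eq_fun do rewrite big_nil; exact: continuous_lam_cst.
by under eq_fun do rewrite big_cons; exact: continuous_lamD.
Qed.

Definition vcontinuous U := forall i, continuous (fun s => U s 0 i).

Definition vint a b U : 'rV[R]_n := \row_i rint a b (fun s => U s 0 i).

Lemma dot_vcontinuous h U : vcontinuous U -> continuous (fun s => dotv h (U s)).
Proof.
move=> cU; apply: continuous_lam_sum => i.
by apply: continuous_lamM => //; exact: continuous_lam_cst.
Qed.

Lemma vcontinuousB U W : vcontinuous U -> vcontinuous W ->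
  vcontinuous (fun s => U s - W s).
Proof.
move=> cU cW i; have -> : (fun s => (U s - W s) 0 i) = (fun s => U s 0 i + - W s 0 i).
  by apply: funext => s; rewrite !mxE.
by apply: continuous_lamD => //; exact: continuous_lamN.
Qed.

Lemma dot_vint h a b U : vcontinuous U ->
  dotv h (vint a b U) = rint a b (fun s => dotv h (U s)).
Proof.
move=> cU; rewrite /dotv.
suff H (I : seq 'I_n) : \sum_(i <- I) h 0 i * vint a b U 0 i =
    rint a b (fun s => \sum_(i <- I) h 0 i * U s 0 i) by exact: H.
elim: I => [|i I ih].
  rewrite big_nil (_ : (fun s => _) = fun=> 0) ?rint_cst ?mul0r //.
  by apply: funext => s; rewrite big_nil.
rewrite big_cons ih mxE -rintZ // -rintD.
- by congr rint; apply: funext => s; rewrite big_cons.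
- by apply: continuous_lamM => //; exact: continuous_lam_cst.
- apply: continuous_lam_sum => j.
  by apply: continuous_lamM => //; exact: continuous_lam_cst.
Qed.

Lemma vint_chasles b a c U : vint a c U = vint a b U + vint b c U.
Proof. by apply/rowP => i; rewrite !mxE -rint_chasles. Qed.

Lemma vint_id a U : vint a a U = 0.
Proof. by apply/rowP => i; rewrite !mxE rint_id. Qed.

Lemma vint_cst a b h : vint a b (fun=> h) = (b - a) *: h.
Proof. by apply/rowP => i; rewrite !mxE rint_cst mulrC. Qed.

Lemma eq_vint a b U W : a <= b -> vcontinuous U -> vcontinuous W ->
  (forall s, a <= s <= b -> U s = W s) -> vint a b U = vint a b W.
Proof.
by move=> ab cU cW UW; apply/rowP => i; rewrite !mxE; apply: eq_rint => // s /UW ->.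
Qed.

Lemma vint_shift a b c U : vcontinuous U ->
  vint a b (fun s => U (c + s)) = vint (c + a) (c + b) U.
Proof.
by move=> cU; apply/rowP => i; rewrite !mxE (rint_shift _ _ _ (cU i)).
Qed.

Lemma vint_opp_reverse a b c U : vcontinuous U ->
  vint a b (fun s => - U (c - s)) = - vint (c - b) (c - a) U.
Proof.
move=> cU; apply/rowP => i; rewrite !mxE -(rint_reverse _ _ _ (cU i)) -mulN1r -rintZ.
  by congr rint; apply: funext => s; rewrite mxE mulN1r.
apply: (continuous_lam_comp (cU i)).
by apply: continuous_lamD; [exact: continuous_lam_cst|exact/continuous_lamN/continuous_lam_id].
Qed.

Lemma vintB a b U W : vcontinuous U -> vcontinuous W ->
  vint a b (fun s => U s - W s) = vint a b U - vint a b W.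
Proof.
move=> cU cW; apply: dot_extl => h; rewrite dotDr dotNr !dot_vint //; last exact: vcontinuousB.
rewrite -mulN1r -rintZ -?rintD; do ?[exact: dot_vcontinuous].
  by congr rint; apply: funext => s; rewrite dotDr dotNr mulN1r.
by apply: continuous_lamM; [exact: continuous_lam_cst|exact: dot_vcontinuous].
Qed.

(** Testing the integral against its own direction reduces the triangle
    inequality for integrals to the scalar case. *)
Lemma enorm_vint_le a b U (f : R -> R) : a <= b -> vcontinuous U -> continuous f ->
  (forall s, a <= s <= b -> enorm (U s) <= f s) -> enorm (vint a b U) <= rint a b f.
Proof.
move=> ab cU cf Uf; set V := vint a b U.
have f0 : 0 <= rint a b f.
  by apply: rint_ge0 => // s /Uf; apply: le_trans; exact: enorm_ge0.
have [V0|V0] := eqVneq (enorm V) 0; first by rewrite V0.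
have Vp : 0 < enorm V by rewrite lt_neqAle eq_sym V0 enorm_ge0.
rewrite -(ler_pM2l Vp) -rintZ // -expr2 enorm_sqr {2}/V dot_vint //.
apply: le_rint => // [||s /Uf hs]; first exact: dot_vcontinuous.
  by apply: continuous_lamM => //; exact: continuous_lam_cst.
by apply: le_trans (dot_le _ _) _; rewrite ler_pM2l.
Qed.

Lemma enorm_vint_le_cst a b U c : a <= b -> vcontinuous U ->
  (forall s, a <= s <= b -> enorm (U s) <= c) -> enorm (vint a b U) <= c * (b - a).
Proof.
move=> ab cU h; rewrite -rint_cst; apply: enorm_vint_le => //.
exact: continuous_lam_cst.
Qed.

Lemma vint_primitive a b U (F : R -> 'rV[R]_n) : vcontinuous U ->
  (forall h s, is_derive s 1 (fun x => dotv h (F x)) (dotv h (U s))) ->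
  vint a b U = F b - F a.
Proof.
move=> cU dF; apply: dot_extl => h; rewrite dot_vint // dotDr dotNr.
exact: rint_primitive (dF h).
Qed.

End VectorIntegral.

(** * Curves on the unit sphere with speed at most one *)

Section UnitLipschitz.
Variables (R : realType) (n : nat).
Implicit Types (U W : R -> 'rV[R]_n) (a b c e h u V : 'rV[R]_n) (s t x y : R).

(** The unit tangents of a unit speed curve of curvature at most one, extended
    to the whole line. *)
Definition tangent_field U :=
  (forall s, dotv (U s) (U s) = 1) /\ forall s t, enorm (U s - U t) <= `|s - t|.

Lemma vcontinuous_of_lip U (c : R) :
  (forall s t, enorm (U s - U t) <= c * `|s - t|) -> vcontinuous U.
Proof.
move=> h i; apply: (@continuous_of_lip _ _ c) => s t.
by apply: le_trans (h s t); have := entry_le_enorm (U s - U t) i; rewrite !mxE.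
Qed.

Lemma tangent_field_vcontinuous U : tangent_field U -> vcontinuous U.
Proof.
by move=> [_ lU]; apply: (@vcontinuous_of_lip _ 1) => s t; rewrite mul1r.
Qed.

Lemma tangent_field_comp U (f : R -> R) : tangent_field U ->
  (forall s t, `|f s - f t| <= `|s - t|) -> tangent_field (fun s => U (f s)).
Proof. by move=> [U1 lU] lf; split=> [s|s t]; rewrite ?U1 ?(le_trans (lU _ _)). Qed.

Lemma tangent_field_shift U (c : R) : tangent_field U -> tangent_field (fun s => U (c + s)).
Proof.
move=> aU; apply: tangent_field_comp => // s t.
by have -> : c + s - (c + t) = s - t by ring.
Qed.

Lemma tangent_field_opp_reverse U (c : R) : tangent_field U -> tangent_field (fun s => - U (c - s)).
Proof.
move=> [U1 lU]; split=> [s|s t]; first by rewrite dotNl dotNr opprK.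
rewrite -opprD enormN (le_trans (lU _ _)) // distrC.
by have -> : c - t - (c - s) = s - t by ring.
Qed.

Definition circle a e x := cos x *: a + sin x *: e.
Definition circle_primitive a e x := sin x *: a - cos x *: e.

Definition orthonormal2 a e := [/\ dotv a a = 1, dotv e e = 1 & dotv a e = 0].

Lemma circle0 a e : circle a e 0 = a.
Proof. by rewrite /circle cos0 sin0 scale1r scale0r addr0. Qed.

Lemma dot_circle h a e x : dotv h (circle a e x) = cos x * dotv h a + sin x * dotv h e.
Proof. by rewrite !dotE. Qed.

Lemma dot_circle2 a e x y : orthonormal2 a e ->
  dotv (circle a e x) (circle a e y) = cos (x - y).
Proof. by case=> a1 e1 ae; rewrite !dotE (dotC e a) a1 e1 ae cosB; ring. Qed.

Lemma dot_circle_center a e x : orthonormal2 a e -> dotv a (circle a e x) = cos x.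
Proof. by case=> a1 e1 ae; rewrite dot_circle a1 ae; ring. Qed.

Lemma circle_unit a e x : orthonormal2 a e -> dotv (circle a e x) (circle a e x) = 1.
Proof. by move=> o; rewrite dot_circle2 // subrr cos0. Qed.

Lemma circle_lip a e x y : orthonormal2 a e ->
  enorm (circle a e x - circle a e y) <= `|x - y|.
Proof.
move=> o; rewrite enorm_le_sqr // dot_sub_unit ?circle_unit // dot_circle2 //.
by rewrite real_normK ?num_real //; have := cos_ge_quad (x - y); lra.
Qed.

Lemma tangent_field_circle a e (f : R -> R) : orthonormal2 a e ->
  (forall s t, `|f s - f t| <= `|s - t|) -> tangent_field (fun s => circle a e (f s)).
Proof.
move=> o lf; split=> [s|s t]; first exact: circle_unit.
exact: le_trans (circle_lip _ _ o) (lf s t).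
Qed.

Lemma tangent_field_cst a : dotv a a = 1 -> tangent_field (fun=> a).
Proof. by move=> a1; split=> // s t; rewrite subrr enorm0. Qed.

Lemma vint_circle a e s t (c : R) : orthonormal2 a e ->
  vint s t (fun x => circle a e (x - c)) =
  circle_primitive a e (t - c) - circle_primitive a e (s - c).
Proof.
move=> o; apply: (@vint_primitive _ _ _ _ _ (fun x => circle_primitive a e (x - c))).
  apply/tangent_field_vcontinuous/tangent_field_circle => // x y.
  by have -> : x - c - (y - c) = x - y by ring.
move=> h x; rewrite dot_circle.
have -> : (fun x => dotv h (circle_primitive a e (x - c))) =
    fun x => sin (x - c) * dotv h a + - (cos (x - c) * dotv h e).
  by apply: funext => z; rewrite !dotE.
by der; ring.
Qed.

(** Triangle inequality for angles. The components of [a] and [c] orthogonal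
    to [b] have the sines of the angles as norms, so by Cauchy-Schwarz they
    contribute at least minus the product of the sines to [dotv a c]. *)
Lemma cos_triangle a b c x y : dotv a a = 1 -> dotv b b = 1 -> dotv c c = 1 ->
  0 <= x -> 0 <= y -> x + y <= pi -> cos x <= dotv a b -> cos y <= dotv b c ->
  cos (x + y) <= dotv a c.
Proof.
move=> a1 b1 c1 x0 y0 xy hx hy.
set p := dotv a b in hx; set q := dotv b c in hy.
have p1 : -1 <= p <= 1 by rewrite unit_dot_geN1 // unit_dot_le1.
have q1 : -1 <= q <= 1 by rewrite unit_dot_geN1 // unit_dot_le1.
have pE : p = cos (acos p) by rewrite acosK.
have qE : q = cos (acos q) by rewrite acosK.
have px : acos p <= x.
  by apply: le_of_cos_le; rewrite -?pE ?acos_ge0 ?acos_lepi ?x0 //=; lra.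
have qy : acos q <= y.
  by apply: le_of_cos_le; rewrite -?qE ?acos_ge0 ?acos_lepi ?y0 //=; lra.
have p0 := acos_ge0 p1; have q0 := acos_ge0 q1.
have -> : dotv a c = p * q + dotv (a - p *: b) (c - q *: b).
  by rewrite !dotE b1 -/p -/q; ring.
apply: (@le_trans _ _ (cos (acos p + acos q))).
  by apply: cos_mono; lra.
rewrite cosD -pE -qE -[leLHS]opprK opprB -[leRHS]opprK lerN2.
suff : - dotv (a - p *: b) (c - q *: b) <= sin (acos p) * sin (acos q) by lra.
have sp : 0 <= sin (acos p) by apply: sin_ge0_pi; rewrite p0 acos_lepi.
have sq : 0 <= sin (acos q) by apply: sin_ge0_pi; rewrite q0 acos_lepi.
have -> : sin (acos p) = enorm (a - p *: b).
  apply/eqP; rewrite -(@eqrXn2 _ 2) ?enorm_ge0 // sin2cos2 -pE enorm_sqr.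
  by apply/eqP; rewrite !dotE a1 b1 (dotC b a) -/p; ring.
have -> : sin (acos q) = enorm (c - q *: b).
  apply/eqP; rewrite -(@eqrXn2 _ 2) ?enorm_ge0 // sin2cos2 -qE enorm_sqr.
  by apply/eqP; rewrite !dotE c1 b1 (dotC c b) -/q; ring.
by apply: le_trans (cauchy_schwarz _ _); rewrite -normrN ler_norm.
Qed.

(** A curve of speed at most one on the sphere turns by an angle of at most
    the elapsed time. The speed bound concerns chords, so on small steps angles are only
    controlled up to a factor [lam > 1], which tends to one in the end. *)
Lemma tangent_field_dot_ge U s t : tangent_field U -> s <= t -> t - s <= pi ->
  cos (t - s) <= dotv (U s) (U t).
Proof.
move=> [U1 lU] st tpi.
have chord x y : dotv (U x) (U y) >= 1 - (y - x) ^+ 2 / 2.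
  have := lU x y; rewrite enorm_le_sqr // dot_sub_unit // real_normK ?num_real //.
  by rewrite -[x - y]opprB sqrrN; lra.
have rough (lam : R) : 1 < lam -> forall y, s <= y -> lam * (y - s) <= pi ->
    cos (lam * (y - s)) <= dotv (U s) (U y).
  move=> lam1; have [h0 h0p hh] := cos_speedup_le_quad lam1.
  suff H (k : nat) : forall y, s <= y -> y - s <= k%:R * h0 -> lam * (y - s) <= pi ->
      cos (lam * (y - s)) <= dotv (U s) (U y).
    move=> y sy ylam; apply: (H (Num.bound ((y - s) / h0))) => //.
    rewrite -ler_pdivrMr //; apply/ltW/archi_boundP.
    by rewrite divr_ge0 ?subr_ge0 // ltW.
  elim: k => [|k ih] y sy yk ylam.
    have -> : y = s by move: yk; rewrite mul0r; lra.
    by rewrite subrr mulr0 cos0 U1.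
  have [small|big] := leP (y - s) h0.
    by apply: le_trans (chord s y); apply: hh; lra.
  have -> : lam * (y - s) = lam * (y - h0 - s) + lam * h0 by ring.
  apply: (@cos_triangle _ (U (y - h0))) => //; rewrite ?U1 //.
  - by apply: mulr_ge0; lra.
  - by apply: mulr_ge0; lra.
  - by have -> : lam * (y - h0 - s) + lam * h0 = lam * (y - s) by ring.
  - apply: ih; first by lra.
      by move: yk; rewrite -natr1 mulrDl mul1r; lra.
    by apply: le_trans ylam; apply: ler_wpM2l; lra.
  - apply: le_trans (chord (y - h0) y); have -> : y - (y - h0) = h0 by ring.
    by apply: hh; rewrite lexx ltW.
have [->|ts] := eqVneq s t; first by rewrite subrr cos0 U1.
have {}st : 0 < t - s by rewrite subr_gt0 lt_neqAle ts.
apply/ler_addgt0Pr => eps eps0.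
have pip := pi_gt0 R.
(* compare the points s and s + d / lam, where d = t - s, and let lam tend to 1 *)
pose d := t - s; pose lam := 1 + eps / (2 * d).
have dp : 0 < d by [].
have l1 : 1 < lam by rewrite /lam ltrDl divr_gt0 // mulr_gt0.
pose y := s + d / lam.
have ys : lam * (y - s) = d by rewrite /y; field; lra.
have sy : s <= y by rewrite /y lerDl divr_ge0 // ltW; lra.
have := rough lam l1 y sy; rewrite ys => /(_ tpi) h1.
have lipy : enorm (U t - U y) <= eps / 2.
  apply: le_trans (lU _ _) _.
  have -> : t - y = (lam - 1) * (y - s) by rewrite mulrBl ys mul1r /d; ring.
  rewrite ger0_norm; last by apply: mulr_ge0; lra.
  have : (lam - 1) * (y - s) <= (lam - 1) * d by apply: ler_wpM2l; [lra|rewrite -ys; nra].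
  by have -> : (lam - 1) * d = eps / 2 by rewrite /lam; field; lra.
have : dotv (U s) (U y - U t) <= eps / 2.
  apply: le_trans (dot_le _ _) _; have /enorm1P -> := U1 s.
  by rewrite mul1r enorm_subC.
by rewrite dotDr dotNr /d in h1 *; lra.
Qed.

Lemma tangent_field_eq_closed U W x y : tangent_field U -> tangent_field W -> x < y ->
  (forall s, x <= s < y -> U s = W s) -> U y = W y.
Proof.
move=> [_ lU] [_ lW] xy h.
apply/eqP; rewrite -subr_eq0; apply/eqP/enorm_eq0/eqP; rewrite eq_le enorm_ge0 andbT.
apply/ler_addgt0Pr => eps eps0; rewrite add0r.
pose d := Num.min (y - x) (eps / 2).
have [d0 dbe deps] : [/\ 0 < d, d <= y - x & d <= eps / 2].
  by rewrite /d; split; rewrite ?lt_min ?subr_gt0 ?xy ?divr_gt0 // ge_min lexx ?orbT.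
apply: le_trans (enorm_triangle_sub (U (y - d)) _ _) _.
have h1 := lU y (y - d).
have h2 : enorm (U (y - d) - W y) <= `|y - d - y|.
  by rewrite h; [exact: lW|apply/andP; split; lra].
have e1 : y - (y - d) = d by ring.
have e2 : y - d - y = - d by ring.
rewrite e1 in h1; rewrite e2 normrN in h2; rewrite gtr0_norm // in h1 h2.
lra.
Qed.

End UnitLipschitz.

(** * Joining tangent fields *)

Section Paths.
Variables (R : realType) (n : nat).
Implicit Types (U W : R -> 'rV[R]_n) (a b c e h u V : 'rV[R]_n) (s t x y T : R).

(** Some curve of curvature at most one has initial direction [a], terminal
    direction [b], length [T], and end points that differ by [V]. *)
Definition connection a b T V := exists U,
  [/\ tangent_field U, 0 <= T, U 0 = a, U T = b & vint 0 T U = V].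

Definition joined T U W s := if s <= T then U s else W (s - T).

Lemma tangent_field_joined T U W : tangent_field U -> tangent_field W -> U T = W 0 ->
  tangent_field (joined T U W).
Proof.
move=> [U1 lU] [W1 lW] UW; split=> [s|]; rewrite /joined; first by case: ifP.
have mixed s t : s <= T -> T < t -> enorm (U s - W (t - T)) <= `|s - t|.
  move=> sT Tt; apply: le_trans (enorm_triangle_sub (U T) _ _) _.
  have -> : `|s - t| = `|s - T| + `|0 - (t - T)|.
    by rewrite !ler0_norm; lra.
  by apply: lerD; [exact: lU|rewrite UW; exact: lW].
move=> s t; have [sT|Ts] := leP s T; have [tT|Tt] := leP t T => //.
- exact: mixed.
- by rewrite enorm_subC distrC; exact: mixed.
- by rewrite (le_trans (lW _ _)) // (_ : s - T - (t - T) = s - t) //; ring.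
Qed.

Lemma connection_sub U s t : tangent_field U -> s <= t -> connection (U s) (U t) (t - s) (vint s t U).
Proof.
move=> fU st; exists (fun x => U (s + x)); split.
- exact: tangent_field_shift.
- by rewrite subr_ge0.
- by rewrite addr0.
- by rewrite addrC subrK.
- rewrite vint_shift ?addr0; last exact: tangent_field_vcontinuous.
  by congr vint; ring.
Qed.

Lemma connection_join a b c T T' V V' : connection a b T V -> connection b c T' V' ->
  connection a c (T + T') (V + V').
Proof.
move=> [U [fU T0 U0 UT UV]] [W [fW T'0 W0 WT' WV']].
have UW : U T = W 0 by rewrite UT W0.
have fJ := tangent_field_joined fU fW UW.
have JT y : 0 <= y -> joined T U W (T + y) = W y.
  move=> y0; rewrite /joined; case: leP => h.
    have -> : y = 0 by lra.
    by rewrite addr0.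
  by congr W; ring.
exists (joined T U W); split=> //.
- by rewrite addr_ge0.
- by rewrite /joined T0.
- by rewrite JT.
have cJ := tangent_field_vcontinuous fJ.
rewrite (vint_chasles T); congr (_ + _).
  rewrite -UV; apply: eq_vint => //; first exact: tangent_field_vcontinuous.
  by move=> s /andP[_ sT]; rewrite /joined sT.
rewrite -{1}[T]addr0 -vint_shift // -WV'; apply: eq_vint => //.
- exact/tangent_field_vcontinuous/tangent_field_shift.
- exact: tangent_field_vcontinuous.
- by move=> s /andP[s0 _]; exact: JT.
Qed.

Lemma connection_cst a T : dotv a a = 1 -> 0 <= T -> connection a a T (T *: a).
Proof.
move=> a1 T0; exists (fun=> a); split=> //; first exact: tangent_field_cst.
by rewrite vint_cst subr0.
Qed.

(** Arcs of radius larger than one: the point on the great circle moves at a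
    constant speed below one. *)
Lemma connection_circle a e x y T : orthonormal2 a e -> 0 < T -> x != y -> `|y - x| <= T ->
  connection (circle a e x) (circle a e y) T
    ((T / (y - x)) *: (circle_primitive a e y - circle_primitive a e x)).
Proof.
move=> o T0 xy xyT; pose k := (y - x) / T.
have yx0 : y - x != 0 by rewrite subr_eq0 eq_sym.
have lf s t : `|x + k * s - (x + k * t)| <= `|s - t|.
  have -> : x + k * s - (x + k * t) = k * (s - t) by ring.
  rewrite normrM; apply: ler_piMl => //.
  by rewrite /k normrM normfV (gtr0_norm T0) ler_pdivrMr // mul1r.
have fC := tangent_field_circle o lf.
exists (fun s => circle a e (x + k * s)); split=> //.
- exact: ltW.
- by rewrite mulr0 addr0.
- by congr circle; rewrite /k; field; rewrite gt_eqF.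
have d h s : is_derive s 1 (fun z => dotv h (k^-1 *: circle_primitive a e (x + k * z)))
    (dotv h (circle a e (x + k * s))).
  rewrite dot_circle.
  have -> : (fun s => dotv h (k^-1 *: circle_primitive a e (x + k * s))) =
      fun s => k^-1 * (sin (x + k * s) * dotv h a + - (cos (x + k * s) * dotv h e)).
    by apply: funext => z; rewrite !dotE.
  have k0 : k != 0 by rewrite /k mulf_neq0 // invr_eq0 gt_eqF.
  by der; field.
rewrite (vint_primitive _ _ (tangent_field_vcontinuous fC) d).
rewrite -scalerBr mulr0 addr0 (_ : x + k * T = y); last first.
  by rewrite /k; field; rewrite gt_eqF.
by congr (_ *: _); rewrite /k; field; rewrite yx0 gt_eqF.
Qed.

(** Up to the angle [pi], this is the curve of speed at most one that stays
    closest to [a] among those with the same end points and duration. *)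
Definition delayed_circle d a e s := circle a e (Num.max 0 (s - d)).

Lemma tangent_field_delayed_circle d a e : orthonormal2 a e ->
  tangent_field (delayed_circle d a e).
Proof.
move=> o; apply: tangent_field_circle => // s t.
have -> : s - t = (s - d) - (t - d) by ring.
move: (s - d) (t - d) => p q.
wlog pq : p q / p <= q => [h|].
  by have [/h//|/ltW /h] := leP p q; rewrite distrC (distrC q).
rewrite !ler0_norm ?subr_le0 //.
  by have [] := leP 0 p; have [] := leP 0 q; lra.
by have [] := leP 0 p; have [] := leP 0 q; lra.
Qed.

Lemma delayed_circle_late d a e s : d <= s -> delayed_circle d a e s = circle a e (s - d).
Proof. by move=> ds; rewrite /delayed_circle max_r // subr_ge0. Qed.

Lemma delayed_circle_early d a e s : s <= d -> delayed_circle d a e s = a.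
Proof. by move=> sd; rewrite /delayed_circle max_l ?circle0 // subr_le0. Qed.

Lemma vint_delayed_circle d a e t : orthonormal2 a e -> 0 <= d -> d <= t ->
  vint 0 t (delayed_circle d a e) = d *: a + (circle_primitive a e (t - d) - circle_primitive a e 0).
Proof.
move=> o d0 dt; have fD := tangent_field_delayed_circle d o.
have cD := tangent_field_vcontinuous fD.
rewrite (vint_chasles d); congr (_ + _).
  rewrite (@eq_vint _ _ _ _ _ (fun=> a)) // ?vint_cst ?subr0 //.
    by apply: tangent_field_vcontinuous; apply: tangent_field_cst; case: o.
  by move=> s /andP[_ sd]; exact: delayed_circle_early.
rewrite -(subrr d) -vint_circle //; apply: eq_vint => //.
  apply/tangent_field_vcontinuous/tangent_field_circle => // x y.
  by have -> : x - d - (y - d) = x - y by ring.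
by move=> s /andP[ds _]; exact: delayed_circle_late.
Qed.

Lemma connection_delayed_circle d a e t : orthonormal2 a e -> 0 <= d -> d <= t ->
  connection a (circle a e (t - d)) t (vint 0 t (delayed_circle d a e)).
Proof.
move=> o d0 dt; exists (delayed_circle d a e); split=> //.
- exact: tangent_field_delayed_circle.
- exact: le_trans d0 dt.
- by rewrite delayed_circle_early.
- exact: delayed_circle_late.
Qed.

Lemma polar_coordinates a b : (2 <= n)%N -> dotv a a = 1 -> dotv b b = 1 ->
  exists psi e, [/\ 0 <= psi <= pi, orthonormal2 a e & b = circle a e psi].
Proof.
move=> n2 a1 b1; set p := dotv a b.
have p1 : -1 <= p <= 1 by rewrite unit_dot_geN1 // unit_dot_le1.
exists (acos p).
have psi : 0 <= acos p <= pi by rewrite acos_ge0 // acos_lepi.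
have c : cos (acos p) = p by rewrite acosK.
have [s0|s0] := eqVneq (sin (acos p)) 0.
  have [e [e1 ae]] := exists_unit_orthogonal n2 a1.
  exists e; split=> //.
  apply/eqP; rewrite -subr_eq0; apply/eqP/dot_eq0.
  have p2 : p ^+ 2 = 1 by have := cos2sin2 (acos p); rewrite s0 c expr0n subr0.
  rewrite /circle s0 scale0r addr0 c dot_sub_sqr b1 !dotE a1 (dotC b a) -/p.
  by move: p2; rewrite expr2 => p2; lra.
exists ((sin (acos p))^-1 *: (b - p *: a)); split=> //.
  have p2 := sin2cos2 (acos p); rewrite c in p2.
  split=> //; rewrite !dotE a1 ?b1 ?(dotC b a) -/p; last by ring.
  transitivity ((sin (acos p))^-1 ^+ 2 * sin (acos p) ^+ 2); last by field.
  by rewrite p2; ring.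
by rewrite /circle scalerA divff // scale1r c addrC subrK.
Qed.

(** A shallow S shaped detour from direction [a] back to direction [a], which
    advances by [X] along [a] and by [y * X] sideways. It consists of two arcs
    of equal radius and turning angle [2 * atan y], so its length exceeds [X]
    only by a term of second order in [y]. *)
Lemma connection_detour a e X y : orthonormal2 a e -> 0 < X -> 0 < y -> 4 * y <= X ->
  exists2 T, 0 < T <= X + X * y ^+ 2 & connection a a T (X *: a + (y * X) *: e).
Proof.
move=> o X0 y0 yX; pose al := 2 * atan y.
have ta : tan (atan y) = y by rewrite atanK.
have a0 : 0 < atan y by have := lt_atan y0; rewrite atan0.
have api := atan_ltpi2 y.
have cp : 0 < cos (atan y) by apply: cos_gt0_pihalf; rewrite api andbT; lra.
have sE : sin (atan y) = tan (atan y) * cos (atan y) by rewrite /tan divfK // gt_eqF.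
rewrite ta in sE.
have sal : sin al = 2 * (y * cos (atan y) ^+ 2).
  by rewrite /al mulr_natl sin_mulr2n sE mulr2n; ring.
have cal : 1 - cos al = 2 * (y ^+ 2 * cos (atan y) ^+ 2).
  by rewrite /al mulr_natl cos_mulr2n mulr2n -exprMn -sE; have := cos2Dsin2 (atan y); lra.
have sc : cos (atan y) ^+ 2 * (1 + y ^+ 2) = 1.
  have := cos2Dsin2 (atan y); by rewrite sE exprMn mulrDr mulr1 [_ * y ^+ 2]mulrC.
have salp : 0 < sin al by rewrite sal !mulr_gt0 // exprn_gt0.
have alp : 0 < al by rewrite /al mulr_gt0.
have atan_le : atan y <= y.
  have d1 x : is_derive x 1 (@atan R) (1 + x ^+ 2)^-1 by exact: is_derive1_atan.
  have d2 x : is_derive x 1 (fun y : R => y) 1 by der.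
  have := le_of_derive (ltW y0) d1 d2; rewrite atan0 !subr0; apply => x _.
  by rewrite invf_le1; have := sqr_ge0 x; lra.
pose T := X * al / sin al.
have T0 : 0 < T by rewrite /T divr_gt0 // mulr_gt0.
exists T.
  rewrite T0 /= /T ler_pdivrMr //.
  have -> : (X + X * y ^+ 2) * sin al = X * (2 * y) * (cos (atan y) ^+ 2 * (1 + y ^+ 2)).
    by rewrite sal; ring.
  by rewrite sc mulr1 ler_pM2l // /al; lra.
(* each arc turns by [al] in time [T / 2]: the speed condition *)
have speed : al <= T / 2.
  rewrite /T -(ler_pM2r salp) (_ : X * al / sin al / 2 * sin al = al * (X / 2)); last first.
    by field; rewrite gt_eqF.
  rewrite ler_pM2l // sal.
  have : y * cos (atan y) ^+ 2 <= y.
    by apply: ler_piMr; [exact: ltW|rewrite cos2sin2; have := sqr_ge0 (sin (atan y)); lra].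
  lra.
have T2 : 0 < T / 2 by rewrite divr_gt0.
have up : connection (circle a e 0) (circle a e al) (T / 2) _ :=
  connection_circle o T2 (negbT (lt_eqF alp)) _.
have down : connection (circle a e al) (circle a e 0) (T / 2) _ :=
  connection_circle o T2 (negbT (gt_eqF alp)) _.
have := connection_join (up _) (down _).
rewrite subr0 sub0r normrN (gtr0_norm alp) => /(_ speed speed).
rewrite circle0 (_ : T / 2 + T / 2 = T); last by field.
congr (connection _ _ _ _); rewrite /circle_primitive sin0 cos0 scale0r scale1r sub0r.
have sn0 : sin al != 0 by rewrite gt_eqF.
have an0 : al != 0 by rewrite gt_eqF.
apply: dot_extl => h; rewrite !dotE.
have yE : (1 - cos al) / sin al = y.
  rewrite cal sal; field; rewrite !gt_eqF ?exprn_gt0 //.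
rewrite -yE /T; field.
by rewrite sn0 an0.
Qed.

End Paths.

(** * First order optimality after a line segment *)

Section Shortest.
Variables (R : realType) (n : nat).
Implicit Types (U W : R -> 'rV[R]_n) (a b e h u D V : 'rV[R]_n) (c d s t x y T : R).

(** [T] is the least length of a curve of curvature at most one with the same
    initial and terminal positions and directions. *)
Definition shortest_field T U :=
  tangent_field U /\
  forall T', 0 < T' -> connection (U 0) (U T) T' (vint 0 T U) -> T <= T'.

Lemma shortest_field_opp_reverse T U : shortest_field T U ->
  shortest_field T (fun s => - U (T - s)).
Proof.
move=> [fU mU]; split=> [|T' T'0]; first exact: tangent_field_opp_reverse.
have cU := tangent_field_vcontinuous fU.
rewrite vint_opp_reverse // subr0 !subrr => -[W [fW _ W0 WT WV]].
apply: mU => //; exists (fun s => - W (T' - s)); split.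
- exact: tangent_field_opp_reverse.
- exact: ltW.
- by rewrite subr0 WT opprK.
- by rewrite subrr W0 opprK.
- rewrite vint_opp_reverse; last exact: tangent_field_vcontinuous.
  by rewrite subrr subr0 WV opprK.
Qed.

(** Replacing the piece of the curve after a line segment by another one of
    length [T'] displaces its end by [- D]. Lengthening the segment makes up for
    the component of [D] along [u], and the remaining component is absorbed by
    a detour on the segment at a second order cost only. *)
Lemma shortest_after_line T U u c d : shortest_field T U ->
  0 <= c -> c < d -> d <= T -> (forall s, c <= s <= d -> U s = u) ->
  exists2 rho, 0 < rho & exists2 K, 0 < K &
    forall t T' V, d <= t <= T -> connection u (U t) T' V ->
      enorm (vint d t U - V) <= rho ->
      t - d <= T' + dotv u (vint d t U - V) + K * enorm (vint d t U - V) ^+ 2.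
Proof.
move=> [fU mU] c0 cd dT line; pose X := (d - c) / 2.
have X0 : 0 < X by rewrite /X divr_gt0 // subr_gt0.
have [Uc Ud] : U c = u /\ U d = u by split; apply: line; rewrite lexx ?ltW.
have u1 : dotv u u = 1 by rewrite -Ud fU.1.
have cU := tangent_field_vcontinuous fU.
exists (Num.min X (X ^+ 2 / 4)).
  by rewrite lt_min X0 divr_gt0 // exprn_gt0.
exists X^-1; first by rewrite invr_gt0.
move=> t T' V /andP[dt tT] pV.
have [D DE] : exists D, D = vint d t U - V by exists (vint d t U - V).
rewrite -DE.
rewrite le_min => /andP[DX DX2].
pose m := dotv u D.
have [del delE] : exists del, del = D - m *: u by exists (D - m *: u).
have mX : - X <= m.
  have : `|m| <= enorm D.
    by apply: le_trans (cauchy_schwarz _ _) _; have /enorm1P -> := u1; rewrite mul1r.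
  by rewrite ler_norml => /andP[h _]; lra.
have delD : enorm del ^+ 2 <= enorm D ^+ 2.
  rewrite !enorm_sqr delE dot_sub_sqr !dotE u1 (dotC D) -/m.
  by have := sqr_ge0 m; rewrite expr2; lra.
have T'0 : 0 <= T' by have [W []] := pV.
have [T1 /andP[T10 T1le] p1] : exists2 T1, 0 < T1 <= X + X^-1 * enorm del ^+ 2 &
    connection u u T1 (X *: u + del).
  have [d0|d0] := eqVneq (enorm del) 0.
    exists X; first by rewrite X0 d0 expr0n mulr0 addr0 lexx.
    by rewrite (enorm_eq0 d0) addr0; apply: connection_cst => //; exact: ltW.
  have dp : 0 < enorm del by rewrite lt_neqAle eq_sym d0 enorm_ge0.
  have o : orthonormal2 u ((enorm del)^-1 *: del).
    split=> //; first by rewrite !dotE -enorm_sqr; field.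
    by rewrite delE !dotE u1 -/m; ring.
  have dX : 4 * (enorm del / X) <= X.
    rewrite mulrA ler_pdivrMr // -expr2.
    have : enorm del <= enorm D by rewrite -ler_sqr ?nnegrE ?enorm_ge0.
    by lra.
  have [T1 T1le p1] := connection_detour o X0 (divr_gt0 dp X0) dX.
  exists T1.
    by move: T1le; congr (_ && (_ <= _ + _)); field; rewrite gt_eqF.
  by move: p1; rewrite divfK ?gt_eqF // scalerA divff // scale1r.
have p2 : connection u u (X + m) ((X + m) *: u) by apply: connection_cst => //; lra.
have total : connection (U 0) (U T) (c - 0 + (T1 + (X + m + (T' + (T - t)))))
    (vint 0 c U + (X *: u + del + ((X + m) *: u + (V + vint t T U)))).
  apply: connection_join (connection_sub fU c0) _; rewrite Uc.
  by apply: connection_join p1 (connection_join p2 (connection_join pV (connection_sub fU tT))).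
have line_int : vint c d U = (X + X) *: u.
  rewrite (@eq_vint _ _ _ _ _ (fun=> u)) ?vint_cst //.
  - by congr (_ *: _); rewrite /X; field.
  - exact: ltW.
  - by apply: tangent_field_vcontinuous; exact: tangent_field_cst.
have disp : vint 0 T U =
    vint 0 c U + (X *: u + del + ((X + m) *: u + (V + vint t T U))).
  rewrite (vint_chasles c) (vint_chasles d c) (vint_chasles t d) line_int.
  have -> : vint d t U = D + V by rewrite DE subrK.
  rewrite delE !scalerDl; apply: dot_extl => h; rewrite !dotE; ring.
rewrite -disp in total.
have := mU _ _ total; have : 0 < c - 0 + (T1 + (X + m + (T' + (T - t)))) by lra.
move=> -> /(_ isT); rewrite -/m.
have : X^-1 * enorm del ^+ 2 <= X^-1 * enorm D ^+ 2.
  by apply: ler_wpM2l => //; rewrite invr_ge0 ltW.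
have -> : d = c + 2 * X by rewrite /X; field.
lra.
Qed.

End Shortest.

(** * Comparison with great circles *)

Section Comparison.
Variables (R : realType) (n : nat).
Implicit Types (U W : R -> 'rV[R]_n) (a b e f h u x : 'rV[R]_n) (s t y psi al ph : R).

(** A point of an arc is a combination of the two end points of the arc. For
    [x] on a curve of speed at most one, the two terms on the right compare [x]
    with the arc as seen from each end. *)
Lemma circle_interpolation a e x psi y :
  sin psi * (1 - dotv x (circle a e y)) =
  sin (psi - y) * (cos y - dotv x a) + sin y * (cos (psi - y) - dotv x (circle a e psi)).
Proof.
rewrite !dot_circle sinB cosB; have := cos2Dsin2 y.
move: (dotv x a) (dotv x e) => p q h.
have -> : sin psi * (1 - (cos y * p + sin y * q)) =
    sin psi * (cos y ^+ 2 + sin y ^+ 2) * (1 - (cos y * p + sin y * q)).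
  by rewrite h mulr1.
have -> : (sin psi * cos y - cos psi * sin y) * (cos y - p) +
    sin y * (cos psi * cos y + sin psi * sin y - (cos psi * p + sin psi * q)) =
    sin psi * (cos y ^+ 2 + sin y ^+ 2) - sin psi * (cos y * p + sin y * q) by ring.
by rewrite h; ring.
Qed.

Lemma angle_le_of_near a b c al ph y : dotv a a = 1 -> dotv b b = 1 -> dotv c c = 1 ->
  0 <= al <= pi -> 0 <= ph <= pi -> 0 <= y -> (y <= pi -> cos y <= dotv b c) ->
  dotv a b = cos al -> dotv a c = cos ph -> al <= ph + y.
Proof.
move=> a1 b1 c1 /andP[al0 alpi] /andP[ph0 phpi] y0 bc ab ac.
have [big|small] := ltP pi (ph + y); first by apply: le_trans alpi (ltW big).
apply: le_of_cos_le; rewrite ?al0 ?small ?addr_ge0 //.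
rewrite -ab; apply: (cos_triangle a1 c1 b1); rewrite ?ac //.
by rewrite dotC; apply: bc; lra.
Qed.

Lemma angle_change U a s t al ph : tangent_field U -> dotv a a = 1 -> s <= t ->
  0 <= al <= pi -> 0 <= ph <= pi -> dotv a (U s) = cos al -> dotv a (U t) = cos ph ->
  al <= ph + (t - s) /\ ph <= al + (t - s).
Proof.
move=> fU a1 st al0 ph0 as_ at_.
have near : t - s <= pi -> cos (t - s) <= dotv (U s) (U t) by exact: tangent_field_dot_ge.
have ts : 0 <= t - s by rewrite subr_ge0.
split; first exact: (angle_le_of_near a1 (fU.1 s) (fU.1 t)).
by apply: (angle_le_of_near a1 (fU.1 t) (fU.1 s)) => //; rewrite dotC.
Qed.

(** [U] is compared with the fastest curve that has the same values at the
    times [0] and [t] and moves as late as possible. Their distance is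
    controlled by how much closer the latter stays to the starting point. *)
Lemma delayed_circle_deviation U a e t psi s : tangent_field U -> orthonormal2 a e ->
  t <= pi / 2 -> 0 <= psi <= t -> U 0 = a -> U t = circle a e psi -> 0 <= s <= t ->
  1 - dotv (U s) (delayed_circle (t - psi) a e s) <=
  dotv a (delayed_circle (t - psi) a e s) - dotv a (U s).
Proof.
move=> fU o tpi /andP[psi0 psit] U0 Ut /andP[s0 st].
have [a1 e1 ae] := o.
have [early|late] := leP s (t - psi).
  by rewrite delayed_circle_early // a1 (dotC a).
rewrite delayed_circle_late; last exact: ltW.
set y := s - (t - psi); have yp : 0 < y by rewrite /y subr_gt0.
have ypsi : y <= psi by rewrite /y; lra.
have psiy : psi - y = t - s by rewrite /y; ring.
have pipos := pi_gt0 R.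
have sp : 0 < sin psi by apply: sin_gt0_pi; lra.
have sy : 0 <= sin y by apply: sin_ge0_pi; lra.
have spy0 : 0 <= sin (psi - y) by apply: sin_ge0_pi; lra.
have spy : sin (psi - y) <= sin psi.
  by rewrite -!cosBpihalf -cosN -[leRHS]cosN; apply: cos_mono; lra.
rewrite dot_circle_center //.
have := circle_interpolation a e (U s) psi y; rewrite -Ut psiy.
have near : cos (t - s) <= dotv (U s) (U t) by apply: tangent_field_dot_ge => //; lra.
rewrite -psiy in near *; move=> id.
set N := 1 - _ in id *; rewrite (dotC a); set g := cos y - _ in id *.
have N0 : 0 <= N by rewrite subr_ge0 unit_dot_le1 ?fU.1 ?circle_unit.
have bound : sin psi * N <= sin (psi - y) * g.
  rewrite id gerDl; apply: mulr_ge0_le0 => //.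
  by rewrite subr_le0.
have [g0|g0] := leP 0 g.
  by rewrite -(ler_pM2l sp) (le_trans bound) // ler_wpM2r.
have N_0 : N = 0.
  apply/eqP; rewrite eq_le N0 andbT -(ler_pM2l sp) mulr0 (le_trans bound) //.
  by apply: mulr_ge0_le0 => //; exact: ltW.
have Us : U s = circle a e y.
  by apply: unit_dot_eq1; rewrite ?fU.1 ?circle_unit //; move: N_0; rewrite /N; lra.
by rewrite N_0 /g Us dotC dot_circle_center // subrr.
Qed.

Lemma enorm_sub_unit_sqr a b : dotv a a = 1 -> dotv b b = 1 ->
  enorm (a - b) ^+ 2 = 2 * (1 - dotv a b).
Proof. by move=> a1 b1; rewrite enorm_sqr dot_sub_unit. Qed.

End Comparison.

(** * The circular arc that follows a line segment *)

Section Tail.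
Variables (R : realType) (n : nat).
Hypothesis n2 : (2 <= n)%N.
Variables (V : R -> 'rV[R]_n) (u : 'rV[R]_n) (B rho K : R).
Hypothesis fV : tangent_field V.
Hypothesis V0 : V 0 = u.
Hypothesis rho0 : 0 < rho.
Hypothesis K0 : 0 < K.
Hypothesis first_order : forall t T' W, 0 <= t <= B -> connection u (V t) T' W ->
  enorm (vint 0 t V - W) <= rho ->
  t <= T' + dotv u (vint 0 t V - W) + K * enorm (vint 0 t V - W) ^+ 2.
Implicit Types (e f : 'rV[R]_n) (s t x y tau be sg psi : R).

Let u1 : dotv u u = 1. Proof. by rewrite -V0 fV.1. Qed.
Let cV : vcontinuous V. Proof. exact: tangent_field_vcontinuous. Qed.

(** With [g] the gain of the comparison curve along [u], the squared distance
    to it is at most [2 * g] pointwise, so by Cauchy-Schwarz over a time [t]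
    the second order cost is at most [2 * t * K] times the total gain. For
    small [t] this forces the gain to vanish. *)
Lemma initial_arc : 0 < B -> (forall t, 0 < t <= B -> exists2 s, 0 <= s <= t & V s <> u) ->
  exists t e, [/\ 0 < t <= B, orthonormal2 u e & forall s, 0 <= s <= t -> V s = circle u e s].
Proof.
move=> B0 moves.
pose t := Num.min (Num.min B 1) (Num.min (rho / 2) (1 / (4 * K))).
have t0 : 0 < t by rewrite /t !lt_min B0 ltr01 !divr_gt0 ?mulr_gt0.
have [tB t1 trho tK] : [/\ t <= B, t <= 1, t <= rho / 2 & t <= 1 / (4 * K)].
  by rewrite /t; split; rewrite !ge_min lexx ?orbT.
have tpi : t <= pi / 2 by apply: le_trans t1 (pihalf_ge1 R).
have pipos := pi_gt0 R.
have [psi [e [psi0 o Vt]]] := polar_coordinates n2 u1 (fV.1 t).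
have psit : psi <= t.
  have h0 : 0 <= (0 : R) <= pi by rewrite lexx ltW.
  have c0 : dotv u (V 0) = cos 0 by rewrite V0 u1 cos0.
  have ct : dotv u (V t) = cos psi by rewrite Vt dot_circle_center.
  by have [_] := angle_change fV u1 (ltW t0) h0 psi0 c0 ct; rewrite add0r subr0.
have {psi0} psi0 : 0 <= psi by case/andP: psi0.
pose sg := t - psi; pose C := delayed_circle sg u e.
have sg0 : 0 <= sg by rewrite /sg subr_ge0.
have sgt : sg <= t by rewrite /sg; lra.
have fC : tangent_field C by exact: tangent_field_delayed_circle.
have cC := tangent_field_vcontinuous fC.
have dev s : 0 <= s <= t -> 1 - dotv (V s) (C s) <= dotv u (C s) - dotv u (V s).
  by apply: delayed_circle_deviation => //; rewrite psi0.
pose g s := dotv u (C s) - dotv u (V s).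
have cg : continuous g.
  by apply: continuous_lamD; [|apply: continuous_lamN]; exact: dot_vcontinuous.
have g0 s : 0 <= s <= t -> 0 <= g s.
  move=> /dev; apply: le_trans; rewrite subr_ge0.
  by apply: unit_dot_le1; [exact: fV.1|exact: fC.1].
have [D DE] : exists D, D = vint 0 t V - vint 0 t C by exists (vint 0 t V - vint 0 t C).
have DI : D = vint 0 t (fun s => V s - C s) by rewrite DE vintB.
pose G := rint 0 t g.
have uD : dotv u D = - G.
  rewrite DE dotDr dotNr !dot_vint // /G /g rintD; last 2 first.
  - exact: dot_vcontinuous.
  - by apply: continuous_lamN; exact: dot_vcontinuous.
  rewrite (_ : (fun x => - _) = fun x => -1 * dotv u (V x)); last first.
    by apply: funext => x; rewrite mulN1r.
  by rewrite rintZ; [ring|exact: dot_vcontinuous].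
have Dsqr : enorm D ^+ 2 <= 2 * t * G.
  have h : enorm D ^+ 2 <= t * G + enorm D ^+ 2 / 2.
    rewrite {1}enorm_sqr {2}DI dot_vint; last exact: vcontinuousB.
    have -> : t * G + enorm D ^+ 2 / 2 =
        rint 0 t (fun s => t * g s + enorm D ^+ 2 / (2 * t)).
      rewrite rintD; last 2 first.
      - by apply: continuous_lamM => //; exact: continuous_lam_cst.
      - exact: continuous_lam_cst.
      by rewrite rint_cst rintZ // /G; field; rewrite gt_eqF.
    apply: le_rint; first exact: ltW.
    - by apply: dot_vcontinuous; exact: vcontinuousB.
    - apply: continuous_lamD; last exact: continuous_lam_cst.
      by apply: continuous_lamM => //; exact: continuous_lam_cst.
    move=> s /dev h; have hE := enorm_sub_unit_sqr (fV.1 s) (fC.1 s).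
    have := dot_ge0 (t *: (V s - C s) - D).
    rewrite dot_sub_sqr !dotZl !dotZr -!enorm_sqr hE (dotC _ D).
    move: (dotv D _) => z; rewrite -/(g s) in h *; move: h.
    set N := 1 - _; set d2 := enorm D ^+ 2 => h h2.
    rewrite -(ler_pM2l (mulr_gt0 (ltr0Sn R 1) t0)).
    have -> : 2 * t * (t * g s + d2 / (2 * t)) = 2 * t ^+ 2 * g s + d2.
      by field; rewrite gt_eqF.
    have : t ^+ 2 * N <= t ^+ 2 * g s by rewrite ler_pM2l // exprn_gt0.
    by rewrite expr2; lra.
  by lra.
have G0 : G <= 0.
  have conn : connection u (V t) t (vint 0 t C).
    have := connection_delayed_circle o sg0 sgt.
    by rewrite (_ : t - sg = psi) -?Vt // /sg; ring.
  have Drho : enorm D <= rho.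
    rewrite DI; apply: le_trans (@enorm_vint_le_cst _ _ _ _ _ 2 (ltW t0) _ _) _.
    - exact: vcontinuousB.
    - move=> s _; apply: le_trans (enorm_triangle _ _) _; rewrite enormN.
      by have /enorm1P -> := fV.1 s; have /enorm1P -> := fC.1 s; lra.
    - by rewrite subr0; lra.
  have tt : 0 <= t <= B by rewrite ltW.
  have := first_order tt conn; rewrite -DE => /(_ Drho); rewrite uD => h.
  have h2 : K * enorm D ^+ 2 <= K * (2 * t * G) by rewrite ler_pM2l.
  have h3 : 4 * (K * t) <= 1.
    by move: tK; rewrite ler_pdivlMr ?mulr_gt0 //; lra.
  have G0 : 0 <= G by apply: rint_ge0 => //; exact: ltW.
  have : K * (2 * t * G) <= G / 2.
    have -> : K * (2 * t * G) = 4 * (K * t) * (G / 2) by field.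
    by apply: ler_piMl => //; lra.
  by lra.
have gz := rint_le0_eq0 t0 cg g0 G0.
have VC s : 0 <= s <= t -> V s = C s.
  move=> st; have := dev s st; rewrite -/(g s) gz // => h.
  apply: unit_dot_eq1; [exact: fV.1|exact: fC.1|].
  by have := unit_dot_le1 (fV.1 s) (fC.1 s); lra.
have sgz : sg = 0.
  apply/eqP; apply: contrapT => /negP sgn.
  have sgp : 0 < sg by rewrite lt_neqAle eq_sym sgn.
  have sgB : 0 < sg <= B by rewrite sgp (le_trans sgt).
  have [s /andP[s0 ssg]] := moves sg sgB.
  case; rewrite VC ?s0 ?(le_trans ssg) //.
  exact: delayed_circle_early.
exists t, e; split; rewrite ?t0 // => s /[dup] /andP[s0 _] /VC ->.
by rewrite /C sgz delayed_circle_late // subr0.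
Qed.

(** Polar coordinates of [V (be + tau)] around [u], with an angle [psi] counted
    continuously from [be] even when the arc has passed the antipode of [u]. *)
Lemma arc_angle be tau e : 0 < be < pi *+ 2 -> sin be != 0 -> orthonormal2 u e ->
  (forall s, 0 <= s <= be -> V s = circle u e s) -> 0 < tau -> tau <= `|sin be| ->
  exists psi f, [/\ be - tau <= psi <= be + tau, orthonormal2 u f,
    V (be + tau) = circle u f psi &
    forall s, be <= s <= be + tau -> 0 <= sin be * (dotv u (V s) - cos s)].
Proof.
move=> /andP[be0 be2] sb o arc tau0 tausb; have pipos := pi_gt0 R.
have ubE : dotv u (V be) = cos be.
  by rewrite arc ?lexx ?ltW // dot_circle_center.
have [ph [f [ph0 of_ Vt]]] := polar_coordinates n2 u1 (fV.1 (be + tau)).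
have [ph_ge0 ph_pi] := andP ph0.
have uVt : dotv u (V (be + tau)) = cos ph by rewrite Vt dot_circle_center.
have le_tau : be <= be + tau by rewrite lerDl ltW.
have uV s : exists2 x, 0 <= x <= pi & dotv u (V s) = cos x.
  have h : -1 <= dotv u (V s) <= 1 by rewrite unit_dot_geN1 ?unit_dot_le1 ?fV.1.
  by exists (acos (dotv u (V s))); rewrite ?acosK ?acos_ge0 ?acos_lepi.
move: be2; rewrite mulr2n => be2.
have [bepi|pibe] := ltP be pi.
  have sbp : 0 < sin be by apply: sin_gt0_pi; rewrite be0.
  have tau_pi : be + tau <= pi.
    have : sin (pi - be) <= pi - be by apply: sin_le_id; lra.
    rewrite sinB sinpi cospi mul0r sub0r mulN1r opprK.
    by move: tausb; rewrite gtr0_norm //; lra.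
  have be_in : 0 <= be <= pi by rewrite !ltW.
  have [h1 h2] := angle_change fV u1 le_tau be_in ph0 ubE uVt.
  have tE : be + tau - be = tau by ring.
  rewrite tE in h1 h2.
  exists ph, f; split=> //; first by apply/andP; split; lra.
  move=> s /andP[bes st]; apply: mulr_ge0; first exact: ltW.
  rewrite subr_ge0; have [x x0 ux] := uV s; rewrite ux.
  have [_ h] := angle_change fV u1 bes be_in x0 ubE ux.
  by case/andP: x0 => x0 xpi; apply: cos_mono; lra.
pose al := pi + pi - be.
have al_in : 0 <= al <= pi by rewrite /al; apply/andP; split; lra.
have cosal x : cos (pi + pi - x) = cos x.
  by rewrite cosB -mulr2n cos2pi sin2pi; ring.
have sinal x : sin (pi + pi - x) = - sin x.
  by rewrite sinB -mulr2n cos2pi sin2pi; ring.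
have ubE' : dotv u (V be) = cos al by rewrite cosal.
have [h1 h2] := angle_change fV u1 le_tau al_in ph0 ubE' uVt.
have tE : be + tau - be = tau by ring.
rewrite tE in h1 h2.
have sal0 : 0 <= sin al by apply: sin_ge0_pi.
have sbn : sin be < 0.
  by move: sal0; rewrite sinal oppr_ge0 lt_neqAle => ->; rewrite sb.
have tau_al : tau <= al.
  have : sin al <= al by apply: sin_le_id; case/andP: al_in.
  by move: tausb; rewrite ltr0_norm // sinal; lra.
exists (pi + pi - ph), (- f); split.
- by rewrite /al in h1 h2; apply/andP; split; lra.
- by case: of_ => _ f1 uf; split; rewrite ?dotNl ?dotNr ?opprK ?uf ?oppr0.
- by rewrite Vt /circle cosal sinal scalerN scaleNr opprK.
move=> s /andP[bes st]; rewrite -mulrNN; apply: mulr_ge0; first by rewrite oppr_ge0 ltW.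
rewrite opprB subr_ge0; have [x x0 ux] := uV s; rewrite ux -(cosal s).
have [h _] := angle_change fV u1 bes al_in x0 ubE' ux.
by case/andP: x0 => x0 xpi; apply: cos_mono; rewrite /al in h tau_al *; lra.
Qed.

Section NearbyCircle.
Variables (be tau psi sg : R) (e f : 'rV[R]_n).
Hypothesis tau0 : 0 < tau.
Hypothesis sb : sin be != 0.
Hypothesis tau_sb : tau <= `|sin be| ^+ 2 / 16.
Hypothesis tau_be : tau <= be / 2.
Hypothesis sg0 : 0 <= sg.
Hypothesis sg2 : sg <= 2 * tau.
Hypothesis psiE : psi = be + tau - sg.
Hypothesis o : orthonormal2 u e.
Hypothesis of_ : orthonormal2 u f.
Hypothesis arc : forall s, 0 <= s <= be -> V s = circle u e s.
Hypothesis Vt : V (be + tau) = circle u f psi.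
Hypothesis cosV : forall s, be <= s <= be + tau -> 0 <= sin be * (dotv u (V s) - cos s).

Local Ltac slra := have := tau0; have := tau_be; have := sg0; have := sg2; lra.

Let k := `|sin be|.
Let z := Num.sg (sin be).
Let C := delayed_circle sg u f.

Let k0 : 0 < k. Proof. by rewrite normr_gt0. Qed.
Let k1 : k <= 1. Proof. by rewrite ler_norml sin_geN1 sin_le1. Qed.
Let tau_k : tau <= k / 16.
Proof. by apply: le_trans tau_sb _; rewrite -/k expr2; have := k0; have := k1; nra. Qed.
Let tau1 : tau <= 1 / 16. Proof. by apply: le_trans tau_k _; have := k1; lra. Qed.
Let tau_pi : tau <= pi. Proof. by have := tau1; have := pi_ge2 R; lra. Qed.
Let sg_be : sg <= be. Proof. by slra. Qed.
Let be0 : 0 < be. Proof. by slra. Qed.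
Let be_t : be <= be + tau. Proof. by slra. Qed.
Let z_norm : `|z| = 1. Proof. by rewrite normr_sg sb. Qed.
Let z_sin_be : z * sin be = k. Proof. by rewrite /k normrEsg. Qed.
Let zz : z * z = 1.
Proof. by have := real_normK (num_real z); rewrite z_norm expr1n expr2. Qed.
Let fC : tangent_field C. Proof. exact: tangent_field_delayed_circle. Qed.
Let cC : vcontinuous C. Proof. exact: tangent_field_vcontinuous. Qed.
Let CE s : be <= s -> C s = circle u f (s - sg).
Proof. by move=> bes; apply: delayed_circle_late; exact: le_trans sg_be bes. Qed.
Let Vbe : V be = circle u e be. Proof. by apply: arc; rewrite lexx ltW. Qed.

(* The sign [z] treats both sides of the antipode of [u] at once: beyond it
   the curve returns to [u], and the inequalities along [u] are reversed. *)
Let z_sin x c : `|x - be| <= c -> k - c <= z * sin x.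
Proof.
move=> xc; have : `|z * (sin x - sin be)| <= c.
  by rewrite normrM z_norm mul1r (le_trans (sin_lip _ _)).
by rewrite mulrBr z_sin_be ler_norml => /andP[h _]; lra.
Qed.

Let z_sin_psi : k / 2 <= z * sin psi.
Proof.
have h : `|psi - be| <= tau by rewrite psiE ler_norml; apply/andP; split; slra.
by apply: le_trans (z_sin h); have := tau_k; have := k0; lra.
Qed.

Let z_cos s : be <= s <= be + tau -> 0 <= z * (dotv u (V s) - cos s).
Proof.
move=> /cosV; have -> : sin be = z * k by rewrite -z_sin_be mulrA zz mul1r.
by rewrite mulrAC (pmulr_lge0 _ k0).
Qed.

Let defect_ge0 s : 0 <= 1 - dotv (V s) (C s).
Proof. by rewrite subr_ge0; exact: unit_dot_le1 (fV.1 s) (fC.1 s). Qed.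

Let interpolation s : be <= s <= be + tau ->
  z * sin psi * (1 - dotv (V s) (C s)) <=
  sin (be + tau - s) * (z * (cos (s - sg) - dotv u (V s))).
Proof.
move=> /andP[bes st]; rewrite CE // -mulrA circle_interpolation.
have -> : psi - (s - sg) = be + tau - s by rewrite psiE; ring.
rewrite -Vt mulrDr (dotC _ u).
have near : cos (be + tau - s) <= dotv (V s) (V (be + tau)).
  by apply: tangent_field_dot_ge => //; have := tau_pi; slra.
have zs : 0 <= z * sin (s - sg).
  have h : `|s - sg - be| <= 2 * tau by rewrite ler_norml; apply/andP; split; slra.
  by apply: le_trans (z_sin h); have := tau_k; have := k0; lra.
rewrite [X in X + _]mulrCA gerDl mulrA.
by apply: mulr_ge0_le0; rewrite ?subr_le0.
Qed.

Let defect_le s : be <= s <= be + tau -> 1 - dotv (V s) (C s) <= 2 * tau * sg / k.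
Proof.
move=> st; have [bes st'] := andP st.
have h1 : z * (cos (s - sg) - dotv u (V s)) <= sg.
  have h := z_cos st.
  have : `|z * (cos (s - sg) - cos s)| <= sg.
    rewrite normrM z_norm mul1r (le_trans (cos_lip _ _)) //.
    by rewrite (_ : s - sg - s = - sg) ?normrN ?ger0_norm //; ring.
  by rewrite ler_norml => /andP[_]; rewrite !mulrBr in h *; lra.
have st0 : 0 <= sin (be + tau - s) by apply: sin_ge0_pi; have := tau_pi; slra.
have st1 : sin (be + tau - s) <= tau by apply: le_trans (sin_le_id _) _; slra.
have := interpolation st; have := defect_ge0 s; move: h1.
set N := 1 - _; set g := z * _ => h1 N0 h2.
rewrite ler_pdivlMr ?k0 //.
have h3 : sin (be + tau - s) * g <= tau * sg.
  have : sin (be + tau - s) * g <= sin (be + tau - s) * sg by apply: ler_wpM2l.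
  have : sin (be + tau - s) * sg <= tau * sg by apply: ler_wpM2r.
  by lra.
have h4 : k / 2 * N <= z * sin psi * N by apply: ler_wpM2r.
by rewrite mulrC; lra.
Qed.

Let eta := Num.sqrt (4 * tau * sg / k).
Let eta0 : 0 <= eta. Proof. exact: sqrtr_ge0. Qed.
Let eta2 : eta ^+ 2 = 4 * tau * sg / k.
Proof.
rewrite sqr_sqrtr //; apply: mulr_ge0; last by rewrite invr_ge0 ltW.
by apply: mulr_ge0 => //; slra.
Qed.

Let distance_le s : be <= s <= be + tau -> enorm (V s - C s) <= eta.
Proof.
move=> /defect_le h; rewrite enorm_le_sqr // dot_sub_unit ?fV.1 ?fC.1 // eta2.
by move: h; rewrite -!mulrA; lra.
Qed.

Let cos_sub_sg : `|cos (be - sg) - cos be| <= sg.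
Proof.
rewrite (le_trans (cos_lip _ _)) //.
by rewrite (_ : be - sg - be = - sg) ?normrN ?ger0_norm //; ring.
Qed.

Let sin_sub_sg : `|sin (be - sg) - sin be| <= sg.
Proof.
rewrite (le_trans (sin_lip _ _)) //.
by rewrite (_ : be - sg - be = - sg) ?normrN ?ger0_norm //; ring.
Qed.

(** Two great circles through [u] separate by [sin be] times their angle, so
    closeness at the time [be] bounds the angle. *)
Let rotation_le : k * enorm (e - f) <= eta + 2 * sg.
Proof.
rewrite /k -enormZ.
have -> : sin be *: (e - f) = (V be - C be) +
    ((cos (be - sg) - cos be) *: u + (sin (be - sg) - sin be) *: f).
  by rewrite Vbe CE // /circle; apply: dot_extl => h; rewrite !dotE; ring.
have [/enorm1P u1' /enorm1P f1' _] := of_.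
have be_in : be <= be <= be + tau by rewrite lexx.
apply: le_trans (enorm_triangle _ _) _; apply: lerD; first exact: distance_le.
apply: le_trans (enorm_triangle _ _) _; rewrite !enormZ u1' f1' !mulr1.
by have := cos_sub_sg; have := sin_sub_sg; lra.
Qed.

Let vint_arc : vint 0 be V = circle_primitive u e be - circle_primitive u e 0.
Proof.
rewrite -[in RHS](subr0 be) -[X in _ - circle_primitive _ _ X](subr0 0) -vint_circle //.
apply: eq_vint => //; first exact: ltW.
  apply/tangent_field_vcontinuous/tangent_field_circle => // x y.
  by rewrite !subr0.
by move=> s s0; rewrite subr0; exact: arc.
Qed.

Let displacement_split : vint 0 (be + tau) V - vint 0 (be + tau) C =
  ((sin be - sin (be - sg) - sg) *: u + (1 - cos be) *: (e - f) +
   (cos (be - sg) - cos be) *: f) + vint be (be + tau) (fun s => V s - C s).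
Proof.
rewrite vintB // !(vint_chasles be 0 (be + tau)) vint_arc vint_delayed_circle //.
rewrite /circle_primitive sin0 cos0.
by apply: dot_extl => h; rewrite !dotE; ring.
Qed.

Let displacement_le : enorm (vint 0 (be + tau) V - vint 0 (be + tau) C) <=
  (3 + 4 / k) * sg + (1 + 2 / k) * eta.
Proof.
rewrite displacement_split; have [/enorm1P u1' /enorm1P f1' _] := of_.
have d0 : `|sin be - sin (be - sg) - sg| <= 2 * sg.
  apply: le_trans (ler_normB _ _) _; rewrite (ger0_norm sg0) distrC.
  by have := sin_sub_sg; lra.
have d2 : enorm (vint be (be + tau) (fun s => V s - C s)) <= eta.
  apply: le_trans (@enorm_vint_le_cst _ _ _ _ _ eta be_t _ distance_le) _.
    exact: vcontinuousB.
  rewrite (_ : be + tau - be = tau); last by ring.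
  by apply: ler_piMr => //; have := tau1; slra.
have d3 : enorm ((1 - cos be) *: (e - f)) <= 2 * (eta + 2 * sg) / k.
  rewrite enormZ ler_pdivlMr ?k0 //.
  have c2 : `|1 - cos be| <= 2.
    by have := cos_le1 be; have := cos_geN1 be; rewrite ler_norml => *; apply/andP; split; lra.
  rewrite -mulrA (mulrC _ k); apply: ler_pM => //.
  by apply: mulr_ge0; [exact: ltW|exact: enorm_ge0].
have d1 : enorm ((cos (be - sg) - cos be) *: f) <= sg by rewrite enormZ f1' mulr1.
have d4 : enorm ((sin be - sin (be - sg) - sg) *: u) <= 2 * sg by rewrite enormZ u1' mulr1.
have -> : (3 + 4 / k) * sg + (1 + 2 / k) * eta =
    2 * sg + 2 * (eta + 2 * sg) / k + sg + eta.
  by field; rewrite gt_eqF ?k0.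
apply: le_trans (enorm_triangle _ _) _; apply: lerD => //.
apply: le_trans (enorm_triangle _ _) _; apply: lerD => //.
by apply: le_trans (enorm_triangle _ _) _; apply: lerD.
Qed.

Lemma nearby_circle_displacement :
  enorm (vint 0 (be + tau) V - vint 0 (be + tau) C) ^+ 2 <=
  (4 * (3 + 4 / k) ^+ 2 + 8 * (1 + 2 / k) ^+ 2 / k) * (tau * sg).
Proof.
have := displacement_le; set d := enorm _; set A := 3 + _; set A' := 1 + _ => dle.
have A0 : 0 <= A by rewrite /A addr_ge0 // divr_ge0 // ltW.
have A'0 : 0 <= A' by rewrite /A' addr_ge0 // divr_ge0 // ltW.
have h : d ^+ 2 <= (A * sg + A' * eta) ^+ 2.
  rewrite ler_sqr ?nnegrE ?enorm_ge0 //.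
  by apply: addr_ge0; apply: mulr_ge0.
have h1 : (A * sg + A' * eta) ^+ 2 <= 2 * A ^+ 2 * sg ^+ 2 + 2 * A' ^+ 2 * eta ^+ 2.
  have h0 := sqr_ge0 (A * sg - A' * eta); rewrite -subr_ge0.
  by move: h0; congr (_ <= _); ring.
have h2 : 2 * A ^+ 2 * sg ^+ 2 <= 4 * A ^+ 2 * (tau * sg).
  have e2 : sg ^+ 2 <= 2 * tau * sg by rewrite expr2 ler_wpM2r.
  have := ler_wpM2l (mulr_ge0 (ler0n R 2) (sqr_ge0 A)) e2.
  by congr (_ <= _); ring.
apply: le_trans h _; apply: le_trans h1 _.
have -> : (4 * A ^+ 2 + 8 * A' ^+ 2 / k) * (tau * sg) =
    4 * A ^+ 2 * (tau * sg) + 2 * A' ^+ 2 * eta ^+ 2.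
  by rewrite eta2; field; rewrite gt_eqF ?k0.
by apply: lerD.
Qed.

Let sin_gain x : be - sg <= x - sg -> x <= be + tau ->
  sin x - sin (x - sg) <= (cos be + 3 * tau) * sg.
Proof.
move=> bx xt; rewrite [X in _ * X](_ : sg = x - (x - sg)); last by ring.
apply: sin_diff_le_cos; first by slra.
move=> y /andP[y1 y2]; have : cos y - cos be <= 3 * tau; last by slra.
apply: le_trans (ler_norm _) _; apply: le_trans (cos_lip _ _) _.
by rewrite ler_norml; apply/andP; split; slra.
Qed.

Let rint_cos_le c : (forall s, be <= s <= be + tau -> dotv u (V s) <= cos (s - c)) ->
  rint be (be + tau) (fun s => dotv u (V s)) <= sin (be + tau - c) - sin (be - c).
Proof.
have d x : is_derive x 1 (fun s => sin (s - c)) (cos (x - c)) by der; ring.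
move=> h; rewrite -(rint_primitive _ _ d); apply: le_rint => //; first exact: dot_vcontinuous.
apply: (continuous_lam_comp (@continuous_cos R)).
by apply: continuous_lamD; [exact: continuous_lam_id|exact: continuous_lam_cst].
Qed.

Let dot_displacement : dotv u (vint 0 (be + tau) V - vint 0 (be + tau) C) =
  sin be + rint be (be + tau) (fun s => dotv u (V s)) - sg - sin psi.
Proof.
rewrite dotDr dotNr (vint_chasles be) dotDr -dot_vint // vint_arc.
rewrite vint_delayed_circle //; last by have := sg_be; slra.
rewrite -psiE /circle_primitive sin0 cos0; case: of_ => _ _ uf; case: o => _ _ ue.
by rewrite !dotE u1 uf ue; ring.
Qed.

Let gain_rough : dotv u (vint 0 (be + tau) V - vint 0 (be + tau) C) <=
  - ((1 - cos be - 3 * tau) * sg).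
Proof.
rewrite dot_displacement; have [sbp|sbn] := ltP 0 (sin be).
  have z1 : z = 1 by rewrite /z gtr0_sg.
  have h : rint be (be + tau) (fun s => dotv u (V s)) <= sin (be + tau - sg) - sin (be - sg).
    apply: rint_cos_le => s st; have [bes st'] := andP st.
    have [->|ts] := eqVneq s (be + tau); first by rewrite -psiE Vt dot_circle_center.
    have sp : 0 < sin (be + tau - s).
      apply: sin_gt0_pi; rewrite subr_gt0 lt_neqAle ts st' /=.
      by have := tau1; have := pi_ge2 R; slra.
    have := interpolation st; have : 0 <= z * sin psi * (1 - dotv (V s) (C s)).
      by apply: mulr_ge0 => //; apply: le_trans z_sin_psi; rewrite divr_ge0 // ltW.
    by move=> /le_trans h /h; rewrite pmulr_rge0 // z1 mul1r subr_ge0.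
  have := sin_gain (lexx _) be_t; rewrite -psiE in h; move: h.
  by move: (rint _ _ _) (sin psi) (sin be) (sin (be - sg)) (cos be) => *; lra.
have z1 : z = -1 by rewrite /z ltr0_sg // lt_neqAle sb.
have h : rint be (be + tau) (fun s => dotv u (V s)) <= sin (be + tau - 0) - sin (be - 0).
  by apply: rint_cos_le => s st; rewrite subr0; have := z_cos st; rewrite z1; lra.
have bt : be - sg <= be + tau - sg by slra.
have := sin_gain bt (lexx _); rewrite -psiE; rewrite !subr0 in h; move: h.
by move: (rint _ _ _) (sin psi) (sin be) (sin (be + tau)) (cos be) => *; lra.
Qed.

Lemma nearby_circle_gain :
  dotv u (vint 0 (be + tau) V - vint 0 (be + tau) C) <= - (k ^+ 2 / 4 * sg).
Proof.
apply: le_trans gain_rough _; rewrite lerN2 ler_wpM2r //.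
have c0 := cos_le1 be; have c1 := cos_geN1 be.
have kE : k ^+ 2 = (1 - cos be) * (1 + cos be).
  by rewrite /k real_normK ?num_real // sin2cos2; ring.
have : k ^+ 2 / 2 <= 1 - cos be by rewrite kE; move: (cos be) c0 c1 => c *; nra.
by have := sqr_ge0 k; move: tau_sb; rewrite -/k; move: (k ^+ 2) (cos be) => *; lra.
Qed.

Lemma nearby_circle_eq : sg = 0 -> forall s, 0 <= s <= be + tau -> V s = circle u e s.
Proof.
move=> sgz.
have VCs s : be <= s <= be + tau -> V s = circle u f s.
  move=> st; have := defect_le st; rewrite sgz mulr0 mul0r => h.
  have <- : C s = circle u f s by rewrite CE ?sgz ?subr0 //; case/andP: st.
  apply: (unit_dot_eq1 (fV.1 s) (fC.1 s)); apply/eqP.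
  by rewrite eq_le (unit_dot_le1 (fV.1 s) (fC.1 s)) -subr_le0.
have fe : f = e.
  have : circle u e be = circle u f be by rewrite -Vbe VCs ?lexx.
  rewrite /circle => /addrI h.
  by rewrite -[f]scale1r -[e]scale1r -(mulVf sb) -!scalerA h.
move=> s /andP[s0 st]; have [sbe|bes] := leP s be; first by apply: arc; rewrite s0.
by rewrite VCs ?fe // st ltW.
Qed.

End NearbyCircle.

(** The new piece is compared with an arc of a nearby great circle through
    [u], run through after some rest at [u]: rotating a great circle about [u]
    does not change the motion along [u]. The first order gain is proportional
    to the rest [sg], and the displacement only to [Num.sqrt (tau * sg)]. When
    [sin be = 0] all great circles through [u] meet, and the rotation is not
    small any more. *)
Lemma arc_extends be e : 0 < be < pi *+ 2 -> sin be != 0 -> be < B -> orthonormal2 u e ->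
  (forall s, 0 <= s <= be -> V s = circle u e s) ->
  exists2 tau, 0 < tau <= B - be & forall s, 0 <= s <= be + tau -> V s = circle u e s.
Proof.
move=> bein sb beB o arc; have be0 : 0 < be by case/andP: bein.
pose k := `|sin be|; have k0 : 0 < k by rewrite normr_gt0.
have k1 : k <= 1 by rewrite ler_norml sin_geN1 sin_le1.
have [M ME] : exists M, M = 4 * (3 + 4 / k) ^+ 2 + 8 * (1 + 2 / k) ^+ 2 / k.
  by exists (4 * (3 + 4 / k) ^+ 2 + 8 * (1 + 2 / k) ^+ 2 / k).
have M0 : 0 < M.
  by rewrite ME addr_gt0 ?divr_gt0 ?mulr_gt0 ?exprn_gt0 ?addr_gt0 ?divr_gt0.
pose tau := Num.min (Num.min (B - be) (be / 2)) (Num.min (k ^+ 2 / 16)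
   (Num.min (rho ^+ 2 / (2 * M)) (k ^+ 2 / (8 * (K * M))))).
have tau0 : 0 < tau.
  by rewrite /tau !lt_min subr_gt0 beB !divr_gt0 ?mulr_gt0 ?exprn_gt0.
have [tB tbe tk [trho tK]] : [/\ tau <= B - be, tau <= be / 2, tau <= k ^+ 2 / 16 &
    tau <= rho ^+ 2 / (2 * M) /\ tau <= k ^+ 2 / (8 * (K * M))].
  by rewrite /tau; do !split; rewrite !ge_min lexx ?orbT.
exists tau; first by rewrite tau0.
have k2 : k ^+ 2 <= k by rewrite expr2 ler_piMl // ltW.
have tausb : tau <= `|sin be| by rewrite -/k; lra.
have tau1 : tau <= 1 by rewrite (le_trans tausb).
have [psi [f [/andP[psi1 psi2] of_ Vt cosV]]] := arc_angle bein sb o arc tau0 tausb.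
have [sg sgE] : exists sg, sg = be + tau - psi by exists (be + tau - psi).
have sg0 : 0 <= sg by rewrite sgE subr_ge0.
have sg2 : sg <= 2 * tau by rewrite sgE; lra.
have psiE : psi = be + tau - sg by rewrite sgE; ring.
apply: (nearby_circle_eq tau0 sb tk tbe sg0 sg2 psiE of_ arc Vt cosV).
have D2 := nearby_circle_displacement tau0 sb tk tbe sg0 sg2 psiE o of_ arc Vt cosV.
have gain := nearby_circle_gain tau0 sb tk tbe sg0 sg2 psiE o of_ arc Vt cosV.
rewrite -/k -ME in D2 gain.
have tB' : 0 <= be + tau <= B by apply/andP; split; lra.
have conn : connection u (V (be + tau)) (be + tau) (vint 0 (be + tau) (delayed_circle sg u f)).
  have sgt : sg <= be + tau by lra.
  by have := connection_delayed_circle of_ sg0 sgt; rewrite -psiE -Vt.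
have := first_order tB' conn; move: D2 gain.
move: (dotv u _) => g; set d := enorm _ => D2 gain opt.
have drho : d <= rho.
  rewrite -ler_sqr ?nnegrE ?enorm_ge0 ?(ltW rho0) //; apply: le_trans D2 _.
  have h1 : tau * (2 * M) <= rho ^+ 2 by rewrite -ler_pdivlMr // mulr_gt0.
  have h2 : tau * sg <= 2 * tau.
    have e1 : tau * sg <= 2 * (tau * tau) by rewrite mulrCA ler_wpM2l // ltW.
    have e2 : tau * tau <= tau by rewrite ler_piMl // ltW.
    by move: (tau * tau) (tau * sg) e1 e2 => *; lra.
  have : M * (tau * sg) <= M * (2 * tau) by apply: ler_wpM2l => //; exact: ltW.
  by move: (M * (tau * sg)) h1 => *; lra.
have {}opt := opt drho.
have h1 : K * d ^+ 2 <= K * (M * (tau * sg)) by rewrite ler_pM2l.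
have h2 : tau * (8 * (K * M)) <= k ^+ 2 by rewrite -ler_pdivlMr // !mulr_gt0.
have h3 : K * (M * (tau * sg)) <= k ^+ 2 / 8 * sg.
  have -> : K * (M * (tau * sg)) = tau * (8 * (K * M)) / 8 * sg by field.
  by apply: ler_wpM2r => //; rewrite ler_pM2r.
have k20 : 0 < k ^+ 2 / 8 by rewrite divr_gt0 // exprn_gt0.
have : k ^+ 2 / 8 * sg <= 0.
  move: h1 h3 gain opt; have -> : k ^+ 2 / 4 * sg = 2 * (k ^+ 2 / 8 * sg) by field.
  by move: (k ^+ 2 / 8 * sg) (K * d ^+ 2) (K * (M * _)) => *; lra.
by rewrite pmulr_rle0 // => h; apply/eqP; rewrite eq_le h sg0.
Qed.

Let antipode_circle tau e a f s : 0 < tau < pi -> a = circle u e (pi - tau) ->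
  - u = circle a f tau -> circle a f (s - (pi - tau)) = circle u e s.
Proof.
move=> taupi aE h.
have stp : 0 < sin tau by apply: sin_gt0_pi.
have aE' : a = - cos tau *: u + sin tau *: e.
  by rewrite aE /circle cosB sinB cospi sinpi; congr (_ *: _ + _ *: _); ring.
have fE : f = - sin tau *: u - cos tau *: e.
  have sf : sin tau *: f = - u - cos tau *: a by rewrite h /circle addrAC subrr add0r.
  rewrite -[f]scale1r -(@mulVf _ (sin tau)) ?gt_eqF // -scalerA sf aE'.
  apply: dot_extl => h'; rewrite !dotE.
  have c2 : cos tau * cos tau = 1 - sin tau ^+ 2 by rewrite -cos2sin2 expr2.
  move: (dotv h' u) (dotv h' e) => p q.
  have -> : (sin tau)^-1 * (- p + - (cos tau * (- cos tau * p + sin tau * q))) =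
    (sin tau)^-1 * ((cos tau * cos tau - 1) * p - cos tau * sin tau * q) by ring.
  by rewrite c2; field; rewrite gt_eqF.
rewrite {1}/circle aE' fE.
have cs : cos s = - (cos (s - (pi - tau)) * cos tau) - sin (s - (pi - tau)) * sin tau.
  rewrite {1}(_ : s = pi + (s - (pi - tau) - tau)); last by ring.
  by rewrite cosD cospi sinpi cosB; ring.
have ss : sin s = cos (s - (pi - tau)) * sin tau - sin (s - (pi - tau)) * cos tau.
  rewrite {1}(_ : s = pi + (s - (pi - tau) - tau)); last by ring.
  by rewrite sinD cospi sinpi sinB; ring.
by rewrite /circle cs ss; apply: dot_extl => h'; rewrite !dotE; ring.
Qed.

(** A curve of given length that passes through [- u] half way is the one
    that points most against [u]. *)
Let antipode_gain tau psi e a f : orthonormal2 u e ->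
  (forall s, 0 <= s <= pi -> V s = circle u e s) -> 0 < tau <= 1 / 2 ->
  a = circle u e (pi - tau) -> orthonormal2 a f -> 0 <= psi <= 2 * tau ->
  dotv u (vint (pi - tau) (pi + tau) V -
    (circle_primitive a f psi - circle_primitive a f 0)) <= 0.
Proof.
move=> o arc /andP[tau0 t1] aE of_ /andP[psi0 psi2].
have pi2 := pi_ge2 R; have [_ e1 ue] := o; have [a1 f1 af] := of_.
pose t := pi + tau; pose Q := circle_primitive a f psi - circle_primitive a f 0.
rewrite -/t -/Q.
have Vu s : pi - tau <= s <= t -> dotv u (V s) <= - cos (s - pi).
  move=> /andP[s1 s2]; have [spi|pis] := leP s pi.
    rewrite arc; last by apply/andP; split; lra.
    by rewrite dot_circle_center // cosB cospi sinpi; lra.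
  have uVpi : V pi = - u.
    rewrite arc; last by rewrite lexx andbT; lra.
    by rewrite /circle cospi sinpi scale0r addr0 scaleN1r.
  have := @tangent_field_dot_ge _ _ V pi s fV (ltW pis); rewrite uVpi dotNl.
  by move=> h; rewrite lerNr; apply: h; rewrite /t in s2; lra.
have cos_int : rint (pi - tau) t (fun s => - cos (s - pi)) = - (sin tau + sin tau).
  have d x : is_derive x 1 (fun s => - sin (s - pi)) (- cos (x - pi)) by der; ring.
  rewrite (rint_primitive _ _ d) /t (_ : pi + tau - pi = tau); last by ring.
  by rewrite (_ : pi - tau - pi = - tau) ?sinN; ring.
have old : dotv u (vint (pi - tau) t V) <= - (sin tau + sin tau).
  rewrite dot_vint // -cos_int; apply: le_rint => //.
  - by rewrite /t; lra.
  - exact: dot_vcontinuous.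
  - apply: continuous_lamN; apply: (continuous_lam_comp (@continuous_cos R)).
    by apply: continuous_lamD; [exact: continuous_lam_id|exact: continuous_lam_cst].
have ua : dotv u a = - cos tau.
  by rewrite aE dot_circle_center // cosB cospi sinpi; ring.
have sint : 0 <= sin tau by apply: sin_ge0_pi; apply/andP; split; lra.
have uf : - sin tau <= dotv u f.
  have h : `|dotv (u + cos tau *: a) f| <= sin tau.
    apply: le_trans (cauchy_schwarz _ _) _; have /enorm1P -> := f1; rewrite mulr1.
    rewrite enorm_le_sqr // !dotE u1 (dotC a u) ua a1 sin2cos2.
    by rewrite le_eqVlt; apply/orP; left; apply/eqP; ring.
  by move: h; rewrite dotDl dotZl af mulr0 addr0 ler_norml => /andP[].
have new : - (sin (psi - tau) + sin tau) <= dotv u Q.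
  rewrite /Q /circle_primitive sin0 cos0 !dotE ua sinB.
  have c1 := cos_le1 psi.
  have : (1 - cos psi) * (- sin tau) <= (1 - cos psi) * dotv u f.
    by apply: ler_wpM2l => //; rewrite subr_ge0.
  by move: (sin psi) (cos psi) (sin tau) (cos tau) (dotv u f) => *; lra.
have mono : sin (psi - tau) <= sin tau.
  have sc x : sin x = cos (pi / 2 - x) by rewrite -cosN opprB cosBpihalf.
  by rewrite !sc; apply: cos_mono; lra.
by rewrite dotDr dotNr; move: old new mono; move: (sin _) (sin tau) (dotv u _) => *; lra.
Qed.

(** At the antipode the piece between the times [pi - tau] and [pi + tau] is
    compared with the great circle arc between its ends, which saves some time
    [sg]. The displacement costs [tau * sg] only. Along [u] nothing is lost:
    the old piece passes through [- u] itself, so that none of the same length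
    points more against [u]. *)
Lemma arc_crosses_antipode e : pi < B -> orthonormal2 u e ->
  (forall s, 0 <= s <= pi -> V s = circle u e s) ->
  exists2 tau, 0 < tau <= B - pi & forall s, 0 <= s <= pi + tau -> V s = circle u e s.
Proof.
move=> piB o arc; have pi2 := pi_ge2 R.
have [tau [tau0 tB t1 [trho tK]]] : exists tau, [/\ 0 < tau, tau <= B - pi, tau <= 1 / 2 &
    tau <= rho / 9 /\ tau <= 1 / (72 * K)].
  exists (Num.min (Num.min (B - pi) (1 / 2)) (Num.min (rho / 9) (1 / (72 * K)))).
  split; last split; rewrite ?lt_min ?ge_min ?lexx ?orbT //.
  by rewrite subr_gt0 piB !divr_gt0 // mulr_gt0.
exists tau; first by rewrite tau0.
have [u1' e1 ue] := o.
pose t := pi + tau; pose a := V (pi - tau).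
have aE : a = circle u e (pi - tau) by apply: arc; apply/andP; split; lra.
pose W s := V (pi - tau + s).
have fW : tangent_field W by exact: tangent_field_shift.
have cW := tangent_field_vcontinuous fW.
have W0 : W 0 = a by rewrite /W addr0.
have Wt : W (2 * tau) = V t by congr V; rewrite /t; ring.
have [psi [f [/andP[psi0 psipi] of_ Vt]]] := polar_coordinates n2 (fW.1 0) (fV.1 t).
rewrite W0 in of_ Vt; have [a1 f1 af] := of_.
have tau2 : 2 * tau <= pi / 2 by have := pihalf_ge1 R; lra.
have psi2 : psi <= 2 * tau.
  apply: le_of_cos_le; rewrite ?psi0 ?psipi //; first by apply/andP; split; lra.
  rewrite -(dot_circle_center psi of_) -Vt -Wt -W0 -[X in cos X]subr0.
  by apply: tangent_field_dot_ge => //; lra.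
have [sg sgE] : exists sg, sg = 2 * tau - psi by exists (2 * tau - psi).
have sg0 : 0 <= sg by rewrite sgE subr_ge0.
have sg2 : sg <= 2 * tau by rewrite sgE; lra.
pose C := delayed_circle sg a f.
have fC : tangent_field C by exact: tangent_field_delayed_circle.
have cC := tangent_field_vcontinuous fC.
have psit : 0 <= psi <= 2 * tau by rewrite psi0.
have dev s : 0 <= s <= 2 * tau -> 1 - dotv (W s) (C s) <= 2 * tau * sg.
  move=> /[dup] st /andP[s0 st'].
  have Wt' : W (2 * tau) = circle a f psi by rewrite Wt.
  have := delayed_circle_deviation fW of_ tau2 psit W0 Wt' st; rewrite -sgE -/C.
  move/le_trans; apply.
  have near : cos s <= dotv a (W s).
    by rewrite -W0 -[X in cos X]subr0; apply: tangent_field_dot_ge => //; lra.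
  rewrite /C /delayed_circle dot_circle_center //; set y := Num.max _ _.
  have [y0 ys ysg] : [/\ 0 <= y, y <= s & s - y <= sg].
    by rewrite /y; have [] := leP 0 (s - sg); split; lra.
  have h : cos y - cos s <= s * (s - y).
    apply: cos_diff_le_sin => // x /andP[yx xs].
    by apply: le_trans xs; apply: sin_le_id; exact: le_trans yx.
  have h2 : s * (s - y) <= 2 * tau * sg by apply: ler_pM => //; rewrite subr_ge0.
  by lra.
pose eta := Num.sqrt (4 * tau * sg).
have tsg0 : 0 <= tau * sg by apply: mulr_ge0 => //; exact: ltW.
have eta2 : eta ^+ 2 = 4 * (tau * sg) by rewrite sqr_sqrtr -mulrA // mulr_ge0.
have eta0 : 0 <= eta by exact: sqrtr_ge0.
have WC s : 0 <= s <= 2 * tau -> enorm (W s - C s) <= eta.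
  move=> /dev h; rewrite enorm_le_sqr // dot_sub_unit ?fW.1 ?fC.1 // eta2.
  by move: h; rewrite -mulrA; lra.
pose Q := circle_primitive a f psi - circle_primitive a f 0.
have vW : vint (pi - tau) t V = vint 0 (2 * tau) W.
  by rewrite vint_shift // addr0 (_ : pi - tau + 2 * tau = t) // /t; ring.
have [D DE] : exists D, D = vint 0 t V - (vint 0 (pi - tau) V + Q).
  by exists (vint 0 t V - (vint 0 (pi - tau) V + Q)).
have DV : D = vint (pi - tau) t V - Q.
  by rewrite DE (vint_chasles (pi - tau) 0 t) opprD addrACA subrr add0r.
have Dle : enorm D <= 2 * tau * eta + sg.
  have -> : D = vint 0 (2 * tau) (fun s => W s - C s) + sg *: a.
    rewrite vintB // vint_delayed_circle // DV vW /Q (_ : 2 * tau - sg = psi); last first.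
      by rewrite sgE; ring.
    by apply: dot_extl => h; rewrite !dotE; ring.
  apply: le_trans (enorm_triangle _ _) _; apply: lerD.
    have t20 : 0 <= 2 * tau by lra.
    apply: le_trans (@enorm_vint_le_cst _ _ _ _ _ eta t20 _ WC) _.
      exact: vcontinuousB.
    by rewrite subr0 mulrC.
  by rewrite enormZ ger0_norm //; have /enorm1P -> := a1; rewrite mulr1.
have D2 : enorm D ^+ 2 <= 36 * (tau * sg).
  have h : enorm D ^+ 2 <= (2 * tau * eta + sg) ^+ 2.
    by rewrite ler_sqr ?nnegrE ?enorm_ge0 // addr_ge0 // !mulr_ge0 // ltW.
  have h1 : (2 * tau * eta + sg) ^+ 2 <= 8 * (tau ^+ 2 * eta ^+ 2) + 2 * sg ^+ 2.
    have := sqr_ge0 (2 * tau * eta - sg); rewrite -subr_ge0 => h0; rewrite -subr_ge0.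
    by move: h0; congr (_ <= _); ring.
  have h2 : tau ^+ 2 * eta ^+ 2 <= tau * sg.
    rewrite eta2 mulrCA mulrA; apply: ler_piMl => //.
    by rewrite expr2; have : tau * tau <= 1 / 2 * (1 / 2); [apply: ler_pM => //; exact: ltW|lra].
  have h3 : sg ^+ 2 <= 2 * (tau * sg) by rewrite expr2 mulrA ler_wpM2r.
  by move: (tau ^+ 2 * _) h1 h2 => *; lra.
have gain : dotv u D <= 0 by rewrite DV /t /Q; apply: antipode_gain o arc _ aE of_ _; rewrite ?psi0 // tau0.
have conn : connection u (V t) (pi - tau + psi) (vint 0 (pi - tau) V + Q).
  have h0 : 0 <= pi - tau by lra.
  have c1 := connection_sub fV h0; rewrite V0 subr0 -/a in c1.
  have c2 := connection_delayed_circle of_ (lexx 0) psi0.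
  rewrite vint_delayed_circle // scale0r add0r subr0 -/Q -Vt in c2.
  exact: connection_join c1 c2.
have tB' : 0 <= t <= B by rewrite /t; apply/andP; split; lra.
have := first_order tB' conn; rewrite -DE => opt.
have Drho : enorm D <= rho.
  rewrite -ler_sqr ?nnegrE ?enorm_ge0 ?(ltW rho0) //; apply: le_trans D2 _.
  have h1 : tau * sg <= 2 * tau ^+ 2 by rewrite expr2 mulrCA ler_wpM2l // ltW.
  have h2 : tau ^+ 2 <= (rho / 9) ^+ 2 by rewrite ler_sqr ?nnegrE // ?(ltW tau0) // divr_ge0 // ltW.
  have := sqr_ge0 rho; move: h2; rewrite exprMn exprVn.
  by move: (tau ^+ 2) (rho ^+ 2) (tau * sg) h1 => *; lra.
have {}opt := opt Drho.
have sgz : sg = 0.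
  have h1 : K * enorm D ^+ 2 <= K * (36 * (tau * sg)) by rewrite ler_pM2l.
  have h2 : tau * (72 * K) <= 1 by rewrite -ler_pdivlMr // mulr_gt0.
  have h3 : K * (36 * (tau * sg)) <= sg / 2.
    have -> : K * (36 * (tau * sg)) = tau * (72 * K) * (sg / 2) by field.
    by apply: ler_piMl => //; rewrite divr_ge0.
  have tE : t = pi - tau + psi + sg by rewrite sgE /t; ring.
  move: opt; rewrite tE; move: (K * enorm D ^+ 2) (K * _) h1 h3 gain => *.
  by apply/eqP; rewrite eq_le sg0 andbT; lra.
have WCs s : 0 <= s <= 2 * tau -> W s = circle a f s.
  move=> st; have := dev s st; rewrite sgz mulr0 => h.
  have <- : C s = circle a f s.
    by rewrite /C sgz delayed_circle_late ?subr0 //; case/andP: st.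
  apply: (unit_dot_eq1 (fW.1 s) (fC.1 s)); apply/eqP.
  by rewrite eq_le (unit_dot_le1 (fW.1 s) (fC.1 s)) -subr_le0.
move=> s /andP[s0 st]; have [spi|pis] := leP s (pi - tau).
  by apply: arc; rewrite s0 /=; lra.
have -> : V s = W (s - (pi - tau)) by rewrite /W; congr V; ring.
rewrite WCs; last by apply/andP; split; lra.
apply: antipode_circle aE _; first by apply/andP; split; lra.
have tin : 0 <= tau <= 2 * tau by apply/andP; split; lra.
have := WCs tau tin; rewrite /W subrK arc; last by rewrite lexx andbT; lra.
by rewrite /circle cospi sinpi scale0r addr0 scaleN1r.
Qed.

(** The maximal arc cannot stop before a full turn, since it is prolonged by
    [arc_extends], or by [arc_crosses_antipode] when it has just reached [- u]. *)
Theorem tail_is_arc : 0 < B -> (forall t, 0 < t <= B -> exists2 s, 0 <= s <= t & V s <> u) ->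
  exists2 e, orthonormal2 u e &
    forall s, 0 <= s <= Num.min B (pi *+ 2) -> V s = circle u e s.
Proof.
move=> B0 moves; have [t0 [e [/andP[t00 t0B] o arc0]]] := initial_arc B0 moves.
exists e => //; pose be1 := Num.min B (pi *+ 2).
have pi0 := pi_gt0 R; have pi2 := pi_ge2 R.
have be1p : 0 < be1 by rewrite lt_min B0 mulrn_wgt0.
have [be1B be12] : be1 <= B /\ be1 <= pi *+ 2 by rewrite /be1 !ge_min !lexx ?orbT.
pose S := [set x | 0 <= x <= be1 /\ forall s, 0 <= s <= x -> V s = circle u e s].
have S0 : S (Num.min t0 be1).
  split; first by rewrite le_min ltW //= (ltW be1p) /= ge_min lexx orbT.
  by move=> s /andP[s0 st]; apply: arc0; rewrite s0 (le_trans st) // ge_min lexx.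
have hasS : has_sup S by split; [exists (Num.min t0 be1)|exists be1 => x [/andP[]]].
pose be := sup S.
have be_ub x : S x -> x <= be by move=> Sx; apply: sup_upper_bound.
have beb1 : be <= be1 by apply: ge_sup; [exists (Num.min t0 be1)|move=> x [/andP[]]].
have bep : 0 < be by apply: lt_le_trans (be_ub _ S0); rewrite lt_min t00.
have arc_lt s : 0 <= s < be -> V s = circle u e s.
  move=> /andP[s0 sbe]; have d0 : 0 < be - s by rewrite subr_gt0.
  have [x [_ Sx]] := sup_adherent d0 hasS; rewrite -/be subKr => sx.
  by apply: Sx; rewrite s0 ltW.
have arc s : 0 <= s <= be -> V s = circle u e s.
  move=> /andP[s0]; rewrite le_eqVlt => /orP[/eqP ->|sbe]; last by rewrite arc_lt ?s0.
  apply: (tangent_field_eq_closed fV _ bep arc_lt).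
  by apply: tangent_field_circle.
have [be_eq|nbe] := eqVneq be be1; first by rewrite -/be1 -be_eq.
have {}nbe : be < be1 by rewrite lt_neqAle nbe.
suff [tau /andP[tau0 tauB] arct] : exists2 tau, 0 < tau <= B - be &
    forall s, 0 <= s <= be + tau -> V s = circle u e s.
  have : S (be + Num.min tau (be1 - be)).
    have [h1 h2] : Num.min tau (be1 - be) <= tau /\ Num.min tau (be1 - be) <= be1 - be.
      by rewrite !ge_min !lexx ?orbT.
    have h3 : 0 <= Num.min tau (be1 - be) by rewrite le_min ltW //= subr_ge0 ltW.
    split; first by apply/andP; split; lra.
    by move=> s /andP[s0 st]; apply: arct; rewrite s0 /=; lra.
  move=> /be_ub; rewrite gerDl leNgt lt_min tau0 subr_gt0 nbe //.
have beB : be < B by apply: lt_le_trans nbe be1B.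
have be2 : be < pi *+ 2 by apply: lt_le_trans nbe be12.
have [sb|sb] := eqVneq (sin be) 0; last first.
  by apply: arc_extends => //; rewrite bep.
have bepi : be = pi.
  apply/eqP; rewrite eq_le !leNgt; apply/andP; split; apply/negP => h.
    have : 0 < sin (be - pi) by apply: sin_gt0_pi; rewrite mulr2n in be2; lra.
    by rewrite sinB sb cospi sinpi; lra.
  have : 0 < sin be by apply: sin_gt0_pi; rewrite bep.
  by rewrite sb ltxx.
rewrite bepi in beB arc *; exact: arc_crosses_antipode.
Qed.

End Tail.

(** * Straightness where the curvature bound is not attained *)

Section Reparametrization.
Variables (R : realType) (n : nat).
Implicit Types (v w : 'rV[R]_n) (s t x y : R).

Definition normalize v : 'rV[R]_n := (enorm v)^-1 *: v.

Lemma normalize_unit v : dotv v v = 1 -> normalize v = v.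
Proof. by move=> /enorm1P v1; rewrite /normalize v1 invr1 scale1r. Qed.

Lemma dot_normalize v : 0 < enorm v -> dotv (normalize v) (normalize v) = 1.
Proof. by move=> v0; rewrite !dotE -enorm_sqr; field; rewrite gt_eqF. Qed.

Lemma normalize_lip v w (m : R) : 0 < m -> m <= enorm v -> m <= enorm w ->
  m * enorm (normalize v - normalize w) <= enorm (v - w).
Proof.
move=> m0 mv mw.
have [v0 w0] : 0 < enorm v /\ 0 < enorm w by split; apply: lt_le_trans m0 _.
rewrite -ler_sqr ?nnegrE ?mulr_ge0 ?enorm_ge0 // ?(ltW m0) // exprMn.
rewrite enorm_sub_unit_sqr ?dot_normalize // enorm_sqr dot_sub_sqr -!enorm_sqr.
have -> : dotv (normalize v) (normalize w) = dotv v w / (enorm v * enorm w).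
  by rewrite !dotE; field; rewrite !gt_eqF.
have le1 : dotv v w / (enorm v * enorm w) <= 1.
  by rewrite ler_pdivrMr ?mulr_gt0 // mul1r dot_le.
have mm : m ^+ 2 <= enorm v * enorm w by rewrite expr2 ler_pM // ltW.
apply: (@le_trans _ _ (enorm v * enorm w * (2 * (1 - dotv v w / (enorm v * enorm w))))).
  by apply: ler_wpM2r => //; rewrite mulr_ge0 // subr_ge0.
have -> : enorm v * enorm w * (2 * (1 - dotv v w / (enorm v * enorm w))) =
    2 * (enorm v * enorm w) - 2 * dotv v w by field; rewrite !gt_eqF.
by have := sqr_ge0 (enorm v - enorm w); rewrite !expr2; lra.
Qed.

Lemma enorm_lip_continuous (v : R -> 'rV[R]_n) (c : R) :
  (forall x y, enorm (v x - v y) <= c * `|x - y|) -> continuous (fun x => enorm (v x)).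
Proof.
move=> lv; apply: (@continuous_of_lip _ _ c) => x y.
apply: le_trans (lv x y); rewrite ler_norml; apply/andP; split.
  by rewrite lerNl opprB enorm_subC; exact: enorm_sub_ge.
exact: enorm_sub_ge.
Qed.

(** After parametrization by arclength the direction turns at a rate of at most
    [c / m ^+ 2]: one factor [m] comes from normalizing the velocity, the other
    from the change of parameter. *)
Lemma connection_of_velocity (v : R -> 'rV[R]_n) (c m T : R) : 0 <= T -> 0 < m ->
  (forall x y, enorm (v x - v y) <= c * `|x - y|) -> (forall x, m <= enorm (v x)) ->
  c <= m ^+ 2 ->
  connection (normalize (v 0)) (normalize (v T)) (rint 0 T (fun x => enorm (v x)))
    (vint 0 T v).
Proof.
move=> T0 m0 lv mv cm.
have cv := vcontinuous_of_lip lv; have cnv := enorm_lip_continuous lv.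
pose S x := rint 0 x (fun x => enorm (v x)).
have S0 : S 0 = 0 by rewrite /S rint_id.
have dS x : is_derive x 1 S (enorm (v x)).
  have h := primitiveP cnv x; have k := is_derive_lam_cst (- primitive (fun x => enorm (v x)) 0) x.
  by rewrite -[enorm _]addr0; exact: is_derive_lamD h k.
have Sgrow x y : x <= y -> m * (y - x) <= S y - S x.
  move=> xy; have d (z : R) : is_derive z 1 (fun z => m * z) m by der; ring.
  by have := le_of_derive xy d dS (fun z _ => mv z); rewrite mulrBr.
have Sabs x y : m * `|x - y| <= `|S x - S y|.
  wlog xy : x y / y <= x => [h|].
    by have [/h//|/ltW /h] := leP y x; rewrite distrC (distrC (S y)).
  have h := Sgrow y x xy; have h0 : 0 <= x - y by rewrite subr_ge0.
  rewrite (ger0_norm h0) ger0_norm //; apply: le_trans h.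
  by apply: mulr_ge0 => //; exact: ltW.
have cS := is_derive_continuous dS.
have surj s : exists x, S x = s.
  pose b := `|s| / m; have b0 : 0 <= b by rewrite divr_ge0 // ltW.
  have mb : m * b = `|s| by rewrite /b mulrC divfK // gt_eqF.
  have h1 : - b <= b by lra.
  have h2 : S (- b) <= s.
    have := Sgrow (- b) 0; rewrite S0 sub0r opprK => /(_ _); rewrite oppr_le0 => /(_ b0).
    by rewrite mb; have := ler_norm (- s); rewrite normrN; lra.
  have h3 : s <= S b.
    have := Sgrow 0 b b0; rewrite S0 !subr0 mb; have := ler_norm s; lra.
  have [|x _ <-] := @IVT _ S (- b) b s h1 (continuous_subspaceT cS); last by exists x.
  by rewrite ge_min le_max h2 h3 orbT.
pose X s := xget 0 [set x | S x = s].
have SX s : S (X s) = s by exact: (xgetPex 0 (surj s)).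
have XS x : X (S x) = x.
  have := Sabs (X (S x)) x; rewrite SX subrr normr0 pmulr_rle0 // normr_le0 subr_eq0.
  by move/eqP.
pose U s := normalize (v (X s)).
have npos x : 0 < enorm (v x) by exact: lt_le_trans (mv x).
have fU : tangent_field U.
  split=> [s|s t]; first exact: dot_normalize.
  have h1 := normalize_lip m0 (mv (X s)) (mv (X t)).
  have h2 := lv (X s) (X t).
  have h3 := Sabs (X s) (X t); rewrite !SX in h3.
  have h4 : c * `|X s - X t| <= m ^+ 2 * `|X s - X t| by apply: ler_wpM2r.
  have h5 : m ^+ 2 * `|X s - X t| <= m * `|s - t| by rewrite expr2 -mulrA ler_pM2l.
  by rewrite -(ler_pM2l m0) (le_trans h1) // (le_trans h2) // (le_trans h4).
have cU := tangent_field_vcontinuous fU.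
exists U; split=> //.
- by apply: rint_ge0 => // x _; exact: enorm_ge0.
- by rewrite /U -{1}S0 XS.
- by rewrite /U XS.
apply/rowP => i; rewrite !mxE; have dZ := primitiveP (cU i).
have dZS x : is_derive x 1 (fun x => primitive (fun s => U s 0 i) (S x)) (v x 0 i).
  apply: is_derive_eql (is_derive_lam_comp (dS x) (dZ (S x))) _.
  by rewrite /U XS /normalize mxE mulrA divff ?mul1r // gt_eqF.
by rewrite (rint_primitive _ _ dZS) S0.
Qed.

End Reparametrization.

Section Slack.
Variables (R : realType) (n : nat).
Implicit Types (U : R -> 'rV[R]_n) (a b c : 'rV[R]_n) (s t x y eta : R).

Lemma clamp_lip (p q x y : R) :
  `|Num.max p (Num.min q x) - Num.max p (Num.min q y)| <= `|x - y|.
Proof.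
wlog xy : x y / x <= y => [h|].
  by have [/h//|/ltW /h] := leP x y; rewrite distrC (distrC y).
have mono : Num.max p (Num.min q x) <= Num.max p (Num.min q y).
  by rewrite ge_max !le_max lexx /= le_min !ge_min lexx xy !orbT.
rewrite distrC ger0_norm ?subr_ge0 // distrC ger0_norm ?subr_ge0 //.
have [] := leP q x; have [] := leP q y; have [] := leP p q;
  have [] := leP p x; have [] := leP p y; lra.
Qed.

Definition ramp eta x := Num.max 0 (Num.min 1 (1 - x / eta)).

Lemma ramp_ge0 eta x : 0 <= ramp eta x.
Proof. by rewrite /ramp le_max lexx. Qed.

Lemma ramp_le1 eta x : ramp eta x <= 1.
Proof. by rewrite /ramp ge_max ler01 ge_min lexx. Qed.

Lemma ramp_before eta x : 0 < eta -> 0 <= x <= eta -> ramp eta x = 1 - x / eta.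
Proof.
move=> e0 /andP[x0 xe]; have : 0 <= x / eta by rewrite divr_ge0 // ltW.
have : x / eta <= 1 by rewrite ler_pdivrMr // mul1r.
by move=> h1 h2; rewrite /ramp min_r ?max_r //; lra.
Qed.

Lemma ramp_after eta x : 0 < eta -> eta <= x -> ramp eta x = 0.
Proof.
move=> e0 ex; have : 1 <= x / eta by rewrite ler_pdivlMr // mul1r.
by move=> h; rewrite /ramp min_r ?max_l //; lra.
Qed.

Lemma ramp_lip eta x y : 0 < eta -> `|ramp eta x - ramp eta y| <= eta^-1 * `|x - y|.
Proof.
move=> e0; have -> : eta^-1 * `|x - y| = `|(1 - x / eta) - (1 - y / eta)|.
  rewrite -[X in X * _]gtr0_norm ?invr_gt0 // -normrM distrC.
  by congr `|_|; ring.
exact: clamp_lip.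
Qed.

Lemma ramp_continuous eta : 0 < eta -> continuous (ramp eta).
Proof. by move=> e0; apply: (@continuous_of_lip _ _ eta^-1) => s t; exact: ramp_lip. Qed.

Lemma rint_ramp eta T : 0 < eta -> eta <= T -> rint 0 T (ramp eta) = eta / 2.
Proof.
move=> e0 eT; have cr := ramp_continuous e0.
have d x : is_derive x 1 (fun x => x - x * x * (2 * eta)^-1) (1 - x / eta).
  by der; field; rewrite gt_eqF.
have cl : continuous (fun x => 1 - x / eta).
  apply: continuous_lamD; first exact: continuous_lam_cst.
  apply: continuous_lamN; apply: continuous_lamM; first exact: continuous_lam_id.
  exact: continuous_lam_cst.
rewrite (rint_chasles eta) (@eq_rint _ 0 eta _ _ (ltW e0) cr cl); last first.
  by move=> x; exact: ramp_before.
rewrite (rint_primitive _ _ d) (@eq_rint _ eta T _ (fun=> 0) eT cr); last 2 first.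
- exact: continuous_lam_cst.
- by move=> x /andP[ex _]; exact: ramp_after.
by rewrite rint_cst; field; rewrite gt_eqF.
Qed.

(** The velocity is constant except close to the ends, where it turns to [a]
    and [b]. Since the curvature is not restricted, these turns can be made so
    short that they cost less than the slack [T - enorm V]. *)
Lemma exists_slow_velocity a b (V : 'rV[R]_n) T : enorm a = 1 -> enorm b = 1 -> enorm V < T ->
  exists w N M, [/\ [/\ w 0 = a, w T = b, vint 0 T w = V &
       rint 0 T (fun x => enorm (w x)) < T],
     0 <= N, 0 <= M, forall x, enorm (w x) <= N &
     forall x y, enorm (w x - w y) <= M * `|x - y|].
Proof.
move=> a1 b1 VT; pose eta := (T - enorm V) / 5.
have eta0 : 0 < eta by rewrite divr_gt0 // subr_gt0.
have V0 := enorm_ge0 V.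
have VE : enorm V = T - 5 * eta by rewrite /eta; field.
have T5 : 5 * eta <= T by lra.
have eT : eta <= T by lra.
have [c cE] : exists c, c = (T - eta)^-1 *: (V - (eta / 2) *: (a + b)).
  by exists ((T - eta)^-1 *: (V - (eta / 2) *: (a + b))).
have cle : enorm c * (T - eta) <= T - 4 * eta.
  have Te : 0 < T - eta by lra.
  rewrite cE enormZ gtr0_norm ?invr_gt0 // mulrC mulrA divff ?gt_eqF // mul1r.
  apply: le_trans (enorm_triangle _ _) _; have eta2 : 0 < eta / 2 by lra.
  rewrite enormN enormZ (gtr0_norm eta2) VE.
  have : eta / 2 * enorm (a + b) <= eta / 2 * 2.
    apply: ler_wpM2l; first by lra.
    by apply: le_trans (enorm_triangle _ _) _; rewrite a1 b1.
  lra.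
pose w (x : R) : 'rV[R]_n := c + ramp eta x *: (a - c) + ramp eta (T - x) *: (b - c).
have [r0 rT] : ramp eta 0 = 1 /\ ramp eta T = 0.
  by rewrite ramp_before ?lexx ?(ltW eta0) // ramp_after // mul0r subr0.
pose A := enorm (a - c); pose B := enorm (b - c).
have A0 : 0 <= A by exact: enorm_ge0.
have B0 : 0 <= B by exact: enorm_ge0.
have lw x y : enorm (w x - w y) <= (A + B) / eta * `|x - y|.
  have -> : w x - w y = (ramp eta x - ramp eta y) *: (a - c) +
      (ramp eta (T - x) - ramp eta (T - y)) *: (b - c).
    by rewrite /w; apply: dot_extl => h; rewrite !dotE; ring.
  apply: le_trans (enorm_triangle _ _) _; rewrite !enormZ -/A -/B.
  have h1 := ramp_lip x y eta0; have h2 := ramp_lip (T - x) (T - y) eta0.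
  rewrite (_ : T - x - (T - y) = y - x) ?(distrC y x) in h2; last by ring.
  have := ler_wpM2r A0 h1; have := ler_wpM2r B0 h2.
  have -> : (A + B) / eta * `|x - y| = eta^-1 * `|x - y| * A + eta^-1 * `|x - y| * B by ring.
  by lra.
have nw x : enorm (w x) <= enorm c + ramp eta x * A + ramp eta (T - x) * B.
  rewrite /w; apply: le_trans (enorm_triangle _ _) _; apply: lerD.
    apply: le_trans (enorm_triangle _ _) _; apply: lerD => //.
    by rewrite enormZ ger0_norm // ramp_ge0.
  by rewrite enormZ ger0_norm // ramp_ge0.
have cw := vcontinuous_of_lip lw; have cnw := enorm_lip_continuous lw.
have cr := ramp_continuous eta0.
have crT : continuous (fun x => ramp eta (T - x)).
  apply: (continuous_lam_comp cr); apply: continuous_lamD; first exact: continuous_lam_cst.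
  by apply: continuous_lamN; exact: continuous_lam_id.
have crc x : continuous (fun z => ramp eta z * x).
  by apply: continuous_lamM => //; exact: continuous_lam_cst.
have crTc x : continuous (fun z => ramp eta (T - z) * x).
  by apply: continuous_lamM => //; exact: continuous_lam_cst.
have int_affine p q r : rint 0 T (fun x => p + ramp eta x * q + ramp eta (T - x) * r) =
    p * T + eta / 2 * q + eta / 2 * r.
  have mulC (f : R -> R) (z : R) : (fun x : R => f x * z) = (fun x => z * f x).
    by apply: funext => x; rewrite mulrC.
  rewrite rintD //; last first.
    by apply: continuous_lamD => //; exact: continuous_lam_cst.
  rewrite rintD //; last exact: continuous_lam_cst.
  rewrite rint_cst !mulC rintZ // [X in _ + X]rintZ // rint_reverse // subrr subr0.
  by rewrite rint_ramp //; ring.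
exists w, (enorm c + A + B), ((A + B) / eta); split.
- split.
  + by rewrite /w r0 subr0 rT scale0r addr0 scale1r addrC subrK.
  + by rewrite /w rT subrr r0 scale0r addr0 scale1r addrC subrK.
  + apply: dot_extl => h; rewrite dot_vint //.
    have -> : (fun s => dotv h (w s)) = fun s => dotv h c + ramp eta s * dotv h (a - c) +
        ramp eta (T - s) * dotv h (b - c).
      by apply: funext => s; rewrite /w !(dotDr, dotZr).
    rewrite int_affine.
    have : (T - eta) *: c = V - (eta / 2) *: (a + b).
      by rewrite cE scalerA divff ?scale1r // gt_eqF //; lra.
    move=> /(congr1 (dotv h)); rewrite !dotE => hc.
    have -> : dotv h V = (T - eta) * dotv h c + eta / 2 * (dotv h a + dotv h b) by rewrite hc; ring.
    by field.
  + have h : rint 0 T (fun x => enorm (w x)) <= enorm c * T + eta / 2 * A + eta / 2 * B.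
      rewrite -int_affine; apply: le_rint => //; first by lra.
      apply: continuous_lamD => //; apply: continuous_lamD => //.
      exact: continuous_lam_cst.
    apply: le_lt_trans h _.
    have hA : A <= 1 + enorm c by rewrite /A -a1 -(enormN c); exact: enorm_triangle.
    have hB : B <= 1 + enorm c by rewrite /B -b1 -(enormN c); exact: enorm_triangle.
    have hA2 : eta / 2 * A <= eta / 2 * (1 + enorm c) by rewrite ler_pM2l // divr_gt0.
    have hB2 : eta / 2 * B <= eta / 2 * (1 + enorm c) by rewrite ler_pM2l // divr_gt0.
    suff : enorm c * (T + eta) < T - eta by lra.
    have Te : 0 < T - eta by lra.
    rewrite -(ltr_pM2r Te); apply: (@le_lt_trans _ _ ((T - 4 * eta) * (T + eta))).
      by rewrite mulrAC; apply: ler_wpM2r => //; lra.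
    by nra.
- by rewrite !addr_ge0 // enorm_ge0.
- by rewrite divr_ge0 ?addr_ge0 // ltW.
- move=> x; apply: le_trans (nw x) _; apply: lerD.
    by apply: lerD => //; apply: ler_piMl => //; exact: ramp_le1.
  by apply: ler_piMl => //; exact: ramp_le1.
- by [].
Qed.

(** If the curvature is less than one on a piece that is not straight, then a
    small step towards a shorter curve with the same end data stays
    admissible; the length is a convex function of the velocity. *)
Lemma straight_of_slack T U t1 t2 lam : shortest_field T U ->
  0 <= t1 -> t1 < t2 -> t2 <= T -> 0 <= lam < 1 ->
  (forall s t, t1 <= s <= t2 -> t1 <= t <= t2 -> enorm (U s - U t) <= lam * `|s - t|) ->
  forall s, t1 <= s <= t2 -> U s = U t1.
Proof.
move=> [fU mU] t10 t12 t2T /andP[lam0 lam1] slack; have cU := tangent_field_vcontinuous fU.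
pose tau := t2 - t1; have tau0 : 0 < tau by rewrite subr_gt0.
pose V := vint t1 t2 U.
have U1 s : enorm (U s) = 1 by apply/enorm1P; exact: fU.1.
have [Vtau|Vtau] := ltP (enorm V) tau; last first.
  have Vp : 0 < enorm V by exact: lt_le_trans Vtau.
  have h1 : dotv (normalize V) (normalize V) = 1 by exact: dot_normalize.
  suff H s : t1 <= s <= t2 -> U s = normalize V.
    by move=> s /H ->; rewrite H // lexx ltW.
  pose f s := 1 + - dotv (normalize V) (U s).
  have cf : continuous f.
    apply: continuous_lamD; first exact: continuous_lam_cst.
    by apply: continuous_lamN; exact: dot_vcontinuous.
  have f0 x : t1 <= x <= t2 -> 0 <= f x.
    by move=> _; rewrite subr_ge0; apply: unit_dot_le1 => //; exact: fU.1.
  have fi : rint t1 t2 f <= 0.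
    rewrite /f rintD ?rint_cst; last 2 first.
    - exact: continuous_lam_cst.
    - by apply: continuous_lamN; exact: dot_vcontinuous.
    rewrite (_ : (fun x => - _) = fun x => -1 * dotv (normalize V) (U x)); last first.
      by apply: funext => x; rewrite mulN1r.
    rewrite rintZ; last exact: dot_vcontinuous.
    rewrite -dot_vint // -/V /normalize dotZl -enorm_sqr.
    have -> : (enorm V)^-1 * enorm V ^+ 2 = enorm V by field; rewrite gt_eqF.
    by rewrite -/tau; lra.
  move=> s_in; have := rint_le0_eq0 t12 cf f0 fi s_in; rewrite /f => e.
  by apply/esym/unit_dot_eq1 => //; [exact: fU.1|lra].
(* the given piece, continued constantly *)
pose cl x := Num.max 0 (Num.min tau x).
have cl_in x : 0 <= cl x <= tau.
  by rewrite /cl le_max lexx ge_max (ltW tau0) ge_min lexx.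
have cl_id x : 0 <= x <= tau -> cl x = x.
  by move=> /andP[x0 xt]; rewrite /cl min_r // max_r.
have cl_lip x y : `|cl x - cl y| <= `|x - y| by exact: clamp_lip.
pose P x := U (t1 + cl x).
have lP x y : enorm (P x - P y) <= lam * `|x - y|.
  have [hx hy] := (cl_in x, cl_in y).
  apply: le_trans (slack _ _ _ _) _; try by rewrite /tau in hx hy; lra.
  by rewrite ler_wpM2l // (_ : t1 + cl x - (t1 + cl y) = cl x - cl y) //; ring.
have cP := vcontinuous_of_lip lP.
have P1 x : enorm (P x) = 1 by exact: U1.
have PV : vint 0 tau P = V.
  rewrite /V (_ : vint t1 t2 U = vint 0 tau (fun x => U (t1 + x))); last first.
    by rewrite vint_shift // addr0; congr vint; rewrite /tau; ring.
  apply: eq_vint => //; first exact: ltW.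
    by apply: tangent_field_vcontinuous; exact: tangent_field_shift.
  by move=> s s_in; rewrite /P cl_id.
have [w [N [M [[w0 wT wV wL] N0 M0 wN wM]]]] := exists_slow_velocity (P1 0) (P1 tau) Vtau.
have cw := vcontinuous_of_lip wM.
pose eps := (1 - lam) / (M + 2 * (1 + N)).
have den : 0 < M + 2 * (1 + N) by lra.
have eps0 : 0 < eps by rewrite divr_gt0 // subr_gt0.
have epsE : eps * (M + 2 * (1 + N)) = 1 - lam by rewrite /eps divfK // gt_eqF.
have epsM : 0 <= eps * M by rewrite mulr_ge0 // ltW.
have epsN : 0 <= eps * N by rewrite mulr_ge0 // ltW.
pose m := 1 - eps - eps * N.
have mE : m = 1 - eps * (1 + N) by rewrite /m; ring.
have half : 2 * (eps * (1 + N)) <= 1 - eps * M by rewrite mulrDr in epsE; lra.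
have m0 : 0 < m by rewrite mE; lra.
have eps1 : 0 <= 1 - eps by rewrite /m in m0; lra.
pose v x := (1 - eps) *: P x + eps *: w x.
have lv x y : enorm (v x - v y) <= (lam + eps * M) * `|x - y|.
  have -> : v x - v y = (1 - eps) *: (P x - P y) + eps *: (w x - w y).
    by rewrite /v; apply: dot_extl => h; rewrite !dotE; ring.
  apply: le_trans (enorm_triangle _ _) _; rewrite !enormZ (ger0_norm eps1) (ger0_norm (ltW eps0)).
  have h1 : (1 - eps) * enorm (P x - P y) <= 1 * (lam * `|x - y|).
    by apply: ler_pM; [lra|exact: enorm_ge0|lra|exact: lP].
  have h2 : eps * enorm (w x - w y) <= eps * (M * `|x - y|) by rewrite ler_pM2l.
  apply: le_trans (lerD h1 h2) _.
  by rewrite le_eqVlt; apply/orP; left; apply/eqP; ring.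
have mv x : m <= enorm (v x).
  have h := enorm_sub_ge ((1 - eps) *: P x) (- (eps *: w x)).
  rewrite opprK enormN !enormZ P1 (ger0_norm eps1) (ger0_norm (ltW eps0)) in h.
  have h1 : eps * enorm (w x) <= eps * N by rewrite ler_pM2l.
  by rewrite -/(v x) in h; rewrite /m; lra.
have cm : lam + eps * M <= m ^+ 2.
  have : 1 - 2 * (eps * (1 + N)) <= m ^+ 2.
    by rewrite mE; have := sqr_ge0 (eps * (1 + N)); rewrite !expr2; lra.
  by move: epsE; rewrite mulrDr; lra.
have conn := connection_of_velocity (ltW tau0) m0 lv mv cm.
have v0 : normalize (v 0) = U t1.
  rewrite /v w0 -scalerDl subrK scale1r normalize_unit; last by apply/enorm1P.
  by rewrite /P cl_id ?addr0 // lexx ltW.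
have vT : normalize (v tau) = U t2.
  rewrite /v wT -scalerDl subrK scale1r normalize_unit; last by apply/enorm1P.
  by rewrite /P cl_id ?lexx ?andbT ?ltW // /tau; congr U; ring.
have vV : vint 0 tau v = V.
  apply: dot_extl => h; rewrite dot_vint; last exact: vcontinuous_of_lip lv.
  rewrite (_ : (fun s => _) = fun s => (1 - eps) * dotv h (P s) + eps * dotv h (w s)); last first.
    by apply: funext => s; rewrite /v dotDr !dotZr.
  have c1 : continuous (fun s => (1 - eps) * dotv h (P s)).
    by apply: continuous_lamM; [exact: continuous_lam_cst|exact: dot_vcontinuous].
  have c2 : continuous (fun s => eps * dotv h (w s)).
    by apply: continuous_lamM; [exact: continuous_lam_cst|exact: dot_vcontinuous].
  rewrite rintD // rintZ; last exact: dot_vcontinuous.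
  rewrite [X in _ + X]rintZ; last exact: dot_vcontinuous.
  by rewrite -!dot_vint // PV wV; ring.
have cnw := enorm_lip_continuous wM.
have vL : rint 0 tau (fun x => enorm (v x)) < tau.
  have h : rint 0 tau (fun x => enorm (v x)) <=
      (1 - eps) * tau + eps * rint 0 tau (fun x => enorm (w x)).
    have c2 : continuous (fun x => eps * enorm (w x)).
      by apply: continuous_lamM => //; exact: continuous_lam_cst.
    have -> : (1 - eps) * tau + eps * rint 0 tau (fun x => enorm (w x)) =
        rint 0 tau (fun x => (1 - eps) + eps * enorm (w x)).
      by rewrite rintD // ?rintZ // ?rint_cst ?subr0 //; exact: continuous_lam_cst.
    apply: le_rint; first exact: ltW.
    - exact: enorm_lip_continuous lv.
    - by apply: continuous_lamD => //; exact: continuous_lam_cst.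
    move=> x _; apply: le_trans (enorm_triangle _ _) _.
    by rewrite !enormZ P1 mulr1 (ger0_norm eps1) (ger0_norm (ltW eps0)).
  have : eps * rint 0 tau (fun x => enorm (w x)) < eps * tau by rewrite ltr_pM2l.
  by move: (rint 0 tau (fun x => enorm (v x))) (eps * rint _ _ _) h => p q; lra.
have vL0 : 0 < rint 0 tau (fun x => enorm (v x)).
  have h : m * (tau - 0) <= rint 0 tau (fun x => enorm (v x)).
    rewrite -rint_cst; apply: le_rint => //; first exact: ltW.
      exact: continuous_lam_cst.
    exact: enorm_lip_continuous lv.
  by apply: lt_le_trans h; rewrite subr0 mulr_gt0.
rewrite v0 vT vV in conn.
have total := connection_join (connection_sub fU t10)
  (connection_join conn (connection_sub fU t2T)).
rewrite /V -!vint_chasles in total.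
have := mU _ _ total; move: vL vL0; rewrite /tau; move: (rint _ _ _) => r h1 h2 h3.
have {}h3 : T <= t1 - 0 + (r + (T - t2)) by apply: h3; lra.
lra.
Qed.

End Slack.

(** * Shortest tangent fields: arc, line, arc *)

Section Global.
Variables (R : realType) (n : nat).
Hypothesis n2 : (2 <= n)%N.
Implicit Types (U : R -> 'rV[R]_n) (u e : 'rV[R]_n) (s t x c d T : R).

(** A full turn would displace the curve by nothing, so it can be cut out. *)
Lemma shortest_no_full_turn T U d u e : shortest_field T U -> 0 < d ->
  orthonormal2 u e -> d + pi *+ 2 <= T ->
  ~ (forall s, d <= s <= d + pi *+ 2 -> U s = circle u e (s - d)).
Proof.
move=> [fU mU] d0 o dT arc; have pi0 := pi_gt0 R.
have pi20 : 0 < (pi : R) *+ 2 by rewrite mulrn_wgt0.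
have le2 : d <= d + pi *+ 2 by rewrite lerDl ltW.
have turn : d + pi *+ 2 - d = pi *+ 2 by ring.
have fC : tangent_field (fun x => circle u e (x - d)).
  apply: tangent_field_circle => // x y.
  by have -> : x - d - (y - d) = x - y by ring.
have [Ud Ud2] : U d = u /\ U (d + pi *+ 2) = u.
  split; first by rewrite arc ?lexx ?le2 // subrr circle0.
  by rewrite arc ?lexx ?le2 // turn /circle cos2pi sin2pi scale1r scale0r addr0.
have loop : vint d (d + pi *+ 2) U = 0.
  rewrite (eq_vint le2 (tangent_field_vcontinuous fU) (tangent_field_vcontinuous fC) arc).
  rewrite vint_circle // turn subrr.
  by rewrite /circle_primitive cos2pi sin2pi sin0 cos0 subrr.
have c1 := connection_sub fU (ltW d0); have c2 := connection_sub fU dT.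
rewrite Ud in c1; rewrite Ud2 in c2.
have disp : vint 0 d U + vint (d + pi *+ 2) T U = vint 0 T U.
  by rewrite (vint_chasles d 0 T) (vint_chasles (d + pi *+ 2) d T) loop add0r.
have := connection_join c1 c2; rewrite subr0 disp => conn.
 have : T <= d + (T - (d + pi *+ 2)) by apply: mU => //; lra.
by lra.
Qed.

Lemma shortest_right_arc T U c s1 u : shortest_field T U -> 0 <= c -> c < s1 -> s1 <= T ->
  (forall s, c <= s <= s1 -> U s = u) ->
  exists d e, [/\ s1 <= d <= T, orthonormal2 u e, T - d < pi *+ 2,
    forall s, c <= s <= d -> U s = u & forall s, d <= s <= T -> U s = circle u e (s - d)].
Proof.
move=> sU c0 cs1 s1T line1; have [fU mU] := sU.
have u1 : dotv u u = 1 by rewrite -(line1 c) ?fU.1 // lexx ltW.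
have pi20 : 0 < (pi : R) *+ 2 by rewrite mulrn_wgt0 // pi_gt0.
pose S := [set x | s1 <= x <= T /\ forall s, c <= s <= x -> U s = u].
have S1 : S s1 by split; rewrite ?lexx.
have hasS : has_sup S by split; [exists s1|exists T => x [/andP[]]].
pose d := sup S.
have d_ub x : S x -> x <= d by move=> Sx; apply: sup_upper_bound.
have dT : d <= T by apply: ge_sup; [exists s1|move=> x [/andP[]]].
have s1d : s1 <= d by exact: d_ub.
have cd : c < d by exact: lt_le_trans s1d.
have line_lt s : c <= s < d -> U s = u.
  move=> /andP[cs sd]; have d0 : 0 < d - s by rewrite subr_gt0.
  have [x [_ Sx]] := sup_adherent d0 hasS; rewrite -/d subKr => sx.
  by apply: Sx; rewrite cs ltW.
have line s : c <= s <= d -> U s = u.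
  move=> /andP[cs]; rewrite le_eqVlt => /orP[/eqP ->|sd]; last by rewrite line_lt ?cs.
  exact: (tangent_field_eq_closed fU (tangent_field_cst u1) cd line_lt).
have [dTe|dTn] := eqVneq d T.
  have [e [e1 ue]] := exists_unit_orthogonal n2 u1.
  exists d, e; split=> //; rewrite ?s1d ?dT ?dTe ?subrr //.
  move=> s; rewrite -eq_le => /eqP <-; rewrite subrr circle0 -dTe.
  by apply: line; rewrite lexx ltW.
have {dTn} dT' : d < T by rewrite lt_neqAle dTn.
have B0 : 0 < T - d by rewrite subr_gt0.
have [rho rho0 [K K0 first_order]] := shortest_after_line sU c0 cd dT line.
pose V s := U (d + s).
have fV : tangent_field V by exact: tangent_field_shift.
have V0 : V 0 = u by rewrite /V addr0 line // lexx ltW.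
have vV t : vint 0 t V = vint d (d + t) U.
  by rewrite vint_shift ?addr0 //; exact: tangent_field_vcontinuous.
have first_orderV t T' W : 0 <= t <= T - d -> connection u (V t) T' W ->
    enorm (vint 0 t V - W) <= rho ->
    t <= T' + dotv u (vint 0 t V - W) + K * enorm (vint 0 t V - W) ^+ 2.
  move=> /andP[t0 tB]; rewrite vV => conn small.
  have tin : d <= d + t <= T by apply/andP; split; lra.
  by have := first_order _ _ _ tin conn small; rewrite addrAC subrr add0r.
have moves t : 0 < t <= T - d -> exists2 s, 0 <= s <= t & V s <> u.
  move=> /andP[t0 tB]; apply: contrapT => none.
  have : S (d + t).
    split; first by apply/andP; split; lra.
    move=> s /andP[cs st]; have [sd|ds] := leP s d; first by apply: line; rewrite cs.
    apply: contrapT => Us; apply: none; exists (s - d); first by apply/andP; split; lra.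
    by rewrite /V addrC subrK.
  by move=> /d_ub; lra.
have [e o arc] := tail_is_arc n2 fV V0 rho0 K0 first_orderV B0 moves.
have arcU s : d <= s -> s - d <= Num.min (T - d) (pi *+ 2) -> U s = circle u e (s - d).
  move=> ds sm; rewrite -arc ?subr_ge0 ?ds // /V; congr U; ring.
have [full|short] := leP (pi *+ 2) (T - d).
  exfalso; apply: (@shortest_no_full_turn T U d u e sU) => //; first by lra.
    by lra.
  move=> s /andP[ds sd]; apply: arcU => //; rewrite le_min; apply/andP; split; lra.
exists d, e; split=> //; first by rewrite s1d.
move=> s /andP[ds sT]; apply: arcU => //; rewrite le_min; apply/andP; split; lra.
Qed.

Theorem shortest_arc_line_arc T U s0 r lam : shortest_field T U -> 0 < T ->
  0 <= s0 <= T -> 0 < r -> 0 <= lam < 1 ->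
  (forall s t, `|s - s0| <= r -> `|t - s0| <= r -> 0 <= s <= T -> 0 <= t <= T ->
     enorm (U s - U t) <= lam * `|s - t|) ->
  exists c d u e f, [/\ 0 <= c < d /\ d <= T, orthonormal2 u e /\ orthonormal2 u f,
    c < pi *+ 2 /\ T - d < pi *+ 2,
    forall s, c <= s <= d -> U s = u &
    (forall s, 0 <= s <= c -> U s = circle u e (c - s)) /\
    (forall s, d <= s <= T -> U s = circle u f (s - d))].
Proof.
move=> sU T0 /andP[s00 s0T] r0 lam1 slack.
pose t1 := Num.max 0 (s0 - r); pose t2 := Num.min T (s0 + r).
have [t10 t1s t12 t2T] : [/\ 0 <= t1, s0 - r <= t1, t1 < t2 & t2 <= T].
  rewrite /t1 /t2 gt_max !lt_min !le_max ge_min !lexx orbT T0.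
  by split=> //; repeat (apply/andP; split); lra.
have t2s : t2 <= s0 + r by rewrite /t2 ge_min lexx orbT.
have [t1s' t2s'] : t1 <= s0 /\ s0 <= t2.
  by rewrite /t1 /t2 ge_max le_min s00 s0T /=; split; lra.
have line0 : forall s, t1 <= s <= t2 -> U s = U t1.
  apply: (straight_of_slack sU t10 t12 t2T lam1) => s t /andP[s1 s2] /andP[s3 s4].
  by apply: slack; rewrite ?ler_norml; apply/andP; split; lra.
have [d [f [/andP[t2d dT] of_ d2 line1 arc1]]] := shortest_right_arc sU t10 t12 t2T line0.
have [r10 r12 r2T] : [/\ 0 <= T - t2, T - t2 < T - t1 & T - t1 <= T] by split; lra.
have line0' s : T - t2 <= s <= T - t1 -> - U (T - s) = - U t1.
  by move=> /andP[h1 h2]; rewrite line0 //; apply/andP; split; lra.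
have [d' [e [/andP[t1d' d'T] oe c2 line2 arc2]]] :=
  shortest_right_arc (shortest_field_opp_reverse sU) r10 r12 r2T line0'.
exists (T - d'), d, (U t1), (- e), f; split.
- by split; [apply/andP; split|]; lra.
- split=> //; case: oe => u1 e1 ue.
  move: u1 ue; rewrite dotNl dotNr opprK dotNl => u1 /eqP; rewrite oppr_eq0 => /eqP ue.
  by split; rewrite ?dotNr ?dotNl ?opprK ?ue ?oppr0.
- by [].
- move=> s /andP[cs sd]; have [st2|t2s''] := leP s t2; last by apply: line1; lra.
  apply: oppr_inj; rewrite -(line2 (T - s)) ?subKr //.
  by apply/andP; split; lra.
- split=> // s /andP[h1 h2]; apply: oppr_inj.
  have := arc2 (T - s); rewrite subKr => ->; last by apply/andP; split; lra.
  rewrite /circle (_ : T - s - d' = T - d' - s); last by ring.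
  by apply: dot_extl => h; rewrite !dotE; ring.
Qed.

End Global.

(** * Curves and their tangent fields *)

Section Velocity.
Variables (R : realType) (n : nat).
Implicit Types (g : R -> 'rV[R]_n) (l : 'rV[R]_n) (a b s t x y : R).

(** Pointwise Lipschitz bounds with a uniform constant add up to a global one,
    here for a pseudometric [D] on an interval. *)
Lemma lipschitz_of_local (D : R -> R -> R) a b c :
  (forall x y z, D x z <= D x y + D y z) -> (forall x y, D x y = D y x) ->
  (forall s, a <= s <= b -> exists2 d, 0 < d &
     forall t, a <= t <= b -> `|t - s| < d -> D s t <= c * `|t - s|) ->
  forall s t, a <= s <= b -> a <= t <= b -> D s t <= c * `|t - s|.
Proof.
move=> tri sym loc.
suff H s t : a <= s -> s <= t -> t <= b -> D s t <= c * (t - s).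
  move=> s t /andP[sa sb] /andP[ta tb]; have [st|/ltW ts] := leP s t.
    by rewrite ger0_norm ?subr_ge0 // H.
  by rewrite sym distrC ger0_norm ?subr_ge0 // H.
move=> sa st tb.
have at_in x : s <= x <= t -> a <= x <= b by move=> /andP[h1 h2]; apply/andP; split; lra.
pose S := [set x | s <= x <= t /\ D s x <= c * (x - s)].
have Ss : S s.
  split; first by rewrite lexx.
  have [|d d0 h] := loc s; first by apply: at_in; rewrite lexx.
  by have := h s (at_in s _); rewrite lexx st subrr normr0 => /(_ isT d0).
have hasS : has_sup S by split; [exists s|exists t => x [/andP[]]].
pose m := sup S.
have m_ub x : S x -> x <= m by move=> Sx; apply: sup_upper_bound.
have mt : m <= t by apply: ge_sup; [exists s|move=> x [/andP[]]].
have sm : s <= m by exact: m_ub.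
have m_in : s <= m <= t by rewrite sm.
have [d d0 h] := loc m (at_in m m_in).
have [x [/andP[sx xt] Sx]] := sup_adherent d0 hasS; rewrite -/m => mx.
have xm : x <= m by apply: m_ub; split; rewrite ?sx.
have Sm : D s m <= c * (m - s).
  have x_in : s <= x <= t by rewrite sx.
  have := h x (at_in x x_in); rewrite distrC ger0_norm ?subr_ge0 // => /(_ _).
  move=> h1; have {}h1 : D m x <= c * (m - x) by apply: h1; lra.
  by have := tri s x m; rewrite (sym x m); lra.
have [tm|mt'] := leP t m.
  by have -> : t = m by apply/eqP; rewrite eq_le tm mt.
pose y := Num.min t (m + d / 2).
have [yt yd my] : [/\ y <= t, y <= m + d / 2 & m < y].
  by rewrite /y !ge_min !lexx orbT lt_min mt'; split=> //=; lra.
have : S y.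
  have y_in : s <= y <= t by apply/andP; split; lra.
  split=> //; have := h y (at_in y y_in); rewrite ger0_norm ?subr_ge0 ?(ltW my) // => h1.
  have {}h1 : D m y <= c * (y - m) by apply: h1; lra.
  by have := tri s m y; lra.
by move=> /m_ub; lra.
Qed.

Lemma near_within_dnbhsP a b s (P : set R) : (within `[a, b] s^') P <->
  exists2 d, 0 < d & forall t, `|t - s| < d -> t != s -> a <= t <= b -> P t.
Proof.
split=> [/nbhs_ballP[d d0 h]|[d d0 h]].
  exists d => // t ts tns tin; apply: (h t) => //.
  by rewrite /ball /= distrC.
apply/nbhs_ballP; exists d => // t; rewrite /ball /= distrC => ts tns.
by rewrite in_itv /= => tin; exact: h.
Qed.

Lemma within_dnbhs_proper a b s : a < b -> a <= s <= b -> ProperFilter (within `[a, b] s^').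
Proof.
move=> ab /andP[sa sb]; apply: Build_ProperFilter_ex => P /near_within_dnbhsP[d d0 h].
have small x : 0 < x -> exists e, [/\ 0 < e, e < d & e < x].
  move=> x0; exists (Num.min d x / 2).
  have [h1 h2] : Num.min d x <= d /\ Num.min d x <= x by rewrite !ge_min !lexx orbT.
  have e0 : 0 < Num.min d x by rewrite lt_min d0.
  by split; lra.
have [sb'|sb'] := eqVneq s b.
  have [|e [e0 ed eb]] := small (b - a); first by rewrite subr_gt0.
  exists (s - e); apply: h.
  - by rewrite (_ : s - e - s = - e) ?normrN ?gtr0_norm //; ring.
  - by rewrite lt_eqF //; lra.
  - by apply/andP; split; lra.
have {}sb' : s < b by rewrite lt_neqAle sb'.
have [|e [e0 ed eb]] := small (b - s); first by rewrite subr_gt0.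
exists (s + e); apply: h.
- by rewrite (_ : s + e - s = e) ?gtr0_norm //; ring.
- by rewrite gt_eqF //; lra.
- by apply/andP; split; lra.
Qed.

(** Euclidean form of the one-sided differentiability of a curve. *)
Definition has_velocity a b g s l := forall e, 0 < e -> exists2 d, 0 < d &
  forall t, `|t - s| < d -> a <= t <= b -> enorm (g t - g s - (t - s) *: l) <= e * `|t - s|.

Lemma diff_quotient_dist g s t l : t != s ->
  enorm (g t - g s - (t - s) *: l) = `|t - s| * enorm (l - diff_quotient g s t).
Proof.
move=> ts; rewrite -enormZ -[LHS]enormN; congr enorm.
have ts0 : t - s != 0 by rewrite subr_eq0.
by rewrite /diff_quotient scalerBr scalerA divff // scale1r opprB.
Qed.

Lemma has_velocity_of_curve a b g s : curve_derivable a b g s ->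
  has_velocity a b g s (velocity a b g s).
Proof.
move=> dg e e0; have : diff_quotient g s t @[t --> within `[a, b] s^'] --> velocity a b g s.
  exact: dg.
set l := velocity a b g s => /cvg_ballP cv.
pose e' := e / (n%:R + 1); have n1 : 0 < n%:R + 1 :> R by rewrite ltr_pwDr.
have e'0 : 0 < e' by rewrite divr_gt0.
have [d d0 h] := (near_within_dnbhsP a b s _).1 (cv e' e'0).
exists d => // t ts tin; have [->|tns] := eqVneq t s.
  by rewrite !subrr scale0r subrr enorm0 normr0 mulr0.
have [_ close] := h t ts tns tin.
rewrite diff_quotient_dist // mulrC ler_wpM2r //.
apply: le_trans (enorm_le_sum _) _; apply: (@le_trans _ _ (\sum_(i < n) e')).
  by apply: ler_sum => i _; have := close 0 i; rewrite /ball /= !mxE => /ltW.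
rewrite sumr_const card_ord -mulr_natr /e' mulrAC ler_pdivrMr // ler_pM2l //.
by rewrite lerDl.
Qed.

Lemma velocity_of_has_velocity a b g s l : a < b -> a <= s <= b -> has_velocity a b g s l ->
  curve_derivable a b g s /\ velocity a b g s = l.
Proof.
move=> ab sin hv; have PF := within_dnbhs_proper ab sin.
suff cv : diff_quotient g s t @[t --> within `[a, b] s^'] --> l.
  split; first by apply/cvg_ex; exists l.
  by apply: cvg_lim => //; exact: norm_hausdorff.
apply/cvg_ballP => e e0; have e20 : 0 < e / 2 by rewrite divr_gt0.
have [d d0 h] := hv _ e20; apply/near_within_dnbhsP; exists d => // t ts tns tin.
split=> // i j; rewrite (ord1 i) /ball /=.
have := h t ts tin; rewrite diff_quotient_dist // mulrC ler_pM2r ?normr_gt0 ?subr_eq0 // => h2.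
have := entry_le_enorm (l - diff_quotient g s t) j; rewrite !mxE => h1.
by apply: le_lt_trans h1 (le_lt_trans h2 _); lra.
Qed.

Lemma curve_length_unit_speed a b g s t :
  (forall s, a <= s <= b -> enorm (velocity a b g s) = 1) ->
  a <= s <= b -> a <= t <= b -> curve_length a b g s t = `|s - t|.
Proof.
move=> unit /andP[sa sb] /andP[ta tb]; rewrite /curve_length.
rewrite (@eq_Rintegral _ _ _ _ _ (fun=> 1)); last first.
  move=> x; rewrite inE /= in_itv /= ge_min le_max => /andP[h1 h2]; apply: unit.
  by apply/andP; split; [case/orP: h1|case/orP: h2]; lra.
rewrite Rintegral_cst; last exact: measurable_itv.
rewrite mul1r [X in fine X](lebesgue_measure_itv `[Num.min s t, Num.max s t]) /= lte_fin.
have [st|st|->] := ltgtP s t => /=; last by rewrite ?ltxx subrr normr0.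
  by rewrite st -EFinD /= ltr0_norm ?opprB ?subr_lt0.
by rewrite st -EFinD /= gtr0_norm ?subr_gt0.
Qed.

Lemma chord_le_angle (u v : 'rV[R]_n) : enorm u = 1 -> enorm v = 1 -> enorm (u - v) <= angle u v.
Proof.
move=> u1 v1; rewrite /angle u1 v1 mulr1 divr1.
have [u1' v1'] := ((enorm1P u).1 u1, (enorm1P v).1 v1).
have d1 : -1 <= dotv u v <= 1 by rewrite unit_dot_geN1 // unit_dot_le1.
rewrite enorm_le_sqr ?acos_ge0 // dot_sub_unit //.
by have := cos_ge_quad (acos (dotv u v)); rewrite acosK //; lra.
Qed.

(** A bound on the curvature at [s] bounds the turning of the tangent near
    [s], even between two points that both differ from [s]. *)
Lemma lipschitz_near_of_curvature a b g s (c : R) :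
  (forall s, a <= s <= b -> enorm (velocity a b g s) = 1) -> a <= s <= b ->
  (curvature a b g s < c%:E)%E ->
  exists2 d, 0 < d & forall x y, `|x - s| < d -> `|y - s| < d -> a <= x <= b -> a <= y <= b ->
    enorm (velocity a b g x - velocity a b g y) <= c * `|x - y|.
Proof.
move=> unit sin; rewrite /curvature /limf_esup => /ereal_inf_lt[_ [V FV <-] supV].
have /nbhs_ballP[d d0 h] := FV.
exists d => // x y xs ys xin yin.
have [->|xy] := eqVneq x y; first by rewrite !subrr enorm0 normr0 mulr0.
have Vxy : V (x, y).
  apply: h; last by rewrite /= !in_itv /= xin yin xy.
  by split; rewrite /ball /= distrC.
have xy0 : 0 < `|x - y| by rewrite normr_gt0 subr_eq0.
apply: le_trans (chord_le_angle (unit x xin) (unit y yin)) _.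
rewrite -ler_pdivrMr // -lee_fin; apply: le_trans (ltW supV).
apply: ereal_sup_ubound; exists (x, y) => //=.
by rewrite curve_length_unit_speed.
Qed.

End Velocity.

Section Admissible.
Variables (R : realType) (n : nat).
Implicit Types (g : R -> 'rV[R]_n) (U W : R -> 'rV[R]_n) (p q u v w e : 'rV[R]_n) (s t x y Lam L T : R).

(** The curve from [p] with tangent field [W], scaled from curvature at most
    one to curvature at most [Lam]. *)
Definition field_curve p Lam W s := p + Lam^-1 *: vint 0 (Lam * s) W.

Lemma vint_field_approx W x y : tangent_field W ->
  enorm (vint x y W - (y - x) *: W x) <= (y - x) ^+ 2.
Proof.
move=> fW; have cW := tangent_field_vcontinuous fW.
have cc : vcontinuous (fun=> W x).
  by apply: tangent_field_vcontinuous; apply: tangent_field_cst; exact: fW.1.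
rewrite -vint_cst -vintB //.
have [xy|/ltW yx] := leP x y.
  rewrite expr2; apply: enorm_vint_le_cst => //; first exact: vcontinuousB.
  by move=> s /andP[xs sy]; apply: le_trans (fW.2 _ _) _; rewrite ger0_norm; lra.
have -> : vint x y (fun s => W s - W x) = - vint y x (fun s => W s - W x).
  by apply/eqP; rewrite -subr_eq0 opprK -vint_chasles vint_id.
rewrite enormN -sqrrN opprB expr2; apply: enorm_vint_le_cst => //; first exact: vcontinuousB.
by move=> s /andP[ys sx]; apply: le_trans (fW.2 _ _) _; rewrite ler0_norm; lra.
Qed.

Lemma field_curve_diff p Lam W s t : field_curve p Lam W t - field_curve p Lam W s =
  Lam^-1 *: vint (Lam * s) (Lam * t) W.
Proof.
rewrite /field_curve (vint_chasles (Lam * s) 0 (Lam * t)).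
by apply: dot_extl => h; rewrite !dotE; ring.
Qed.

Lemma field_curve_has_velocity a b p Lam W s : 0 < Lam -> tangent_field W ->
  has_velocity a b (field_curve p Lam W) s (W (Lam * s)).
Proof.
move=> Lam0 fW e e0; exists (e / Lam); first by rewrite divr_gt0.
move=> t ts _; rewrite field_curve_diff.
have -> : Lam^-1 *: vint (Lam * s) (Lam * t) W - (t - s) *: W (Lam * s) =
    Lam^-1 *: (vint (Lam * s) (Lam * t) W - (Lam * t - Lam * s) *: W (Lam * s)).
  by apply: dot_extl => h; rewrite !dotE; field; rewrite gt_eqF.
rewrite enormZ gtr0_norm ?invr_gt0 // ler_pdivrMl //.
apply: le_trans (vint_field_approx _ _ fW) _.
rewrite -mulrBr exprMn -(real_normK (num_real (t - s))) !expr2.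
move: ts; rewrite ltr_pdivlMr // => ts.
have -> : Lam * Lam * (`|t - s| * `|t - s|) = Lam * (`|t - s| * Lam * `|t - s|) by ring.
by rewrite ler_pM2l // ler_wpM2r // ltW.
Qed.

Lemma field_curve_velocity p Lam W L s : 0 < Lam -> tangent_field W -> 0 < L -> 0 <= s <= L ->
  curve_derivable 0 L (field_curve p Lam W) s /\
  velocity 0 L (field_curve p Lam W) s = W (Lam * s).
Proof.
move=> Lam0 fW L0 s_in; apply: velocity_of_has_velocity => //.
exact: field_curve_has_velocity.
Qed.

Lemma angle_le_of_cos u v x : enorm u = 1 -> enorm v = 1 -> 0 <= x <= pi ->
  cos x <= dotv u v -> angle u v <= x.
Proof.
move=> u1 v1 xin h; rewrite /angle u1 v1 mulr1 divr1.
have d1 : -1 <= dotv u v <= 1 by rewrite unit_dot_geN1 ?unit_dot_le1 //; exact/enorm1P.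
by apply: le_of_cos_le; rewrite ?acos_ge0 ?acos_lepi // acosK.
Qed.

Lemma sup_norm_le_enorm u : `|u| <= enorm u.
Proof.
rewrite [`|u|]mx_normrE; apply: bigmax_le; first exact: enorm_ge0.
by move=> [i j] _ /=; rewrite (ord1 i); exact: entry_le_enorm.
Qed.

Lemma in_C_field_curve p Lam W T : 0 < Lam -> tangent_field W -> 0 < T ->
  in_C p (p + Lam^-1 *: vint 0 T W) (W 0) (W T) Lam (T / Lam) (field_curve p Lam W).
Proof.
move=> Lam0 fW T0; have L0 : 0 < T / Lam by rewrite divr_gt0.
pose L := T / Lam; rewrite -/L in L0 *.
have LamL : Lam * L = T by rewrite /L mulrC divfK // gt_eqF.
have vel s : 0 <= s <= L -> curve_derivable 0 L (field_curve p Lam W) s /\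
    velocity 0 L (field_curve p Lam W) s = W (Lam * s).
  exact: field_curve_velocity.
have W1 s : enorm (W s) = 1 by apply/enorm1P; exact: fW.1.
have unit s : 0 <= s <= L -> enorm (velocity 0 L (field_curve p Lam W) s) = 1.
  by move=> /vel[_ ->].
have lip s t : enorm (W (Lam * s) - W (Lam * t)) <= Lam * `|s - t|.
  by apply: le_trans (fW.2 _ _) _; rewrite -mulrBr normrM gtr0_norm.
have end0 : 0 <= (0 : R) <= L by rewrite lexx ltW.
have endL : 0 <= L <= L by rewrite lexx ltW.
split.
- split.
    split=> //; first by move=> s; rewrite in_itv /= => /vel[].
    have cW : continuous (fun s => W (Lam * s)).
      move=> s; apply/cvg_ballP => e e0; apply/nbhs_ballP; exists (e / Lam).
        by rewrite /= divr_gt0.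
      move=> t; rewrite /ball /= ltr_pdivlMr // => st; split=> // i j.
      rewrite (ord1 i) /ball /=.
      have := entry_le_enorm (W (Lam * s) - W (Lam * t)) j; rewrite !mxE => h1.
      by apply: le_lt_trans h1 (le_lt_trans (lip s t) _); rewrite mulrC.
    apply: (subspace_eq_continuous (f := fun s => W (Lam * s))).
      by move=> s; rewrite inE /= in_itv /= => /vel[_ e]; exact: esym e.
    exact: continuous_subspaceT.
  have PF : ProperFilter (globally (`[0, L]%classic `*` `[0, L]%classic)).
    by apply: (@globally_properfilter _ _ (0, 0)); split; rewrite /= in_itv.
  apply: (@klipschitzW _ _ _ Lam) => -[s t] /= [].
  rewrite /= !in_itv /= => /vel[_ ->] /vel[_ ->].
  exact: le_trans (sup_norm_le_enorm _) (lip s t).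
- split; last by have [_ ->] := vel 0 end0; rewrite mulr0.
  by rewrite /field_curve mulr0 vint_id scaler0 addr0.
- by split; [rewrite /field_curve LamL|have [_ ->] := vel L endL; rewrite LamL].
- by move=> s; rewrite in_itv; exact: unit.
move=> s; rewrite in_itv /= => s_in; rewrite /curvature /limf_esup.
pose V : set (R * R) := [set z | [/\ 0 <= z.1 <= L, 0 <= z.2 <= L, z.1 != z.2 &
  Lam * `|z.1 - z.2| <= pi]].
apply: le_trans (ereal_inf_lbound _) _.
  exists V => //.
  have d0 : 0 < pi / Lam / 2 by rewrite !divr_gt0 // pi_gt0.
  apply/nbhs_ballP; exists (pi / Lam / 2) => // -[x y] [/= xs ys] [xin yin xy].
  rewrite !in_itv /= in xin yin; split=> //=.
  rewrite mulrC -ler_pdivlMr //; apply: le_trans (ler_distD s x y) _.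
  move: xs ys; rewrite /ball /= (distrC s x) => xs ys.
  rewrite (_ : pi / Lam = pi / Lam / 2 + pi / Lam / 2); last by field; rewrite gt_eqF.
  by apply: lerD; exact: ltW.
apply: ge_ereal_sup => _ [[x y] [/= xin yin xy small] <-].
have xy0 : 0 < `|x - y| by rewrite normr_gt0 subr_eq0.
rewrite lee_fin curve_length_unit_speed // ler_pdivrMr //.
have [_ ->] := vel x xin; have [_ ->] := vel y yin.
apply: angle_le_of_cos => //; first by rewrite small mulr_ge0 // ltW.
have [xy'|/ltW yx] := leP x y.
  rewrite ler0_norm ?subr_le0 // opprB mulrBr in small *.
  by apply: tangent_field_dot_ge => //; rewrite ler_pM2l.
rewrite ger0_norm ?subr_ge0 // mulrBr in small *.
by rewrite dotC; apply: tangent_field_dot_ge => //; rewrite ler_pM2l.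
Qed.

Lemma field_of_in_C p q v w Lam L g : 0 < Lam -> in_C p q v w Lam L g ->
  [/\ 0 < L, forall s, 0 <= s <= L -> enorm (velocity 0 L g s) = 1 &
    exists2 U, tangent_field U & forall s, 0 <= s <= L ->
      velocity 0 L g s = U (Lam * s) /\ g s = field_curve p Lam U s].
Proof.
move=> Lam0 [[[L0 dg _] _] [g0 v0] [gL wL] unit_ curv].
have unit s : 0 <= s <= L -> enorm (velocity 0 L g s) = 1.
  by move=> s_in; apply: unit_; rewrite in_itv.
split=> //.
have lip_eps eps s t : 0 < eps -> 0 <= s <= L -> 0 <= t <= L ->
    enorm (velocity 0 L g s - velocity 0 L g t) <= (Lam + eps) * `|t - s|.
  move=> eps0.
  apply: (@lipschitz_of_local _ (fun s t => enorm (velocity 0 L g s - velocity 0 L g t))).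
  - by move=> x y z; exact: enorm_triangle_sub.
  - by move=> x y; exact: enorm_subC.
  move=> x xin; have cx : (curvature 0 L g x < (Lam + eps)%:E)%E.
    by apply: le_lt_trans (curv x _) _; rewrite ?in_itv // lte_fin ltrDl.
  have [d d0 h] := lipschitz_near_of_curvature unit xin cx.
  exists d => // y yin xy; rewrite (distrC y x); apply: h => //.
  by rewrite subrr normr0.
have lip s t : 0 <= s <= L -> 0 <= t <= L ->
    enorm (velocity 0 L g s - velocity 0 L g t) <= Lam * `|s - t|.
  move=> s_in t_in; apply/ler_addgt0Pr => eps eps0.
  have e0 : 0 < eps / (`|s - t| + 1) by rewrite divr_gt0 // ltr_wpDl.
  apply: le_trans (lip_eps _ s t e0 s_in t_in) _; rewrite distrC mulrDl lerD2l.
  by rewrite mulrAC ler_pdivrMr ?ltr_wpDl // ler_pM2l // lerDl.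
pose cl s := Num.max 0 (Num.min L s).
have cl_in s : 0 <= cl s <= L by rewrite /cl le_max lexx ge_max (ltW L0) ge_min lexx.
have cl_id s : 0 <= s <= L -> cl s = s.
  by move=> /andP[s0 sL]; rewrite /cl min_r // max_r.
pose U x := velocity 0 L g (cl (Lam^-1 * x)).
have fU : tangent_field U.
  split=> [s|s t]; first by apply/enorm1P; exact: unit.
  apply: le_trans (lip _ _ (cl_in _) (cl_in _)) _; rewrite -ler_pdivlMl //.
  apply: le_trans (clamp_lip _ _ _ _) _.
  by rewrite -mulrBr normrM gtr0_norm ?invr_gt0.
have US s : 0 <= s <= L -> velocity 0 L g s = U (Lam * s).
  by move=> s_in; rewrite /U mulKf ?gt_eqF // cl_id.
exists U => // s s_in; split; first exact: US.
(* the two curves have the same velocity, so their difference is constant *)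
have same eps x y : 0 < eps -> 0 <= x <= L -> 0 <= y <= L ->
    enorm ((g x - field_curve p Lam U x) - (g y - field_curve p Lam U y)) <= eps * `|y - x|.
  move=> eps0.
  apply: (@lipschitz_of_local _ (fun x y =>
    enorm ((g x - field_curve p Lam U x) - (g y - field_curve p Lam U y)))).
  - by move=> a b c; exact: enorm_triangle_sub.
  - by move=> a b; exact: enorm_subC.
  move=> a a_in; have e2 : 0 < eps / 2 by rewrite divr_gt0.
  have dga : curve_derivable 0 L g a by apply: dg; rewrite in_itv.
  have [d1 d10 h1] := has_velocity_of_curve dga e2.
  have [d2 d20 h2] := field_curve_has_velocity 0 L p a Lam0 fU e2.
  exists (Num.min d1 d2); first by rewrite lt_min d10.
  move=> b b_in; rewrite lt_min => /andP[/h1/(_ b_in) b1 /h2/(_ b_in) b2].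
  rewrite US // in b1; rewrite enorm_subC.
  have -> : g b - field_curve p Lam U b - (g a - field_curve p Lam U a) =
      (g b - g a - (b - a) *: U (Lam * a)) +
      - (field_curve p Lam U b - field_curve p Lam U a - (b - a) *: U (Lam * a)).
    by apply: dot_extl => h; rewrite !dotE; ring.
  by apply: le_trans (enorm_triangle _ _) _; rewrite enormN; lra.
have z_in : 0 <= (0 : R) <= L by rewrite lexx ltW.
apply/eqP; rewrite -subr_eq0; apply/eqP/enorm_eq0/eqP; rewrite eq_le enorm_ge0 andbT.
apply/ler_addgt0Pr => eps eps0; rewrite add0r.
have e0 : 0 < eps / L by rewrite divr_gt0.
have := same (eps / L) s 0 e0 s_in z_in.
rewrite {2}/field_curve g0 mulr0 vint_id scaler0 addr0 subrr subr0 sub0r normrN => h.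
apply: le_trans h _; rewrite mulrAC ler_pdivrMr // ler_pM2l //.
by case/andP: s_in => s0 sL; rewrite ger0_norm.
Qed.

Lemma shortest_field_of_curve p q v w Lam L g : 0 < Lam -> shortest_in_C p q v w Lam L g ->
  exists2 U, shortest_field (Lam * L) U & forall s, 0 <= s <= L ->
      velocity 0 L g s = U (Lam * s) /\ g s = field_curve p Lam U s.
Proof.
move=> Lam0 [gC gmin]; have [L0 unit [U fU hU]] := field_of_in_C Lam0 gC.
exists U => //; split=> // T' T'0 [W [fW _ W0 WT WV]].
have [_ [g0 v0] [gL wL] _ _] := gC.
have end0 : 0 <= (0 : R) <= L by rewrite lexx ltW.
have endL : 0 <= L <= L by rewrite lexx ltW.
have := in_C_field_curve p Lam0 fW T'0; rewrite W0 WT WV.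
have [vE _] := hU 0 end0; have [wE gE] := hU L endL.
rewrite mulr0 in vE; rewrite -vE -wE v0 wL.
have -> : p + Lam^-1 *: vint 0 (Lam * L) U = q by rewrite -gL gE.
by move=> /gmin; rewrite ler_pdivlMr // mulrC.
Qed.

Lemma line_segment_of_field p Lam U u c d : 0 < Lam -> tangent_field U -> c <= d ->
  (forall x, Lam * c <= x <= Lam * d -> U x = u) ->
  line_segment (field_curve p Lam U @` `[c, d]).
Proof.
move=> Lam0 fU cd line; pose g := field_curve p Lam U.
have cU := tangent_field_vcontinuous fU.
have u1 : dotv u u = 1.
  rewrite -(line (Lam * c)) ?fU.1 // lexx ler_pM2l //.
have gE s : c <= s <= d -> g s = g c + (s - c) *: u.
  move=> /andP[cs sd]; apply/eqP; rewrite addrC -subr_eq; apply/eqP.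
  rewrite field_curve_diff (@eq_vint _ _ _ _ _ (fun=> u)) ?vint_cst //.
  - by rewrite scalerA; congr (_ *: _); field; rewrite gt_eqF.
  - by rewrite ler_pM2l.
  - by apply: tangent_field_vcontinuous; exact: tangent_field_cst.
  - move=> x /andP[h1 h2]; apply: line; rewrite h1 /= (le_trans h2) //.
    by rewrite ler_pM2l.
have gd : g d - g c = (d - c) *: u.
  by rewrite (gE d) ?lexx ?cd // addrAC subrr add0r.
exists (g c), (g d); rewrite gd.
apply/seteqP; split=> [y [s /=]|y [t /=]]; rewrite in_itv /=.
  move=> s_in <-; have [cds|cds] := eqVneq c d.
    exists 0; first by rewrite in_itv /= lexx ler01.
    by rewrite scale0r addr0; congr g; move: s_in; rewrite -cds -eq_le => /eqP.
  have dc : 0 < d - c by rewrite subr_gt0 lt_neqAle cds.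
  exists ((s - c) / (d - c)).
    case/andP: s_in => s1 s2; rewrite in_itv /= divr_ge0 ?subr_ge0 //=.
    by rewrite ler_pdivrMr // mul1r lerD2r.
  by rewrite -/g (gE s) // scalerA divfK // gt_eqF.
move=> /andP[t0 t1] <-; have h : 0 <= t * (d - c) <= d - c.
  by rewrite mulr_ge0 ?subr_ge0 //= ler_piMl // subr_ge0.
exists (c + t * (d - c)); first by rewrite /= in_itv /=; apply/andP; split; lra.
rewrite -/g gE; last by apply/andP; split; lra.
by rewrite scalerA; congr (_ + _ *: _); ring.
Qed.

Lemma circular_arc_of_field p Lam U u e c l : 0 < Lam -> tangent_field U -> orthonormal2 u e ->
  0 <= l -> (forall x, Lam * c <= x <= Lam * (c + l) -> U x = circle u e (x - Lam * c)) ->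
  circular_arc Lam^-1 l (field_curve p Lam U @` `[c, c + l]).
Proof.
move=> Lam0 fU o l0 arc; pose g := field_curve p Lam U.
have cU := tangent_field_vcontinuous fU; have [u1 e1 ue] := o.
exists (g c + Lam^-1 *: e), (- e), u; split.
- by apply/enorm1P; rewrite dotNl dotNr opprK.
- exact/enorm1P.
- by rewrite dotNl dotC ue oppr0.
have gE t : 0 <= t <= l -> g (c + t) = g c + Lam^-1 *: e +
    (Lam^-1 * cos (t / Lam^-1)) *: - e + (Lam^-1 * sin (t / Lam^-1)) *: u.
  move=> /andP[t0 tl].
  have -> : g (c + t) = g c + (g (c + t) - g c) by rewrite [RHS]addrC subrK.
  have lt : Lam * c <= Lam * (c + t) by rewrite ler_pM2l // lerDl.
  have fC : tangent_field (fun x => circle u e (x - Lam * c)).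
    apply: tangent_field_circle => // x y.
    by have -> : x - Lam * c - (y - Lam * c) = x - y by ring.
  rewrite field_curve_diff (eq_vint lt cU (tangent_field_vcontinuous fC)); last first.
    move=> x /andP[h1 h2]; apply: arc; rewrite h1 (le_trans h2) // ler_pM2l //.
    by rewrite lerD2l.
  rewrite vint_circle // subrr (_ : Lam * (c + t) - Lam * c = t * Lam); last by ring.
  rewrite invrK /circle_primitive sin0 cos0.
  by apply: dot_extl => h; rewrite !dotE; ring.
apply/seteqP; split=> [y [s /=]|y [t /=]]; rewrite in_itv /= => /andP[h1 h2] <-.
  exists (s - c); first by rewrite /= in_itv /=; apply/andP; split; lra.
  have s_in : 0 <= s - c <= l by apply/andP; split; lra.
  by rewrite -gE // (_ : c + (s - c) = s) //; ring.
exists (c + t); first by rewrite /= in_itv /=; apply/andP; split; lra.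
by rewrite -/g gE // h1.
Qed.

Lemma circular_arc_of_field_left p Lam U u e c l : 0 < Lam -> tangent_field U ->
  orthonormal2 u e -> 0 <= l ->
  (forall x, Lam * (c - l) <= x <= Lam * c -> U x = circle u e (Lam * c - x)) ->
  circular_arc Lam^-1 l (field_curve p Lam U @` `[c - l, c]).
Proof.
move=> Lam0 fU o l0 arc; pose g := field_curve p Lam U.
have cU := tangent_field_vcontinuous fU; have [u1 e1 ue] := o.
exists (g c - Lam^-1 *: e), e, (- u); split.
- exact/enorm1P.
- by apply/enorm1P; rewrite dotNl dotNr opprK.
- by rewrite dotNr dotC ue oppr0.
have gE t : 0 <= t <= l -> g (c - t) = g c - Lam^-1 *: e +
    (Lam^-1 * cos (t / Lam^-1)) *: e + (Lam^-1 * sin (t / Lam^-1)) *: - u.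
  move=> /andP[t0 tl].
  have -> : g (c - t) = g c - (g c - g (c - t)) by rewrite subKr.
  have lt : Lam * (c - t) <= Lam * c by rewrite ler_pM2l // lerBlDr lerDl.
  have o' : orthonormal2 u (- e) by split; rewrite ?dotNl ?dotNr ?opprK ?ue ?oppr0.
  have fC : tangent_field (fun x => circle u (- e) (x - Lam * c)).
    apply: tangent_field_circle => // x y.
    by have -> : x - Lam * c - (y - Lam * c) = x - y by ring.
  rewrite field_curve_diff (eq_vint lt cU (tangent_field_vcontinuous fC)); last first.
    move=> x /andP[h1 h2]; rewrite arc; last first.
      by rewrite h2 andbT (le_trans _ h1) // ler_pM2l // lerD2l lerN2.
    rewrite /circle -(opprB (Lam * c) x) cosN sinN.
    by rewrite scalerN scaleNr opprK.
  rewrite vint_circle // subrr (_ : Lam * (c - t) - Lam * c = - (t * Lam)); last by ring.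
  rewrite invrK /circle_primitive sin0 cos0 sinN cosN.
  by apply: dot_extl => h; rewrite !dotE; ring.
apply/seteqP; split=> [y [s /=]|y [t /=]]; rewrite in_itv /= => /andP[h1 h2] <-.
  exists (c - s); first by rewrite /= in_itv /=; apply/andP; split; lra.
  have s_in : 0 <= c - s <= l by apply/andP; split; lra.
  by rewrite -gE // (_ : c - (c - s) = s) //; ring.
exists (c - t); first by rewrite /= in_itv /=; apply/andP; split; lra.
by rewrite -/g gE // h1.
Qed.

End Admissible.

(** Strict inequality of the curvature at one point leaves room for a Lipschitz
    constant below the bound near that point, which is the slack required by
    [shortest_arc_line_arc]. *)
Theorem shortest_is_CLC (R : realType) (n : nat) (p q v w : 'rV[R]_n) (Lam L s0 : R)
    (g : R -> 'rV[R]_n) : (2 <= n)%N -> 0 < Lam -> shortest_in_C p q v w Lam L g ->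
  0 <= s0 <= L -> (curvature 0 L g s0 < Lam%:E)%E ->
  exists c d l1 l2, CLC_decomposition Lam g 0 c d L l1 l2.
Proof.
move=> n2 Lam0 gS s0_in kappa; have [U sU hU] := shortest_field_of_curve Lam0 gS.
have [gC _] := gS; have [L0 unit _] := field_of_in_C Lam0 gC.
have [gC11 _ _ _ _] := gC; have [fU mU] := sU.
have T0 : 0 < Lam * L by rewrite mulr_gt0.
have [c1 [c10 c1Lam kappa1]] : exists c1, [/\ 0 <= c1, c1 < Lam & (curvature 0 L g s0 < c1%:E)%E].
  case: (curvature 0 L g s0) kappa => [r| |]; last 2 first.
  - by rewrite ltNge leey.
  - by exists 0; rewrite lexx ltNyr.
  rewrite lte_fin => r_Lam; exists (Num.max 0 ((r + Lam) / 2)).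
  by rewrite lte_fin gt_max !le_max lexx lt_max Lam0; split=> //; try (apply/orP; right); lra.
have [del del0 slack] := lipschitz_near_of_curvature unit s0_in kappa1.
pose lam := c1 / Lam.
have lam1 : 0 <= lam < 1 by rewrite /lam divr_ge0 ?(ltW Lam0) //= ltr_pdivrMr // mul1r.
have r0 : 0 < Lam * (del / 2) by rewrite mulr_gt0 // divr_gt0.
have T_in s : 0 <= s <= Lam * L -> 0 <= Lam^-1 * s <= L.
  by move=> /andP[h1 h2]; rewrite mulr_ge0 ?invr_ge0 ?(ltW Lam0) //= ler_pdivrMl.
have near s : `|s - Lam * s0| <= Lam * (del / 2) -> `|Lam^-1 * s - s0| < del.
  move=> h; apply: (@le_lt_trans _ _ (del / 2)); last by lra.
  have -> : Lam^-1 * s - s0 = Lam^-1 * (s - Lam * s0) by field; rewrite gt_eqF.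
  by rewrite normrM gtr0_norm ?invr_gt0 // ler_pdivrMl.
have s0_in' : 0 <= Lam * s0 <= Lam * L.
  by case/andP: s0_in => h1 h2; rewrite mulr_ge0 ?(ltW Lam0) //= ler_pM2l.
have UV s : 0 <= s <= Lam * L -> U s = velocity 0 L g (Lam^-1 * s).
  by move=> /T_in /hU [-> _]; rewrite mulVKf // gt_eqF.
have [|c [d [u [e [f [[/andP[c0 cd] dT] [oe of_] [c2 d2] line [arc1 arc2]]]]]]] :=
    shortest_arc_line_arc n2 sU T0 s0_in' r0 lam1.
  move=> s t /near hs /near ht s_in t_in; rewrite UV // (UV t) //.
  apply: le_trans (slack _ _ hs ht (T_in _ s_in) (T_in _ t_in)) _.
  by rewrite -mulrBr normrM gtr0_norm ?invr_gt0 // mulrA.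
pose c' := c / Lam; pose d' := d / Lam.
have cE : Lam * c' = c by rewrite /c' mulrC divfK // gt_eqF.
have dE : Lam * d' = d by rewrite /d' mulrC divfK // gt_eqF.
have c'0 : 0 <= c' by rewrite /c' divr_ge0 // ltW.
have cd' : c' <= d' by rewrite -(ler_pM2l Lam0) cE dE ltW.
have d'L : d' <= L by rewrite -(ler_pM2l Lam0) dE.
have im a b : 0 <= a -> b <= L -> g @` `[a, b] = field_curve p Lam U @` `[a, b].
  move=> a0 bL; apply: eq_imagel => s /=; rewrite in_itv /= => /andP[h1 h2].
  by have [] := hU s; rewrite ?(le_trans a0) ?(le_trans h2).
exists c', d', c', (L - d'); split=> //.
- rewrite im //.
  by apply: (line_segment_of_field p (u := u)) => // x; rewrite cE dE; exact: line.
- rewrite im //; last exact: le_trans cd' d'L.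
  split; first by rewrite c'0 /= /c' ltr_pM2r ?invr_gt0 // mulr_natl.
  have := @circular_arc_of_field_left _ _ p Lam U u e c' c' Lam0 fU oe c'0.
  rewrite subrr mulr0 cE; apply; exact: arc1.
- rewrite im //; last exact: le_trans cd'.
  have Ld : 0 <= L - d' by rewrite subr_ge0.
  split.
    rewrite Ld /= ltr_pdivlMr // mulr_natl mulrBl ![_ * Lam]mulrC dE.
    exact: d2.
  have := @circular_arc_of_field _ _ p Lam U u f d' (L - d') Lam0 fU of_ Ld.
  rewrite (_ : d' + (L - d') = L); last by ring.
  by rewrite dE; apply; exact: arc2.
Qed.

Theorem theorem1 (R : realType) (n : nat) (hn : (2 <= n)%N)
  (p q v w : 'rV[R]_n) (hv : enorm v = 1) (hw : enorm w = 1)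
  (Lam : R) (hLam : 0 < Lam) (L : R) (g : R -> 'rV[R]_n)
  (hg : shortest_in_C p q v w Lam L g) :
  (forall s0 : R, s0 \in `[0, L] -> (curvature 0 L g s0 < Lam%:E)%E ->
     exists a0 b0 c d l1 l2 : R,
       [/\ 0 <= a0, b0 <= L, s0 \in `[a0, b0],
           CLC_decomposition Lam g a0 c d b0 l1 l2
         & (0 \in `[a0, c] \/ L \in `[a0, c] \/ pi / Lam <= l1) /\
           (0 \in `[d, b0] \/ L \in `[d, b0] \/ pi / Lam <= l2)]) /\
  (((Lam^-1)%:E <= ball_radius 0 L g)%E ->
     (exists2 s0 : R, s0 \in `[0, L] & (curvature 0 L g s0 < Lam%:E)%E) ->
     CLC_curve Lam 0 L g).
Proof.
split=> [s0|_ [s0]]; rewrite in_itv /= => s0_in kappa.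
  have [c [d [l1 [l2 CLC]]]] := shortest_is_CLC hn hLam hg s0_in kappa.
  have [_ [c0 cd dL] _ _ _] := CLC.
  exists 0, L, c, d, l1, l2; rewrite !in_itv /= !lexx c0 dL s0_in.
  by split=> //; split; [left|right; left].
have [c [d [l1 [l2 CLC]]]] := shortest_is_CLC hn hLam hg s0_in kappa.
by exists c, d, l1, l2.
Qed.
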